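(* Let $\mu\in\mathcal M_0$, and let $A=A_\mu$, $w=w_\mu$ and $F:D^+\to D^+$, $F(\zeta)=e^{w(z(\zeta))}$, be the associated objects. Then $F$ has a holomorphic extension to the unit disk $D$, by reflection: $F(\overline{\zeta})=\overline{F(\zeta)}$. This extended function $F$ is a conformal map from $D$ onto $F(D)\subset D$, with $F(0)=0$ and $F'(0)=A$.
   Context: Jacobi matrices: $\mathcal J_2$ is the set of all Jacobi matrices $(Ju)_n=a_nu_{n+1}+a_{n-1}u_{n-1}+b_nu_n$ on $\ell^2(\mathbb Z)$ with bounded coefficients $a_n\ge 0$, $b_n\in\mathbb R$ and operator norm $\|J\|\le 2$, made into a compact metric space by $d(J,J')=\sum_{n\in\mathbb Z}2^{-|n|}(|a_n-a_n'|+|b_n-b_n'|)$. The shift $S(a,b)_n=(a,b)_{n+1}$ is a homeomorphism of $\mathcal J_2$. $\mathcal M_0$ is the set of $S$-invariant Borel probability measures $\mu$ on $\mathcal J_2$ with $\int\ln a_0(J)\,d\mu(J)>-\infty$. For $\mu\in\mathcal M_0$, $A_\mu>0$ is defined by $\ln A_\mu=\int\ln a_0\,d\mu$; the density of states measure $dk=dk_\mu$ is the probability measure on $[-2,2]$ with $\int f\,dk=\int d\mu(J)\int f(t)\,d\rho_0(t;J)$ for all $f\in C[-2,2]$, where $d\rho_0(t;J)=d\|E_J(t)\delta_0\|^2$ is the spectral measure of $J$ and $\delta_0$; and for $z\in\mathbb C^+$ (open upper half plane) $$w_\mu(z)=\ln A_\mu-\int_{[-2,2]}\ln(t-z)\,dk(t),$$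 with the branch of the logarithm satisfying $\mathrm{Im}\,\ln\zeta\in(-\pi,0)$ for $\zeta$ in the open lower half plane. One has $\mathrm{Re}\,w_\mu<0$ and $0<\mathrm{Im}\,w_\mu<\pi$ on $\mathbb C^+$. $D=\{|z|<1\}$ is the unit disk, $D^+=D\cap\mathbb C^+$, and $z(\zeta)=-\zeta-1/\zeta$, which maps $D^+$ conformally onto $\mathbb C^+$. A conformal map is a holomorphic bijection between domains (connected open sets). *)

(* Defs.v *)
From HB Require Import structures.
From mathcomp Require Import all_boot all_order all_algebra.
From mathcomp Require Import all_classical all_reals all_analysis.
From mathcomp Require Import complex.

Set Implicit Arguments.
Unset Strict Implicit.
Unset Printing Implicit Defensive.

Import Order.TTheory GRing.Theory Num.Theory.
Import numFieldNormedType.Exports.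

Local Open Scope classical_set_scope.
Local Open Scope ring_scope.
Local Open Scope complex_scope.

Section ell2.
Variable R : realType.
Implicit Types u v : int -> R[i].

Definition l2sq u : \bar R :=
  \esum_(n in [set: int]) (Normc.normc (u n) ^+ 2)%:E.

Definition l2norm u : \bar R := sqrte (l2sq u).

Definition l2 u : Prop := (l2sq u < +oo)%E.

(* Meaningful for absolutely summable families only: positive part minus
   negative part. *)
Definition sumZ (x : int -> R) : R :=
  fine (\esum_(n in [set: int]) (Num.max (x n) 0)%:E)
  - fine (\esum_(n in [set: int]) (Num.max (- x n) 0)%:E).

Definition l2dot u v : R[i] :=
  sumZ (fun n => complex.Re ((u n)^* * v n)) +i* sumZ (fun n => complex.Im ((u n)^* * v n)).

Definition delta0 : int -> R[i] := fun n => (n == 0)%:R.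

Definition opnorm (T : (int -> R[i]) -> (int -> R[i])) : \bar R :=
  ereal_sup [set l2norm (T u) | u in [set u | (l2norm u <= 1)%E]].

Definition jacobi_op (a b : int -> R) u : int -> R[i] :=
  fun n => (a n)%:C * u (n + 1) + (a (n - 1))%:C * u (n - 1) + (b n)%:C * u n.

End ell2.
Arguments delta0 {R}.

Record jacobi (R : realType) := Jacobi {
  ja : int -> R;
  jb : int -> R;
  ja_ge0 : forall n, 0 <= ja n;
  jab_bounded : exists M, forall n, ja n <= M /\ `|jb n| <= M;
  jab_norm : (opnorm (jacobi_op ja jb) <= 2%:E)%E }.

Definition jop (R : realType) (J : jacobi R) := jacobi_op (ja J) (jb J).

Section jacobi_space.
Variable R : realType.
Implicit Types J : jacobi R.

Lemma jacobi_eq J J' : ja J = ja J' -> jb J = jb J' -> J = J'.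
Proof.
case: J J' => [a b p q r] [a' b' p' q' r'] /= ea eb.
subst a' b'; congr Jacobi; exact: Prop_irrelevance.
Qed.

Definition jdist_term J J' (n : int) : R :=
  2 ^- `|n|%N * (`|ja J n - ja J' n| + `|jb J n - jb J' n|).

Definition jdist J J' : R :=
  fine (\esum_(n in [set: int]) (jdist_term J J' n)%:E).

Lemma jdist_term_ge0 J J' n : 0 <= jdist_term J J' n.
Proof. by rewrite mulr_ge0 ?addr_ge0// invr_ge0 exprn_ge0. Qed.

Lemma esum_geo_fin :
  ((\esum_(n in [set: int]) (2 ^- `|n|%N : R)%:E) < +oo)%E.
Proof.
have g0 (n : int) : (0 <= (2 ^- `|n|%N : R)%:E)%E.
  by rewrite lee_fin invr_ge0 exprn_ge0.
have H : (\sum_(k <oo) (2 ^- k : R)%:E < +oo)%E.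
  rewrite (_ : (fun=> _) = EFin \o (series (geometric (1:R) (2^-1)))).
    apply: (@le_lt_trans _ _ (2%:R)%:E); last exact: ltry.
    have cs : series (geometric (1:R) (2^-1)) @ \oo --> (1 * (1 - 2^-1)^-1 : R).
      apply: cvg_geometric_series.
      by rewrite ger0_norm ?invr_ge0// invf_lt1// ltr1n.
    rewrite EFin_lim; last by apply/cvg_ex; eexists; exact: cs.
    rewrite (cvg_lim _ cs)// lee_fin mul1r.
    have -> : (1 - 2^-1 : R) = 2^-1 by rewrite [X in X - _](splitr 1) mul1r addrK.
    by rewrite invrK.
  apply/funext => n /=; rewrite /series/= -sumEFin.
  by apply: eq_bigr => k _; rewrite mul1r exprVn.
have e1 : (\esum_(k in [set: nat]) (2 ^- k : R)%:E < +oo)%E.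
  rewrite -nneseries_esumT; first exact: H.
  by move=> n; rewrite lee_fin invr_ge0 exprn_ge0.
rewrite (esumID (range Posz))// !setTI.
have -> : ~` range Posz = range Negz.
  apply/seteqP; split => [[n|n] /= h|_ /= [n _ <-] [m _]]//; last by exists n.
  by exfalso; apply: h; exists n.
rewrite !esum_image; [|by move=> m n _ _ []|by move=> m n _ _ []].
rewrite lte_add_pinfty//; apply: le_lt_trans e1.
rewrite [leRHS](esumID (range S))// !setTI.
rewrite (@esum_image R nat nat _ S); last by move=> m n _ _ [].
by apply: leeDl; apply: esum_ge0 => n _; rewrite lee_fin invr_ge0 exprn_ge0.
Qed.

Lemma jdist_term_summable J J' :
  ((\esum_(n in [set: int]) (jdist_term J J' n)%:E) < +oo)%E.
Proof.
have [M HM] := jab_bounded J; have [M' HM'] := jab_bounded J'.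
pose C := (M + M' + (M + M')).
have MM' : 0 <= M + M'.
  by rewrite addr_ge0// (le_trans (normr_ge0 _) (HM 0).2, le_trans (normr_ge0 _) (HM' 0).2).
have C0 : 0 <= C by rewrite addr_ge0.
have tle n : jdist_term J J' n <= C * 2 ^- `|n|%N.
  rewrite /jdist_term mulrC ler_wpM2r ?invr_ge0 ?exprn_ge0// lerD//.
    rewrite (le_trans (ler_normB _ _))// lerD//.
      by rewrite ger0_norm ?ja_ge0// (HM n).1.
    by rewrite ger0_norm ?ja_ge0// (HM' n).1.
  by rewrite (le_trans (ler_normB _ _))// lerD// ?(HM n).2 ?(HM' n).2.
apply: (@le_lt_trans _ _
    (C%:E * \esum_(n in [set: int]) (2 ^- `|n|%N : R)%:E)%E); last first.
  by apply: lte_mul_pinfty => //; exact: esum_geo_fin.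
apply: ge_ereal_sup => _ [A [finA _] <-].
apply: (@le_trans _ _ (\sum_(n \in A) (C%:E * (2 ^- `|n|%N : R)%:E))%E).
  by rewrite lee_fsum// => n _; rewrite -EFinM lee_fin.
rewrite -ge0_mule_fsumr; last first.
  by move=> n; rewrite lee_fin invr_ge0 exprn_ge0.
rewrite lee_wpmul2l ?lee_fin//.
by apply: ereal_sup_ubound; exists A.
Qed.

Lemma jdistE J J' :
  (jdist J J')%:E = \esum_(n in [set: int]) (jdist_term J J' n)%:E.
Proof.
rewrite fineK// ge0_fin_numE ?jdist_term_summable//.
by apply: esum_ge0 => n _; rewrite lee_fin jdist_term_ge0.
Qed.

Lemma jdistxx J : jdist J J = 0.
Proof.
rewrite /jdist esum1// => n _.
by rewrite /jdist_term !subrr normr0 addr0 mulr0.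
Qed.

Lemma jdist_sym J J' : jdist J J' = jdist J' J.
Proof.
congr fine; apply: eq_esum => n _; congr EFin.
by rewrite /jdist_term distrC [X in _ + X]distrC.
Qed.

Lemma jdist_triangle J' J J'' : jdist J J'' <= jdist J J' + jdist J' J''.
Proof.
rewrite -lee_fin EFinD !jdistE -esumD; last 2 first.
- by move=> n _; rewrite lee_fin jdist_term_ge0.
- by move=> n _; rewrite lee_fin jdist_term_ge0.
apply: le_esum => n _; rewrite -EFinD lee_fin -mulrDr.
by rewrite ler_wpM2l ?invr_ge0 ?exprn_ge0// addrACA lerD// ler_distD.
Qed.

Lemma jdist_positivity J J' : jdist J J' = 0 -> J = J'.
Proof.
move=> d0.
have t0 n : jdist_term J J' n = 0.
  apply/eqP; rewrite eq_le jdist_term_ge0 andbT -lee_fin -d0 jdistE.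
  by apply: ereal_sup_ubound; exists [set n]; [split|rewrite fsbig_set1].
have p2 (n : int) : (2 ^- `|n|%N : R) != 0 by rewrite invr_eq0 expf_neq0.
apply: jacobi_eq; apply/funext => n; have /eqP := t0 n;
  rewrite mulf_eq0 (negbTE (p2 n))/= paddr_eq0// => /andP[/eqP h1 /eqP h2];
  by apply/eqP; rewrite -subr_eq0 -normr_eq0 ?h1 ?h2.
Qed.

HB.instance Definition _ := gen_eqMixin (jacobi R).
HB.instance Definition _ := gen_choiceMixin (jacobi R).

Fact jacobi0_bounded :
  exists M : R, forall n : int, (0 : R) <= M /\ `|(0 : R)| <= M.
Proof. by exists 0 => n; rewrite normr0. Qed.

Fact jacobi0_norm :
  (opnorm (@jacobi_op R (fun=> 0%R) (fun=> 0%R)) <= 2%:E)%E.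
Proof.
apply: ge_ereal_sup => _ [u _ <-].
rewrite /l2norm /l2sq esum1 ?sqrte0// => n _.
by rewrite /jacobi_op !mul0r !addr0 Normc.normc0 expr0n.
Qed.

(* The zero matrix: an arbitrary point, required by [measurableType]. *)
HB.instance Definition _ := isPointed.Build (jacobi R)
  (@Jacobi R (fun=> 0) (fun=> 0) (fun=> lexx 0) jacobi0_bounded jacobi0_norm).

HB.instance Definition _ := @isMetric.Build R (jacobi R)
  jdist jdistxx jdist_positivity jdist_sym jdist_triangle.

Lemma l2sq_shift (u : int -> R[i]) (m : int) : l2sq (fun n => u (n + m)) = l2sq u.
Proof.
rewrite /l2sq [RHS](reindex_esum setT _ (fun n => n + m))//.
split => //; first by move=> x y _ _ /addIr.
by move=> y _ /=; exists (y - m) => //; rewrite subrK.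
Qed.

Fact jshift_bounded J :
  exists M, forall n, ja J (n + 1) <= M /\ `|jb J (n + 1)| <= M.
Proof. by have [M HM] := jab_bounded J; exists M. Qed.

Fact jshift_norm J :
  (opnorm (jacobi_op (fun n => ja J (n + 1)) (fun n => jb J (n + 1)))
    <= 2%:E)%E.
Proof.
apply: ge_ereal_sup => _ [u u1 <-]; apply: le_trans (jab_norm J).
apply: ereal_sup_ubound; exists (fun n => u (n - 1)).
  by rewrite /= /l2norm l2sq_shift.
rewrite /l2norm -[in LHS](l2sq_shift _ 1); congr (sqrte (l2sq _)).
by apply/funext => n; rewrite /jacobi_op !addrK.
Qed.

Definition jshift J : jacobi R :=
  @Jacobi R (fun n => ja J (n + 1)) (fun n => jb J (n + 1))
    (fun n => ja_ge0 J (n + 1)) (jshift_bounded J) (jshift_norm J).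

End jacobi_space.

Definition jacobi_borel (R : realType) : Type :=
  g_sigma_algebraType (@open (jacobi R)).
HB.instance Definition _ (R : realType) :=
  Measurable.on (jacobi_borel R).

Section spectral.
Variable R : realType.

(* [E t] stands for the spectral projection of the half-line ]-oo, t]; the
   conditions only concern the restriction of [E t] to l^2. *)
Record spectral_family (E : R -> (int -> R[i]) -> (int -> R[i])) : Prop := {
  sf_l2 : forall t u, l2 u -> l2 (E t u);
  sf_linear : forall t (c : R[i]) u v, l2 u -> l2 v ->
    E t (fun n => c * u n + v n) = (fun n => c * E t u n + E t v n);
  sf_selfadjoint : forall t u v, l2 u -> l2 v ->
    l2dot (E t u) v = l2dot u (E t v);
  sf_mul : forall s t u, l2 u -> E s (E t u) = E (Num.min s t) u;
  sf_right_continuous : forall t u, l2 u ->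
    l2norm (fun n => E s u n - E t u n) @[s --> t^'+] --> 0%E;
  sf_ninfty : forall u, l2 u -> l2norm (E s u) @[s --> -oo%R] --> 0%E;
  sf_pinfty : forall u, l2 u ->
    l2norm (fun n => E s u n - u n) @[s --> +oo%R] --> 0%E }.

(* The Lebesgue-Stieltjes measure d||E(t)u||^2. *)
Definition stieltjes_of (E : R -> (int -> R[i]) -> (int -> R[i]))
    (u : int -> R[i]) (rho : {measure set (measurableTypeR R) -> \bar R}) : Prop :=
  forall t : R, rho `]-oo, t]%classic = l2sq (E t u).

(* J = \int t dE(t), in the weak sense. *)
Definition spectral_resolution (J : jacobi R)
    (E : R -> (int -> R[i]) -> (int -> R[i])) : Prop :=
  spectral_family E /\
  forall u, l2 u ->
    exists rho : {measure set (measurableTypeR R) -> \bar R},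
      [/\ stieltjes_of E u rho,
          rho.-integrable setT (fun t : measurableTypeR R => (t : R)%:E) &
          l2dot u (jop J u) = (\int[rho]_t t)%R%:C].

(* rho_0( . ; J), the measure d||E_J(t) delta_0||^2. *)
Definition spectral_measure0 (J : jacobi R)
    (rho : {measure set (measurableTypeR R) -> \bar R}) : Prop :=
  exists E, spectral_resolution J E /\ stieltjes_of E delta0 rho.

End spectral.

Section invariant_measures.
Variable R : realType.
Implicit Types (mu : probability (jacobi_borel R) R)
  (k : probability (measurableTypeR R) R).

Definition shift_invariant mu : Prop :=
  forall B : set (jacobi_borel R), measurable B ->
    mu (@jshift R @^-1` B) = mu B.

(* [lne] is the extended logarithm, with value -oo at 0, whereas [ln 0 = 0]. *)
Definition int_ln_a0 mu : \bar R :=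
  (\int[mu]_J lne (ja (J : jacobi R) 0)%:E)%E.

Definition M0 mu : Prop := shift_invariant mu /\ (-oo < int_ln_a0 mu)%E.

Definition Amu mu : R := expR (fine (int_ln_a0 mu)).

Definition I22 : set R := `[-2, 2]%classic.

Definition density_of_states mu k : Prop :=
  k I22 = 1%E /\
  exists rho : jacobi R -> {measure set (measurableTypeR R) -> \bar R},
    (forall J, spectral_measure0 J (rho J)) /\
    forall f : R -> R, {within I22, continuous f} ->
      (\int[k]_(t in I22) (f t)%:E =
       \int[mu]_J \int[rho J]_(t in I22) (f t)%:E)%E.

Definition cexp (z : R[i]) : R[i] :=
  (expR (complex.Re z) * cos (complex.Im z))
    +i* (expR (complex.Re z) * sin (complex.Im z)).

(* Used on the lower half plane only, where it is the branch of the logarithm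
   with imaginary part in ]-pi, 0[: see [lower_logP]. *)
Definition lower_log (z : R[i]) : R[i] :=
  ln (Normc.normc z) +i* (- acos (complex.Re z / Normc.normc z)).

Lemma lower_logP (z : R[i]) : complex.Im z < 0 ->
  [/\ cexp (lower_log z) = z, - pi < complex.Im (lower_log z) &
      complex.Im (lower_log z) < 0].
Proof.
case: z => x y /= y0.
have y2 : 0 < y ^+ 2 by rewrite exprn_even_gt0//= lt_eqF.
have s0 : 0 < x ^+ 2 + y ^+ 2 by rewrite ltr_wpDl ?sqr_ge0.
set r := Num.sqrt (x ^+ 2 + y ^+ 2); have r0 : 0 < r by rewrite sqrtr_gt0.
have r2 : r ^+ 2 = x ^+ 2 + y ^+ 2 by rewrite sqr_sqrtr// ltW.
have xr2 : (x / r) ^+ 2 < 1.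
  by rewrite expr_div_n ltr_pdivrMr ?exprn_gt0// mul1r r2 ltrDl.
have /andP[xr1 xr1'] : -1 < x / r < 1.
  by rewrite -ltr_norml -(expr_lt1 (n := 2))// real_normK// num_real.
have acos0 : 0 < acos (x / r) by rewrite acos_gt0// ltW.
have acospi : acos (x / r) < pi by rewrite acos_ltpi// xr1 ltW.
split; rewrite /lower_log /cexp /= -/r ?ltrN2 ?oppr_lt0//.
rewrite cosN sinN lnK ?posrE// acosK ?in_itv/= ?ltW//.
rewrite sin_acos ?ltW//; congr (_ +i* _).
  by rewrite mulrC divfK// gt_eqF.
rewrite (_ : 1 - (x / r) ^+ 2 = (- y / r) ^+ 2).
  by rewrite sqrtr_sqr ger0_norm ?divr_ge0 ?oppr_ge0 ?ltW// mulrN mulrC divfK ?opprK// gt_eqF.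
rewrite !expr_div_n sqrrN -[1](divff (x := r ^+ 2)); last by rewrite gt_eqF// exprn_gt0.
by rewrite -mulrBl {1}r2 addrAC subrr add0r.
Qed.

Definition w mu k (z : R[i]) : R[i] :=
  (ln (Amu mu))%:C
  - ((\int[k]_(t in I22) complex.Re (lower_log (t%:C - z)))%R
     +i* (\int[k]_(t in I22) complex.Im (lower_log (t%:C - z)))%R).

Definition zmap (zeta : R[i]) : R[i] := - zeta - zeta^-1.

Definition Fmap mu k (zeta : R[i]) : R[i] := cexp (w mu k (zmap zeta)).

End invariant_measures.

Section conformal.
Variable R : realType.

(* [R[i]^o] carries the topology of the norm of the field [R[i]]; a derivative
   along 1 over the scalars [R[i]] is a complex derivative. *)
Definition disk : set R[i]^o := [set z | `|z| < 1].

Definition half_disk : set R[i]^o := [set z | disk z /\ 0 < complex.Im z].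

Definition holomorphic_on (U : set R[i]^o) (f : R[i]^o -> R[i]^o) : Prop :=
  forall z, U z -> derivable f z 1.

Definition domain (U : set R[i]^o) : Prop := open U /\ connected U.

Definition conformal_map (U V : set R[i]^o) (f : R[i]^o -> R[i]^o) : Prop :=
  [/\ domain U, domain V, holomorphic_on U f & set_bij U V f].

End conformal.
Arguments disk {R}.
Arguments half_disk {R}.

(* Main.v *)
Require Import Defs.
From HB Require Import structures.
From mathcomp Require Import spectral sesquilinear.
From mathcomp Require Import all_boot all_order all_algebra.
From mathcomp Require Import all_classical all_reals all_analysis.
From mathcomp Require Import measurable_realfun complex.
From mathcomp Require Import ring lra zify.

Set Implicit Arguments.
Unset Strict Implicit.
Unset Printing Implicit Defensive.

Import Order.TTheory GRing.Theory Num.Theory.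
Import numFieldNormedType.Exports.

Local Open Scope classical_set_scope.
Local Open Scope ring_scope.
Local Open Scope complex_scope.

(** On D^+ put z = - zeta - 1/zeta, so that t - z = (1 + t zeta + zeta^2) / zeta,
    and the quadratic factors as (1 - zeta e)(1 - zeta e') where |e| = 1 and e' is
    the conjugate of e.  Hence
    F(zeta) = A zeta exp(- \int L_t(zeta) dk(t)), where
    L_t(zeta) = ln (1 - zeta e) + ln (1 - zeta e'), and this formula makes sense
    on the whole disk, is symmetric under conjugation, and has derivative
    A exp(- \int L_t dk) (1 - zeta^2) \int dk(t) / (1 + t zeta + zeta^2),
    which does not vanish.

    That F maps D^+ into D^+ amounts to Re w < 0 and 0 < Im w < pi.  For the
    first, let p_n(z) be the characteristic polynomials of the truncations of J;
    the ratios r_n = p_(n+1) / p_n satisfy a Riccati recursion which gives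
    ln |p_n|^2 >= 2 sum_(j < n) ln a_j + n c + O(1) with c > 0; approximating
    ln |z - t|^2 by polynomials in t and integrating over mu, this becomes
    \int ln |z - t|^2 dk > 2 ln A.

    The function w is injective by the Noshiro-Warschawski argument, so F is
    injective on D^+ and, by reflection, on D^-; on ]-1, 1[ it is real and
    increasing, and the three parts have images separated by the sign of Im F.
    Finally F(D) is open because an interior minimum of |F - w| over a small square
    must be a zero of F - w, as F' does not vanish. *)

(** * Sums over the integers and Jacobi operators *)

(** A spectral resolution is only required to satisfy <u, J u> = \int t d||E(t)u||^2 for each u,
    while the estimate needs the moments <delta_0, J^n delta_0>: these depend on finitely many
    coefficients and so compare with traces of powers of truncations. To pass from n = 1 to all n, E
    is shown to commute with J; on the range of the projection of a short interval ]a, b], both J^n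
    and t^n then differ from b^n by O(b - a), and bisection removes the error. The finite volume
    estimate is integrated at fixed N. Shift invariance turns the sum over sites into N times a
    mean, and the boundary terms stay bounded as N grows. The polynomials lie above ln |z - t|^2,
    since the estimate compares them at the eigenvalues of the truncations, which lie in [-2, 2].
    The rate c = y / (y + 4 / y) with y = Im z is what leaves room for the approximation error and
    keeps Re w < 0 strict. On the analytic side every logarithm is moved into the right half plane,
    where products are controlled by the size of the arguments, and every derivative comes with an
    explicit quadratic remainder. *)

Section sum_over_Z.
Variable R : realType.
Implicit Types x y p q : int -> R.

Definition esumZ x : \bar R := \esum_(n in [set: int]) (x n)%:E.

Lemma esumZ_ge0 x : (forall n, 0 <= x n) -> (0 <= esumZ x)%E.
Proof. by move=> x0; apply: esum_ge0 => n _; rewrite lee_fin. Qed.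

Lemma esumZD x y : (forall n, 0 <= x n) -> (forall n, 0 <= y n) ->
  esumZ (fun n => x n + y n) = (esumZ x + esumZ y)%E.
Proof. by move=> x0 y0; rewrite /esumZ -esumD// => n _; rewrite lee_fin. Qed.

Lemma le_esumZ x y : (forall n, x n <= y n) -> (esumZ x <= esumZ y)%E.
Proof. by move=> xy; apply: le_esum => n _; rewrite lee_fin. Qed.

Lemma esumZ_scale (c : R) x : 0 <= c -> (forall n, 0 <= x n) ->
  esumZ (fun n => c * x n) = (c%:E * esumZ x)%E.
Proof.
move=> c0 x0; rewrite /esumZ /esum -ereal_supZl//; last first.
  by apply/set0P; exists 0%E; exists set0; [exact: fsets_set0|rewrite fsbig_set0].
congr ereal_sup.
have E A : (\sum_(i \in A) (c * x i)%:E = c%:E * \sum_(i \in A) (x i)%:E)%E.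
  by rewrite ge0_mule_fsumr.
apply/seteqP; split => [_ [A fA <-]|_ [_ [A fA <-] <-]].
  by rewrite E; exists (\sum_(i \in A) (x i)%:E)%E => //; exists A.
by exists A => //; rewrite E.
Qed.

Lemma esumZ_shift x (m : int) : esumZ (fun n => x (n + m)) = esumZ x.
Proof.
rewrite /esumZ [RHS](reindex_esum setT _ (fun n => n + m))//.
split => //; first by move=> i j _ _ /addIr.
by move=> j _ /=; exists (j - m) => //; rewrite subrK.
Qed.

Lemma esumZ_fin_num x : (forall n, 0 <= x n) -> (esumZ x < +oo)%E ->
  esumZ x \is a fin_num.
Proof. by move=> x0 xoo; rewrite ge0_fin_numE// esumZ_ge0. Qed.

Lemma esumZ_ge_term x (n : int) : (forall n, 0 <= x n) -> ((x n)%:E <= esumZ x)%E.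
Proof.
move=> x0; apply: ereal_sup_ubound; exists [set n]; last by rewrite fsbig_set1.
by split.
Qed.

Definition summableZ x : Prop := (esumZ (fun n => `|x n|%R) < +oo)%E.

Lemma summableZ_le x y : (forall n, `|x n| <= y n) -> (esumZ y < +oo)%E -> summableZ x.
Proof. by move=> xy; apply: le_lt_trans; exact: le_esumZ. Qed.

Lemma summableZD x y : summableZ x -> summableZ y -> summableZ (fun n => x n + y n).
Proof.
move=> sx sy; apply: (@summableZ_le _ (fun n => `|x n| + `|y n|)).
  by move=> n; exact: ler_normD.
by rewrite esumZD// lte_add_pinfty.
Qed.

Lemma sumZ_ge0E x : (forall n, 0 <= x n) -> (esumZ x < +oo)%E ->
  (sumZ x)%:E = esumZ x.
Proof.
move=> x0 xoo; rewrite /sumZ EFinB [X in (_ - X%:E)%E](_ : _ = 0) ?sube0.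
  rewrite (eq_esum (b := fun n => (x n)%:E)); first by rewrite fineK// esumZ_fin_num.
  by move=> n _; congr EFin; apply/max_idPl.
rewrite esum1// => n _; congr EFin; apply/max_idPr.
by rewrite oppr_le0.
Qed.

(** With xp, xn the positive and negative parts, xp + q = xn + p termwise, so every decomposition
    into nonnegative summable families gives the same difference. Additivity of [sumZ] rests on this
    freedom. *)
Lemma sumZ_sub x p q : (forall n, 0 <= p n) -> (forall n, 0 <= q n) ->
  (esumZ p < +oo)%E -> (esumZ q < +oo)%E -> (forall n, x n = p n - q n) ->
  sumZ x = fine (esumZ p) - fine (esumZ q).
Proof.
move=> p0 q0 poo qoo xE.
pose xp n := Num.max (x n) 0; pose xn n := Num.max (- x n) 0.
have xp0 n : 0 <= xp n by rewrite le_max lexx orbT.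
have xn0 n : 0 <= xn n by rewrite le_max lexx orbT.
have xpoo : (esumZ xp < +oo)%E.
  by apply: le_lt_trans poo; apply: le_esumZ => n; rewrite ge_max p0 andbT xE gerBl.
have xnoo : (esumZ xn < +oo)%E.
  apply: le_lt_trans qoo; apply: le_esumZ => n.
  by rewrite ge_max q0 andbT xE opprB gerBl.
have xpn n : xp n - xn n = x n.
  rewrite /xp /xn; case: (leP (x n) 0) => h; case: (leP (- x n) 0) => h'; lra.
have : (esumZ xp + esumZ q = esumZ xn + esumZ p)%E.
  rewrite -!esumZD//; congr esumZ; apply/funext => n.
  by have := xpn n; rewrite (xE n); lra.
move/(congr1 fine); rewrite !fineD ?esumZ_fin_num//.
rewrite /sumZ -/(esumZ xp) -/(esumZ xn); lra.
Qed.

Lemma sumZE x : summableZ x ->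
  sumZ x = fine (esumZ (fun n => Num.max (x n) 0))
           - fine (esumZ (fun n => Num.max (- x n) 0)).
Proof. by []. Qed.

Lemma pos_part_lty x : summableZ x -> (esumZ (fun n => Num.max (x n) 0)%R < +oo)%E.
Proof.
by apply: le_lt_trans; apply: le_esumZ => n; rewrite ge_max normr_ge0 ler_norm.
Qed.

Lemma neg_part_lty x : summableZ x -> (esumZ (fun n => Num.max (- x n) 0)%R < +oo)%E.
Proof.
by apply: le_lt_trans; apply: le_esumZ => n; rewrite ge_max normr_ge0 -normrN ler_norm.
Qed.

Lemma max0_ge0 (a : R) : 0 <= Num.max a 0.
Proof. by rewrite le_max lexx orbT. Qed.

Lemma max0B (a : R) : Num.max a 0 - Num.max (- a) 0 = a.
Proof. case: (leP a 0) => h; case: (leP (- a) 0) => h'; lra. Qed.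

Lemma sumZD x y : summableZ x -> summableZ y ->
  sumZ (fun n => x n + y n) = sumZ x + sumZ y.
Proof.
move=> sx sy.
rewrite (@sumZ_sub _ (fun n => Num.max (x n) 0 + Num.max (y n) 0)
                     (fun n => Num.max (- x n) 0 + Num.max (- y n) 0)).
- rewrite !esumZD; try by move=> n; exact: max0_ge0.
  rewrite !fineD; try (apply: esumZ_fin_num;
    [by move=> n; exact: max0_ge0|by [exact: pos_part_lty|exact: neg_part_lty]]).
  by rewrite !sumZE//; lra.
- by move=> n; rewrite addr_ge0// max0_ge0.
- by move=> n; rewrite addr_ge0// max0_ge0.
- by rewrite esumZD ?lte_add_pinfty//; try exact: pos_part_lty; move=> n; exact: max0_ge0.
- by rewrite esumZD ?lte_add_pinfty//; try exact: neg_part_lty; move=> n; exact: max0_ge0.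
- move=> n; have := max0B (x n); have := max0B (y n); lra.
Qed.

Lemma sumZN x : sumZ (fun n => - x n) = - sumZ x.
Proof.
rewrite /sumZ opprB; congr (fine _ - fine _).
by apply: eq_esum => n _; rewrite opprK.
Qed.

Lemma sumZ_shift x (m : int) : sumZ (fun n => x (n + m)) = sumZ x.
Proof.
rewrite /sumZ; congr (fine _ - fine _).
- exact: (esumZ_shift (fun n => Num.max (x n) 0)).
- exact: (esumZ_shift (fun n => Num.max (- x n) 0)).
Qed.

Lemma sumZ1 (c : R) (m : int) : sumZ (fun n => if n == m then c else 0) = c.
Proof.
have h (d : R) : esumZ (fun n => Num.max (if n == m then d else 0) 0) = (Num.max d 0)%:E.
  rewrite /esumZ -(esum_set1 (t := m) (a := fun=> (Num.max d 0)%:E)) ?lee_fin ?max0_ge0//.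
  rewrite [RHS]esum_mkcond; apply: eq_esum => n _.
  have -> : (n \in [set m]) = (n == m) by apply/idP/eqP; rewrite inE.
  by case: eqP => //= _; rewrite maxxx.
rewrite /sumZ -/(esumZ _) h (eq_esum (b := fun n => (Num.max (if n == m then - c else 0) 0)%:E)).
  by rewrite -/(esumZ _) h /= max0B.
by move=> n _; case: ifP => //; rewrite oppr0.
Qed.

End sum_over_Z.

(** * Square summable sequences as a real inner product space *)

Section ell2_real.
Variable R : realType.
Implicit Types u v w : int -> R[i].

Definition nsq (z : R[i]) : R := complex.Re z ^+ 2 + complex.Im z ^+ 2.

Lemma nsq_ge0 z : 0 <= nsq z.
Proof. by rewrite addr_ge0 ?sqr_ge0. Qed.

Lemma normc_sqr (z : R[i]) : Normc.normc z ^+ 2 = nsq z.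
Proof. by case: z => x y; rewrite /= sqr_sqrtr// addr_ge0 ?sqr_ge0. Qed.

Lemma cReD (z z' : R[i]) : complex.Re (z + z') = complex.Re z + complex.Re z'.
Proof. by case: z; case: z'. Qed.
Lemma cImD (z z' : R[i]) : complex.Im (z + z') = complex.Im z + complex.Im z'.
Proof. by case: z; case: z'. Qed.
Lemma cReN (z : R[i]) : complex.Re (- z) = - complex.Re z.
Proof. by case: z. Qed.
Lemma cImN (z : R[i]) : complex.Im (- z) = - complex.Im z.
Proof. by case: z. Qed.
Lemma cReM (z z' : R[i]) : complex.Re (z * z') =
  complex.Re z * complex.Re z' - complex.Im z * complex.Im z'.
Proof. by case: z; case: z'. Qed.
Lemma cImM (z z' : R[i]) : complex.Im (z * z') =
  complex.Re z * complex.Im z' + complex.Im z * complex.Re z'.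
Proof. by case: z; case: z'. Qed.
Definition ReImE := (cReD, cImD, cReN, cImN, cReM, cImM).

Lemma l2sqE u : l2sq u = esumZ (fun n => nsq (u n)).
Proof. by apply: eq_esum => n _; rewrite normc_sqr. Qed.

Lemma l2sq_ge0 u : (0 <= l2sq u)%E.
Proof. by rewrite l2sqE esumZ_ge0// => n; exact: nsq_ge0. Qed.

Lemma l2sq_scale (c : R) u : l2sq (fun n => c%:C * u n) = ((c ^+ 2)%:E * l2sq u)%E.
Proof.
rewrite !l2sqE -esumZ_scale ?sqr_ge0//; last by move=> n; exact: nsq_ge0.
by congr esumZ; apply/funext => n; rewrite /nsq !ReImE /=; ring.
Qed.

Lemma l2sq_eq0 u : l2sq u = 0%E -> forall n, u n = 0.
Proof.
move=> u0 n; have := @esumZ_ge_term _ (fun n => nsq (u n)) n (fun n => nsq_ge0 (u n)).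
rewrite -l2sqE u0 lee_fin => h.
have : nsq (u n) == 0 by rewrite eq_le h nsq_ge0.
rewrite /nsq paddr_eq0 ?sqr_ge0// !sqrf_eq0 => /andP[/eqP h1 /eqP h2].
by apply/eqP; rewrite eq_complex h1 h2 !eqxx.
Qed.

Lemma l2B u v : l2 u -> l2 v -> l2 (u - v).
Proof.
rewrite /l2 => hu hv.
apply: (@le_lt_trans _ _ (2%:E * l2sq u + 2%:E * l2sq v)%E); last first.
  by rewrite lte_add_pinfty// lte_mul_pinfty.
rewrite !l2sqE -!esumZ_scale//; try by move=> n; exact: nsq_ge0.
rewrite -esumZD; try by move=> n; rewrite mulr_ge0// nsq_ge0.
apply: le_esumZ => n; rewrite /nsq !ReImE.
have := sqr_ge0 (complex.Re (u n) + complex.Re (v n)).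
have := sqr_ge0 (complex.Im (u n) + complex.Im (v n)).
nra.
Qed.

Lemma l20 : l2 (0 : int -> R[i]).
Proof.
by rewrite /l2 /l2sq esum1// => n _; rewrite Normc.normc0 expr0n.
Qed.

(** The real part of [l2dot]: a real inner product with the same norm, for which polarization takes
    two terms instead of four. *)
Definition rdot u v : R :=
  sumZ (fun n => complex.Re (u n) * complex.Re (v n) + complex.Im (u n) * complex.Im (v n)).

Lemma Re_l2dot u v : complex.Re (l2dot u v) = rdot u v.
Proof.
rewrite /l2dot /rdot /=; congr sumZ; apply/funext => n.
by rewrite !ReImE /= ; case: (u n) => x y /=; ring.
Qed.

(** The weights c stand for the coefficients a_n and b_n, so that the three parts of <u, J v> can be
    summed separately. *)
Lemma dot_summable_gen (c : int -> R) (M : R) u v :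
  (forall n, `|c n| <= M) -> l2 u -> l2 v ->
  summableZ (fun n => c n * (complex.Re (u n) * complex.Re (v n) + complex.Im (u n) * complex.Im (v n))).
Proof.
move=> cM hu hv.
have M0 : 0 <= M := le_trans (normr_ge0 _) (cM 0).
apply: (@summableZ_le _ _ (fun n => M * (nsq (u n) + nsq (v n)))); last first.
  rewrite esumZ_scale ?lte_mul_pinfty//; last first.
  - by move=> n; rewrite addr_ge0 ?nsq_ge0.
  - by rewrite esumZD -?l2sqE ?lte_add_pinfty// => n; exact: nsq_ge0.
move=> n; rewrite normrM ler_pM// /nsq.
move: (complex.Re (u n)) (complex.Re (v n)) (complex.Im (u n)) (complex.Im (v n)) => a b c' d.
rewrite ler_norml; apply/andP; split.
  have := sqr_ge0 (a + b); have := sqr_ge0 (c' + d).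
  have := sqr_ge0 a; have := sqr_ge0 b; have := sqr_ge0 c'; have := sqr_ge0 d; nra.
have := sqr_ge0 (a - b); have := sqr_ge0 (c' - d).
have := sqr_ge0 a; have := sqr_ge0 b; have := sqr_ge0 c'; have := sqr_ge0 d; nra.
Qed.

Lemma dot_summable u v : l2 u -> l2 v ->
  summableZ (fun n => complex.Re (u n) * complex.Re (v n) + complex.Im (u n) * complex.Im (v n)).
Proof.
move=> hu hv; have := @dot_summable_gen (fun=> 1) 1 u v _ hu hv.
rewrite (_ : (fun n => 1 * _) = (fun n => complex.Re (u n) * complex.Re (v n) + complex.Im (u n) * complex.Im (v n))).
  by apply => _; rewrite normr1.
by apply/funext => n; rewrite mul1r.
Qed.

Lemma rdotC u v : rdot u v = rdot v u.
Proof. by congr sumZ; apply/funext => n; ring. Qed.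

Lemma rdotDl u u' v : l2 u -> l2 u' -> l2 v -> rdot (u + u') v = rdot u v + rdot u' v.
Proof.
move=> hu hu' hv; rewrite /rdot -sumZD; try exact: dot_summable.
by congr sumZ; apply/funext => n; rewrite !ReImE; ring.
Qed.

Lemma rdotNl u v : rdot (- u) v = - rdot u v.
Proof.
rewrite /rdot -sumZN.
by congr sumZ; apply/funext => n; rewrite !ReImE; ring.
Qed.

Lemma rdot_l2sq u : l2 u -> (rdot u u)%:E = l2sq u.
Proof.
move=> hu; rewrite l2sqE -sumZ_ge0E -?l2sqE//.
by move=> n; exact: nsq_ge0.
Qed.

Lemma rdot_ge0 u : l2 u -> 0 <= rdot u u.
Proof. by move=> hu; rewrite -lee_fin rdot_l2sq// l2sq_ge0. Qed.

Lemma rdot_eq0 u : l2 u -> rdot u u = 0 -> u = 0.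
Proof.
move=> hu h; apply/funext => n; apply: l2sq_eq0.
by rewrite -rdot_l2sq// h.
Qed.

Lemma rdot_delta0 u : rdot (@delta0 R) u = complex.Re (u 0).
Proof.
rewrite /rdot -(sumZ1 (complex.Re (u 0)) 0); congr sumZ; apply/funext => n.
by rewrite /delta0; case: eqP => [->|_] /=; ring.
Qed.

End ell2_real.

(** * The Jacobi operator on l^2: boundedness, symmetry, size of the coefficients *)

Section jacobi_ell2.
Variables (R : realType) (J : jacobi R).
Implicit Types u v : int -> R[i].

(** [opnorm] only speaks of the unit ball, so u is rescaled to norm one; a vector of norm zero,
    which cannot be rescaled, is treated apart. *)
Lemma l2sq_jop u : l2 u -> (l2sq (jop J u) <= 4%:E * l2sq u)%E.
Proof.
move=> hu; have u0 := l2sq_ge0 u.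
have fu : l2sq u \is a fin_num by rewrite ge0_fin_numE.
have [s0|s_neq0] := eqVneq (l2sq u) 0%E.
  rewrite s0 mule0 /l2sq esum1// => n _; rewrite /jop /jacobi_op.
  by rewrite !(l2sq_eq0 s0) !mulr0 !addr0 Normc.normc0 expr0n.
pose s := fine (l2sq u).
have sE : l2sq u = s%:E by rewrite fineK.
have s_gt0 : 0 < s.
  by rewrite lt_neqAle -!(inj_eq (@EFin_inj R)) -sE eq_sym s_neq0 -lee_fin -sE u0.
pose c := (Num.sqrt s)^-1.
have c0 : 0 < c by rewrite invr_gt0 sqrtr_gt0.
have c2 : c ^+ 2 = s^-1 by rewrite exprVn sqr_sqrtr// ltW.
pose v := fun n => c%:C * u n.
have l2v : l2sq v = 1%E by rewrite l2sq_scale sE c2 -EFinM mulVf// gt_eqF.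
have jv : jop J v = fun n => c%:C * jop J u n.
  by apply/funext => n; rewrite /jop /jacobi_op /v; ring.
have : (l2norm (jop J v) <= 2%:E)%E.
  apply: le_trans (jab_norm J); apply: ereal_sup_ubound; exists v => //=.
  by rewrite /l2norm l2v /= sqrtr1.
have H : (0 <= l2sq (jop J v))%E := l2sq_ge0 _.
rewrite /l2norm -[2%:E]/((2:R)%:E) (_ : (2:R)%:E = sqrte (4%:E)); last first.
  by rewrite /= (_ : 4 = 2 ^+ 2 :> R) ?sqrtr_sqr ?ger0_norm//; ring.
rewrite lee_sqrt ?lee_fin// jv l2sq_scale sE c2.
case: (l2sq (jop J u)) (l2sq_ge0 (jop J u)) => [r||]//.
  by rewrite -EFinM !lee_fin mulrC ler_pdivrMr.
by rewrite gt0_muley// lte_fin invr_gt0.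
Qed.

Lemma l2_jop u : l2 u -> l2 (jop J u).
Proof.
by move=> hu; apply: le_lt_trans (l2sq_jop hu) _; rewrite lte_mul_pinfty.
Qed.

Lemma jopD u v : jop J (u + v) = jop J u + jop J v.
Proof. by apply/funext => n; rewrite /jop /jacobi_op !fctE; ring. Qed.

Lemma rdot_jop_le u : l2 u -> rdot (jop J u) (jop J u) <= 4 * rdot u u.
Proof.
move=> hu; rewrite -lee_fin EFinM !rdot_l2sq//; first exact: l2sq_jop.
exact: l2_jop.
Qed.

(** Summation by parts: shifting the index by one exchanges the two off-diagonal sums. *)
Lemma rdot_jop u v : l2 u -> l2 v -> rdot u (jop J v) = rdot (jop J u) v.
Proof.
move=> hu hv; have [M HM] := jab_bounded J.
have l2s w m : l2 w -> l2 (fun n => w (n + m) : R[i]) by rewrite /l2 l2sq_shift.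
have aM n : `|ja J n| <= M by rewrite ger0_norm ?ja_ge0// (HM n).1.
have am n : `|ja J (n - 1)| <= M by [].
have bM n : `|jb J n| <= M := (HM n).2.
pose d (u v : int -> R[i]) n := complex.Re (u n) * complex.Re (v n) + complex.Im (u n) * complex.Im (v n).
have E w w' : l2 w -> l2 w' -> rdot w (jop J w') =
   sumZ (fun n => ja J n * d w (fun n => w' (n + 1)) n) +
   sumZ (fun n => ja J (n - 1) * d w (fun n => w' (n - 1)) n) +
   sumZ (fun n => jb J n * d w w' n).
  move=> hw hw'; rewrite -!sumZD; last first.
  - exact: (dot_summable_gen am hw (l2s _ (-1) hw')).
  - exact: (dot_summable_gen aM hw (l2s _ 1 hw')).
  - exact: (dot_summable_gen bM hw hw').
  - apply: summableZD.
      exact: (dot_summable_gen aM hw (l2s _ 1 hw')).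
    exact: (dot_summable_gen am hw (l2s _ (-1) hw')).
  congr sumZ; apply/funext => n; rewrite /jop /jacobi_op /d !ReImE /=; ring.
rewrite E// rdotC E// [in RHS](addrC (sumZ _)); congr (_ + _ + _).
- rewrite -[RHS](sumZ_shift _ 1); congr sumZ; apply/funext => n.
  by rewrite /d !addrK; ring.
- rewrite -[RHS](sumZ_shift _ (-1)); congr sumZ; apply/funext => n.
  by rewrite /d !subrK; ring.
- by congr sumZ; apply/funext => n; rewrite /d; ring.
Qed.

(** Expand 0 <= ||J u + 2 u||^2 and 0 <= ||J u - 2 u||^2 and use ||J u||^2 <= 4 ||u||^2. *)
Lemma rdot_jop_bound u : l2 u -> `|rdot u (jop J u)| <= 2 * rdot u u.
Proof.
move=> hu; have hj := l2_jop hu; have b := rdot_jop_le hu.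
have hN w : l2 w -> l2 (- w) by move=> hw; rewrite -[- w]add0r; apply: l2B => //; exact: l20.
have hD w w' : l2 w -> l2 w' -> l2 (w + w').
  by move=> hw hw'; rewrite -[w']opprK; apply: l2B => //; exact: hN.
have huu : l2 (u + u) by exact: hD.
rewrite ler_norml; apply/andP; split.
  have h0 : l2 (jop J u + (u + u)) by exact: hD.
  have := rdot_ge0 h0; rewrite (rdotDl hj huu)// (rdotDl hu hu)//.
  rewrite ![rdot _ (jop J u + _)]rdotC !(rdotDl hj huu)// !(rdotDl hu hu)//.
  rewrite (rdotC (jop J u) u); lra.
have h0 : l2 (jop J u + - (u + u)) by apply: hD => //; exact: hN.
have hn : l2 (- (u + u)) by exact: hN.
have := rdot_ge0 h0; rewrite (rdotDl hj hn)// rdotNl (rdotDl hu hu)//.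
rewrite ![rdot _ (jop J u + _)]rdotC !(rdotDl hj hn)// !rdotNl !(rdotDl hu hu)//.
rewrite (rdotC (jop J u) u); lra.
Qed.

Definition deltaZ (m : int) : int -> R[i] := fun n => (n == m)%:R.

Lemma l2sq_deltaZ m : l2sq (deltaZ m) = 1%E.
Proof.
rewrite l2sqE -(esum_set1 (t := m) (a := fun=> 1%E))// [RHS]esum_mkcond.
apply: eq_esum => n _.
have -> : (n \in [set m]) = (n == m) by apply/idP/eqP; rewrite inE.
by rewrite /nsq /deltaZ; case: eqP => _ /=; congr EFin; ring.
Qed.

(** The coefficients a_n and b_n are coordinates of J delta_m, a vector of norm at most 2; this
    bounds them by 2. *)
Lemma nsq_jop_deltaZ m n : nsq (jop J (deltaZ m) n) <= 4.
Proof.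
have h : (l2sq (jop J (deltaZ m)) <= 4%:E)%E.
  have hl : l2 (deltaZ m) by rewrite /l2 l2sq_deltaZ ltry.
  by have := l2sq_jop hl; rewrite l2sq_deltaZ mule1.
rewrite -lee_fin; apply: le_trans h; rewrite l2sqE.
by apply: (@esumZ_ge_term _ (fun n => nsq (jop J (deltaZ m) n))) => k; exact: nsq_ge0.
Qed.

Lemma jb_le2 n : `|jb J n| <= 2.
Proof.
have := nsq_jop_deltaZ n n; rewrite /jop /jacobi_op /deltaZ /nsq eqxx.
have -> : (n + 1 == n) = false by lia.
have -> : (n - 1 == n) = false by lia.
rewrite !ReImE /= => h.
have {}h : (jb J n) ^+ 2 <= 4 by move: h; apply: le_trans; rewrite le_eqVlt; apply/orP; left; apply/eqP; ring.
by rewrite -(ler_pXn2r (n := 2)) ?nnegrE// real_normK ?num_real//; lra.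
Qed.

Lemma ja_le2 n : ja J n <= 2.
Proof.
have := nsq_jop_deltaZ (n + 1) n; rewrite /jop /jacobi_op /deltaZ /nsq eqxx.
have -> : (n - 1 == n + 1) = false by lia.
have -> : (n == n + 1) = false by lia.
rewrite !ReImE /= => h.
have {}h : (ja J n) ^+ 2 <= 4 by move: h; apply: le_trans; rewrite le_eqVlt; apply/orP; left; apply/eqP; ring.
by rewrite -(ler_pXn2r (n := 2)) ?nnegrE ?ja_ge0//; lra.
Qed.

End jacobi_ell2.

(** * Moments of the spectral measure *)

Section measure_cdf.
Variable R : realType.
Implicit Types m : {measure set (measurableTypeR R) -> \bar R}.

Lemma itv_oc_setD (a b : R) : a <= b ->
  `]a, b]%classic = `]-oo, b]%classic `\` `]-oo, a]%classic.
Proof.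
move=> ab; apply/seteqP; split => x /=; rewrite !in_itv/=.
  by move=> /andP[ax xb]; split => //; rewrite leNgt ax.
by move=> [-> /negP]; rewrite -ltNge andbT.
Qed.

Lemma measure_oc m (a b : R) : a <= b -> (m `]-oo, a]%classic < +oo)%E ->
  (m `]-oo, b]%classic < +oo)%E ->
  m `]a, b]%classic = (m `]-oo, b]%classic - m `]-oo, a]%classic)%E.
Proof.
move=> ab foo boo; rewrite itv_oc_setD// measureD//; congr (_ - m _)%E.
by apply/setIidr => x /=; rewrite !in_itv/= => /le_trans; exact.
Qed.

(** The intervals ]a, b] form a pi-system and ]-n, n] exhausts R; finiteness of the distribution
    function allows the subtraction that gives the mass of ]a, b]. *)
Lemma eq_measure_cdf m1 m2 :
  (forall t : R, (m1 `]-oo, t]%classic < +oo)%E) ->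
  (forall t : R, m1 `]-oo, t]%classic = m2 `]-oo, t]%classic) ->
  forall A, measurable A -> m1 A = m2 A.
Proof.
move=> foo m12.
move=> A mA.
apply: (@measure_unique _ R (measurableTypeR R) (@ocitv R)
  (fun n : nat => `]- n%:R, n%:R]%classic)) mA => //.
- by move=> B C; exact: ocitvI.
- by move=> i; exists (- i%:R, i%:R).
- apply/seteqP; split => // x _.
  exists (Num.truncn `|x|).+1 => //=.
  have : `|x| < (Num.truncn `|x|).+1%:R by exact: truncnS_gt.
  by rewrite in_itv/= ltr_norml => /andP[-> /ltW ->].
- move=> _ [[a b] _ <-] /=.
  have [ab|ba] := leP a b; last by rewrite set_itv_ge ?measure0// bnd_simp -leNgt ltW.
  by rewrite !measure_oc -?m12.
- move=> k; rewrite measure_oc//; last by rewrite lerNl (le_trans _ (ler0n _ _))// oppr_le0.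
  apply: le_lt_trans (foo k%:R); rewrite leeBlDr ?ge0_fin_numE// leeDl//.
Qed.

End measure_cdf.

(* Bisecting n times improves the constant C to C / 2^n. *)
Lemma bisection_constant (R : realType) (g F : R -> R) (C l r : R) :
  (forall a b, l <= a -> a <= b -> b <= r -> F a <= F b) ->
  (forall a b, l <= a -> a <= b -> b <= r -> `|g b - g a| <= C * (b - a) * (F b - F a)) ->
  l <= r -> g l = g r.
Proof.
move=> Fle H lr.
have K k : forall a b, l <= a -> a <= b -> b <= r ->
    `|g b - g a| <= C * (b - a) * (F b - F a) / 2 ^+ k.
  elim: k => [|k IH] a b la ab br; first by rewrite expr0 divr1 H.
  pose m := (a + b) / 2.
  have am : a <= m by rewrite /m; lra.
  have mb : m <= b by rewrite /m; lra.
  have h1 := IH a m la am (le_trans mb br).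
  have h2 := IH m b (le_trans la am) mb br.
  have := ler_normD (g b - g m) (g m - g a); rewrite addrA subrK => /le_trans; apply.
  apply: (le_trans (lerD h2 h1)).
  rewrite exprS invfM /m.
  set q := (2 ^+ k)^-1.
  rewrite le_eqVlt; apply/orP; left; apply/eqP; by field.
apply/eqP; rewrite eq_sym -subr_eq0 -normr_le0; apply/ler_addgt0Pr => e e0.
rewrite add0r.
set B := C * (r - l) * (F r - F l).
pose k := Num.truncn (`|B| / e).
have h : `|B| / e < 2 ^+ k.+1.
  apply: lt_le_trans (truncnS_gt _) _.
  by rewrite -natrX ler_nat ltnW// ltn_expl.
apply: le_trans (K k.+1 l r _ lr _) _ => //.
rewrite ler_pdivrMr ?exprn_gt0//; rewrite ltr_pdivrMr// in h.
by rewrite -/B [leRHS]mulrC; exact: le_trans (ler_norm B) (ltW h).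
Qed.

(** * Moments from a weak resolution of the identity *)

Section spectral_calculus.
Variables (R : realType) (V : zmodType).
Variable dot : V -> V -> R.
Hypothesis dotC : forall u v, dot u v = dot v u.
Hypothesis dotDl : forall u u' v, dot (u + u') v = dot u v + dot u' v.
Hypothesis dot_ge0 : forall u, 0 <= dot u u.
Hypothesis dot_eq0 : forall u, dot u u = 0 -> u = 0.
Variable J : V -> V.
Hypothesis JD : forall u v, J (u + v) = J u + J v.
Hypothesis Jsym : forall u v, dot u (J v) = dot (J u) v.
Hypothesis Jle : forall u, dot (J u) (J u) <= 4 * dot u u.
Hypothesis Jquad : forall u, `|dot u (J u)| <= 2 * dot u u.
Variable E : R -> V -> V.
Hypothesis ED : forall t u v, E t (u + v) = E t u + E t v.
Hypothesis Esym : forall t u v, dot (E t u) v = dot u (E t v).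
Hypothesis EM : forall s t u, E s (E t u) = E (Num.min s t) u.
(** The strong limits at infinity enter in this discrete form: a family that is constant beyond b
    takes its limit at b. *)
Hypothesis Epoo : forall b u, (forall s, b <= s -> E s u = E b u) -> E b u = u.
Hypothesis Enoo : forall b u, (forall s, s <= b -> E s u = E b u) -> E b u = 0.
Variable rho : V -> {measure set (measurableTypeR R) -> \bar R}.
Hypothesis rhoE : forall u t, rho u `]-oo, t]%classic = (dot (E t u) (E t u))%:E.
Hypothesis rho_int : forall u,
  (rho u).-integrable setT (fun t : measurableTypeR R => (t : R)%:E).
Hypothesis rhoJ : forall u, dot u (J u) = (\int[rho u]_t t)%R.

Lemma dot0l v : dot 0 v = 0.
Proof. by have := dotDl 0 0 v; rewrite addr0 => /(canLR (addKr _)); rewrite addNr. Qed.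

Lemma dotNl u v : dot (- u) v = - dot u v.
Proof. by apply/eqP; rewrite -addr_eq0 -dotDl addNr dot0l. Qed.

Lemma dotBl u u' v : dot (u - u') v = dot u v - dot u' v.
Proof. by rewrite dotDl dotNl. Qed.

Lemma dotDr u v v' : dot u (v + v') = dot u v + dot u v'.
Proof. by rewrite dotC dotDl !(dotC _ u). Qed.

Lemma dotBr u v v' : dot u (v - v') = dot u v - dot u v'.
Proof. by rewrite dotC dotBl !(dotC _ u). Qed.

Lemma dot_inj u v : (forall x, dot x u = dot x v) -> u = v.
Proof.
by move=> h; apply/eqP; rewrite -subr_eq0; apply/eqP/dot_eq0; rewrite dotBr h subrr.
Qed.

Lemma E_sub t u v : E t (u - v) = E t u - E t v.
Proof.
have E0 : E t 0 = 0 by have := ED t 0 0; rewrite addr0 => /(canLR (addKr _)); rewrite addNr.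
rewrite ED; congr (_ + _); apply/eqP.
by rewrite -subr_eq0 opprK -ED addNr E0.
Qed.

Lemma J_sub u v : J (u - v) = J u - J v.
Proof.
have J0 : J 0 = 0 by have := JD 0 0; rewrite addr0 => /(canLR (addKr _)); rewrite addNr.
rewrite JD; congr (_ + _); apply/eqP.
by rewrite -subr_eq0 opprK -JD addNr J0.
Qed.

Lemma rho_lty u t : (rho u `]-oo, t]%classic < +oo)%E.
Proof. by rewrite rhoE ltry. Qed.

(* The spectral measure of u + v is the sum of those of u and of v. *)
Lemma jacobi_orthogonal u v :
  (forall t, dot (E t u) (E t v) = 0) -> dot u (J v) = 0.
Proof.
move=> uv.
have rhoD A : measurable A -> rho (u + v) A = measure_add (rho u) (rho v) A.
  apply: eq_measure_cdf; first by move=> t; exact: rho_lty.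
  move=> t; transitivity (rho u `]-oo, t]%classic + rho v `]-oo, t]%classic)%E; last first.
    by rewrite -measure_addE.
  rewrite !rhoE -EFinD; congr EFin.
  by rewrite ED dotDl !dotDr uv (dotC (E t v)) uv; ring.
have : dot (u + v) (J (u + v)) = dot u (J u) + dot v (J v).
  rewrite !rhoJ /Rintegral (eq_measure_integral (measure_add (rho u) (rho v))); last first.
    by move=> A mA _; exact: rhoD.
  rewrite integral_measure_add// fineD//; exact: integrable_fin_num.
by rewrite JD dotDl !dotDr (Jsym v u) (dotC (J v) u); lra.
Qed.

(* Vectors as in [jacobi_orthogonal] include E_s x and w - E_s w, whence
   E_s J = E_s J E_s; taking adjoints, E_s J = J E_s. *)
Lemma E_J_commute s u : E s (J u) = J (E s u).
Proof.
have H w : E s (J w) = E s (J (E s w)).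
  apply/eqP; rewrite -subr_eq0 -E_sub -J_sub; apply/eqP; apply: dot_inj => x.
  rewrite (dotC x 0) dot0l -Esym; apply: jacobi_orthogonal => t.
  rewrite E_sub dotBr !EM.
  set m := Num.min t s.
  have -> : E m x = E m (E m x) by rewrite EM minxx.
  rewrite [in X in _ - X]Esym [in X in X - _]Esym !EM minxx.
  have -> : Num.min m t = m by rewrite /m minAC minxx.
  by rewrite subrr.
rewrite H; apply: dot_inj => x.
by rewrite [RHS]Jsym -(Esym s (J x)) (H x) [RHS]Esym -[RHS]Jsym [RHS]Esym.
Qed.

(** The spectral projection of ]a, b], half-open because E t belongs to ]-oo, t]. *)
Definition oc_proj a b u := E b u - E a u.

Lemma oc_projJ a b u : oc_proj a b (J u) = J (oc_proj a b u).
Proof. by rewrite /oc_proj !E_J_commute J_sub. Qed.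

Lemma oc_projK a b u : a <= b -> oc_proj a b (oc_proj a b u) = oc_proj a b u.
Proof.
move=> ab; rewrite /oc_proj !E_sub !EM minxx minxx.
by rewrite (min_r ab) (min_l ab) subrr subr0.
Qed.

Lemma oc_proj_sym a b u v : dot (oc_proj a b u) v = dot u (oc_proj a b v).
Proof. by rewrite /oc_proj dotBl dotBr !Esym. Qed.

Lemma E_dot p q u : p <= q -> dot (E p u) (E q u) = dot (E p u) (E p u).
Proof. by move=> pq; rewrite Esym EM (min_l pq) [in RHS]Esym EM minxx. Qed.

Lemma dot_oc_proj p q u : p <= q ->
  dot (oc_proj p q u) (oc_proj p q u) = dot (E q u) (E q u) - dot (E p u) (E p u).
Proof.
move=> pq; rewrite /oc_proj dotBl !dotBr (dotC (E q u) (E p u)) E_dot//; ring.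
Qed.

Lemma rho_oc_proj a b u : a <= b -> rho u `]a, b]%classic = (dot (oc_proj a b u) (oc_proj a b u))%:E.
Proof.
by move=> ab; rewrite measure_oc ?rho_lty// !rhoE -EFinB dot_oc_proj.
Qed.

(** Comparison of distribution functions: E t applied to the projection of ]a, b] is the projection
    of ]min t a, min t b], which is ]-oo, t] cut with ]a, b]. *)
Lemma rho_oc_proj_restr a b u A : a <= b -> measurable A ->
  rho (oc_proj a b u) A = rho u (A `&` `]a, b]%classic).
Proof.
move=> ab mA.
have mab : measurable (`]a, b]%classic : set (measurableTypeR R)) by exact: measurable_itv.
rewrite -/(mrestr (rho u) mab A).
apply: eq_measure_cdf mA => t; first exact: rho_lty.
rewrite rhoE -[RHS]/(rho u (`]-oo, t]%classic `&` `]a, b]%classic)).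
rewrite [X in rho u X](_ : _ = `](Num.min t a), (Num.min t b)]%classic); last first.
  apply/seteqP; split => x /=; rewrite !in_itv/= ?le_min ?gt_min.
    by move=> [-> /andP[-> ->]]; rewrite orbT.
  move=> /and3P[h xt xb]; rewrite xt xb andbT; split => //.
  by case/orP: h => //; rewrite ltNge xt.
have tab : Num.min t a <= Num.min t b by rewrite le_min !ge_min lexx ab orbT.
rewrite rho_oc_proj//; congr EFin.
by rewrite /oc_proj E_sub !EM.
Qed.

Lemma quad_oc_proj a b u : a <= b ->
  dot (oc_proj a b u) (J (oc_proj a b u)) = (\int[rho u]_(t in `]a, b]%classic) t)%R.
Proof.
move=> ab; rewrite rhoJ /Rintegral.
have mab : measurable (`]a, b]%classic : set (measurableTypeR R)) by exact: measurable_itv.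
have mab' : measurable (~` `]a, b]%classic : set (measurableTypeR R)) by exact: measurableC.
have n0 : rho (oc_proj a b u) (~` `]a, b]%classic) = 0%E.
  by rewrite rho_oc_proj_restr// setICl measure0.
have := negligible_integral mab' measurableT (rho_int (oc_proj a b u)) n0.
rewrite setTD setCK => ->.
congr fine; apply: eq_measure_integral => A mA Aab.
by rewrite rho_oc_proj_restr//; congr (rho u _); apply/setIidl.
Qed.

Lemma rho_oc_lty u a b : (rho u `]a, b]%classic < +oo)%E.
Proof.
have [ab|ba] := leP a b; first by rewrite rho_oc_proj// ltry.
by rewrite set_itv_ge ?measure0// bnd_simp -leNgt ltW.
Qed.

Lemma pow_integrable u n a b :
  (rho u).-integrable `]a, b]%classic (EFin \o (fun t : measurableTypeR R => (t : R) ^+ n)).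
Proof.
apply: measurable_bounded_integrable.
- exact: measurable_itv.
- exact: rho_oc_lty.
- exact: exprn_measurable.
- exists (Num.max `|a| `|b| ^+ n); split; first by rewrite num_real.
  move=> M hM t /=; rewrite in_itv/= => /andP[at_ tb].
  apply: le_trans (ltW hM); rewrite normrX lerXn2r// ?nnegrE ?le_max ?normr_ge0//.
  case: (lerP 0 t) => [t0|t0]; apply/orP; [right|left].
    by rewrite ger0_norm// (le_trans tb)// ler_norm.
  by rewrite ltr0_norm// -[`|a|]normrN (le_trans _ (ler_norm _))// lerN2 ltW.
Qed.

Lemma quad_oc_proj_bounds a b u : a <= b ->
  a * dot (oc_proj a b u) (oc_proj a b u) <= dot (oc_proj a b u) (J (oc_proj a b u)) <= b * dot (oc_proj a b u) (oc_proj a b u).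
Proof.
move=> ab; rewrite quad_oc_proj//.
have mab : measurable (`]a, b]%classic : set (measurableTypeR R)) by exact: measurable_itv.
have rE : dot (oc_proj a b u) (oc_proj a b u) = fine (rho u `]a, b]%classic) by rewrite rho_oc_proj.
rewrite rE -!Rintegral_cst//.
have ic c : (rho u).-integrable `]a, b]%classic (EFin \o (fun=> c)).
  have := pow_integrable u 0 a b => /(integrableZl mab c).
  by apply: eq_integrable => // t _ /=; rewrite expr0 mule1.
apply/andP; split; apply: le_Rintegral => //.
- exact: (pow_integrable u 1 a b).
- by move=> t /=; rewrite in_itv/= => /andP[/ltW].
- exact: (pow_integrable u 1 a b).
- by move=> t /=; rewrite in_itv/= => /andP[].
Qed.

(** For x in the range, a ||x||^2 <= <x, J x> <= 2 ||x||^2, which forces x = 0 when a > 2. This and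
    its mirror image confine the spectrum to [-2, 2]. *)
Lemma oc_proj_gt2 a b u : 2 < a -> a <= b -> oc_proj a b u = 0.
Proof.
move=> a2 ab; apply: dot_eq0; have /andP[h _] := quad_oc_proj_bounds u ab.
have := Jquad (oc_proj a b u); rewrite ler_norml => /andP[_ h2].
have := dot_ge0 (oc_proj a b u); rewrite le_eqVlt => /orP[/eqP//|h3].
by have := le_trans h h2; rewrite ler_pM2r//; lra.
Qed.

Lemma oc_proj_ltN2 a b u : a <= b -> b < -2 -> oc_proj a b u = 0.
Proof.
move=> ab b2; apply: dot_eq0; have /andP[_ h] := quad_oc_proj_bounds u ab.
have := Jquad (oc_proj a b u); rewrite ler_norml => /andP[h2 _].
have := dot_ge0 (oc_proj a b u); rewrite le_eqVlt => /orP[/eqP//|h3].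
by have := le_trans h2 h; rewrite -mulNr ler_pM2r//; lra.
Qed.

Lemma E_gt2 b u : 2 < b -> E b u = u.
Proof.
move=> b2; apply: Epoo => s bs.
by have := oc_proj_gt2 u b2 bs => /eqP; rewrite subr_eq0 => /eqP.
Qed.

Lemma E_ltN2 b u : b < -2 -> E b u = 0.
Proof.
move=> b2; apply: Enoo => s bs.
by have := oc_proj_ltN2 u bs b2 => /eqP; rewrite subr_eq0 => /eqP.
Qed.

(** Projections live on half-open intervals, and 3 is a convenient bound beyond 2, where E is
    already constant. The excess is exhausted by the intervals ]-3, -2 - 1/(j + 1)] and ]2 + 1/(j +
    1), 3], null because they keep a distance from [-2, 2]. *)
Lemma I22_itv u n : (\int[rho u]_(t in @I22 R) (t ^+ n)%:E =
  (\int[rho u]_(t in `](-3), 3]%classic) t ^+ n)%R%:E)%E.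
Proof.
have mI : measurable (@I22 R : set (measurableTypeR R)) by exact: measurable_itv.
have mW : measurable (`](-3), 3]%classic : set (measurableTypeR R)) by exact: measurable_itv.
have sub : @I22 R `<=` `](-3), 3]%classic.
  by move=> t; rewrite /I22 /= !in_itv/= => /andP[h1 h2]; apply/andP; split; lra.
have mD : measurable (`](-3), 3]%classic `\` @I22 R : set (measurableTypeR R)).
  exact: measurableD.
have D0 : (rho u).-negligible (`](-3), 3]%classic `\` @I22 R : set (measurableTypeR R)).
  apply: (@negligibleS _ _ _ _ ((\bigcup_k `](-3), (-2 - k.+1%:R^-1)]%classic)
     `|` (\bigcup_k `](2 + k.+1%:R^-1), 3]%classic) : set (measurableTypeR R))).
    move=> t [/=]; rewrite /I22 /= !in_itv/= => /andP[h1 h2] /negP.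
    rewrite negb_and -!ltNge => /orP[h|h].
      left; have /ltr_add_invr[k hk] : t < -2 by [].
      by exists k => //=; rewrite in_itv/= h1/= lerBrDr ltW.
    right; have /ltr_add_invr[k hk] : 2 < t by [].
    by exists k => //=; rewrite in_itv/= h2 hk.
  apply: negligibleU; apply: negligible_bigcup => k; apply/negligibleP.
  - exact: measurable_itv.
  - have [ab|ba] := leP (-3) (-2 - k.+1%:R^-1 : R); last first.
      by rewrite set_itv_ge ?measure0// bnd_simp -leNgt ltW.
    by have := rho_oc_proj u ab; rewrite oc_proj_ltN2 ?dot0l// gtrBl invr_gt0.
  - exact: measurable_itv.
  - have [ab|ba] := leP (2 + k.+1%:R^-1 : R) 3; last first.
      by rewrite set_itv_ge ?measure0// bnd_simp -leNgt ltW.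
    by have := rho_oc_proj u ab; rewrite oc_proj_gt2 ?dot0l// ltrDl invr_gt0.
rewrite /Rintegral fineK; last exact/integrable_fin_num/pow_integrable.
have n0 : rho u (`](-3), 3]%classic `\` @I22 R) = 0%E by apply/negligibleP.
rewrite [RHS](negligible_integral mD mW (pow_integrable u n (-3) 3) n0).
by rewrite setDD; congr integral; apply/esym/setIidr.
Qed.

Definition Jn n u := iter n J u.

Lemma oc_proj_iter a b n u : oc_proj a b (Jn n u) = Jn n (oc_proj a b u).
Proof. by elim: n u => //= n IH u; rewrite oc_projJ IH. Qed.

Lemma quad_shift a b x : a <= b -> oc_proj a b x = x ->
  `|dot x (J x) - b * dot x x| <= (b - a) * dot x x.
Proof.
move=> ab xP; have /andP[] := quad_oc_proj_bounds x ab; rewrite xP => h1 h2.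
by rewrite ler_norml; apply/andP; split; lra.
Qed.

Lemma oc_projD a b u v : oc_proj a b (u + v) = oc_proj a b u + oc_proj a b v.
Proof. by rewrite /oc_proj !ED opprD addrACA. Qed.

Lemma oc_projB a b u v : oc_proj a b (u - v) = oc_proj a b u - oc_proj a b v.
Proof. by apply/eqP; rewrite eq_sym subr_eq -oc_projD subrK. Qed.

(* Polarization of the quadratic bound. *)
Lemma bilin_shift a b x y : a <= b -> oc_proj a b x = x -> oc_proj a b y = y ->
  `|dot x (J y) - b * dot x y| <= (b - a) * (dot x x + dot y y).
Proof.
move=> ab xP yP.
have := @quad_shift a b (x + y) ab; rewrite oc_projD xP yP => /(_ erefl).
have := @quad_shift a b (x - y) ab; rewrite oc_projB xP yP => /(_ erefl).
rewrite !J_sub !JD !(dotBl, dotBr) !(dotDl, dotDr) (dotC y x) (dotC y (J x)) -(Jsym x y).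
rewrite !ler_norml => /andP[h1 h2] /andP[h3 h4]; apply/andP.
have := mulr_ge0 (_ : 0 <= b - a) (dot_ge0 x); have := mulr_ge0 (_ : 0 <= b - a) (dot_ge0 y).
rewrite subr_ge0 => /(_ ab) h5 /(_ ab) h6; split; nra.
Qed.

(** One constant for both comparisons with b^n below: the factor 4 comes from ||J y||^2 <= 4
    ||y||^2, and 3^m bounds |b|^m. *)
Fixpoint Cn (n : nat) : R := if n is m.+1 then 4 * Cn m + 3 ^+ m else 0.

Lemma Cn_ge0 n : 0 <= Cn n.
Proof. by elim: n => //= n IH; rewrite addr_ge0 ?mulr_ge0 ?exprn_ge0. Qed.

(** Induction through J^(n+1) y = J^n (J y): since J commutes with the projection, J y stays in its
    range. Two vectors are needed because J acts on one side only. *)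
Lemma Jn_shift n a b x y : a <= b -> `|b| <= 3 -> oc_proj a b x = x -> oc_proj a b y = y ->
  `|dot x (Jn n y) - b ^+ n * dot x y| <= Cn n * (b - a) * (dot x x + dot y y).
Proof.
move=> ab b3 xP; elim: n y => [|n IH] y yP.
  by rewrite /= expr0 mul1r subrr normr0 !mul0r.
have JyP : oc_proj a b (J y) = J y by rewrite oc_projJ yP.
have h1 := IH _ JyP; have h2 := bilin_shift ab xP yP.
rewrite /Jn iterSr -/(Jn n (J y)) exprSr -mulrA.
rewrite -[_ - _](subrKA (b ^+ n * dot x (J y))) -mulrBr.
apply: (le_trans (ler_normD _ _)); rewrite normrM normrX.
have d0 : 0 <= b - a by rewrite subr_ge0.
have s0 : 0 <= dot x x + dot y y by rewrite addr_ge0.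
have k1 : Cn n * (b - a) * (dot x x + dot (J y) (J y)) <=
          4 * Cn n * ((b - a) * (dot x x + dot y y)).
  rewrite [4 * _]mulrC -!mulrA ler_wpM2l ?Cn_ge0// [leRHS]mulrCA ler_wpM2l//.
  have := Jle y; have := dot_ge0 x; lra.
have k2 : `|b| ^+ n * `|dot x (J y) - b * dot x y| <=
          3 ^+ n * ((b - a) * (dot x x + dot y y)).
  by rewrite ler_pM ?exprn_ge0// lerXn2r ?nnegrE.
by rewrite /= mulrDl mulrDl -!(mulrA _ (b - a)) lerD// (le_trans h1).
Qed.

Lemma pow_shift n (b t : R) : `|b| <= 3 -> `|t| <= 3 ->
  `|t ^+ n - b ^+ n| <= Cn n * `|t - b|.
Proof.
move=> b3 t3; elim: n => [|n IH]; first by rewrite !expr0 subrr normr0 mul0r.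
have -> : t ^+ n.+1 - b ^+ n.+1 = t * (t ^+ n - b ^+ n) + (t - b) * b ^+ n.
  by rewrite !exprS; ring.
apply: (le_trans (ler_normD _ _)); rewrite !normrM normrX /= mulrDl lerD//.
  apply: (@le_trans _ _ (3 * (Cn n * `|t - b|))); first by rewrite ler_pM.
  have := mulr_ge0 (Cn_ge0 n) (normr_ge0 (t - b)); lra.
by rewrite mulrC ler_wpM2r// lerXn2r ?nnegrE.
Qed.

Lemma int_shift n a b u : -3 <= a -> a <= b -> b <= 3 ->
  `|(\int[rho u]_(t in `]a, b]%classic) t ^+ n)%R - b ^+ n * dot (oc_proj a b u) (oc_proj a b u)|
    <= Cn n * (b - a) * dot (oc_proj a b u) (oc_proj a b u).
Proof.
move=> a3 ab b3.
have rE : dot (oc_proj a b u) (oc_proj a b u) = fine (rho u `]a, b]%classic) by rewrite rho_oc_proj.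
have mab : measurable (`]a, b]%classic : set (measurableTypeR R)) by exact: measurable_itv.
have ic c : (rho u).-integrable `]a, b]%classic (EFin \o (fun=> c)).
  have := pow_integrable u 0 a b => /(integrableZl mab c).
  by apply: eq_integrable => // t _ /=; rewrite expr0 mule1.
have pw t : t \in `]a, b] -> `|t ^+ n - b ^+ n| <= Cn n * (b - a).
  rewrite in_itv/= => /andP[at_ tb]; apply: (le_trans (@pow_shift n b t _ _)).
  - by rewrite ler_norml; apply/andP; split; lra.
  - by rewrite ler_norml; apply/andP; split; lra.
  - by rewrite ler_wpM2l ?Cn_ge0// ler0_norm; lra.
rewrite rE.
have l1 : (b ^+ n - Cn n * (b - a)) * fine (rho u `]a, b]%classic)
    <= (\int[rho u]_(t in `]a, b]%classic) t ^+ n)%R.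
  rewrite -Rintegral_cst//; apply: le_Rintegral => //; first exact: pow_integrable.
  by move=> t /= /pw; rewrite ler_norml => /andP[h1 h2]; rewrite lerBlDr -lerBlDl; lra.
have l2 : (\int[rho u]_(t in `]a, b]%classic) t ^+ n)%R <=
    (b ^+ n + Cn n * (b - a)) * fine (rho u `]a, b]%classic).
  rewrite -Rintegral_cst//; apply: le_Rintegral => //; first exact: pow_integrable.
  by move=> t /= /pw; rewrite ler_norml => /andP[h1 h2]; rewrite -lerBlDl; lra.
by rewrite ler_norml; apply/andP; split; lra.
Qed.

(** Put G(x) = <u, J^n E_x u> and H(x) = \int_]-3, x] t^n. On ]a, b] both increments are within C (b
    - a) ||P u||^2 of b^n ||P u||^2, with P the projection of ]a, b]. Since ||P u||^2 is the
    increment of the monotone F(x) = ||E_x u||^2, bisection shows that G - H is constant, and it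
    vanishes at -3. *)
Lemma spectral_moment u n :
  (\int[rho u]_(t in @I22 R) (t ^+ n)%:E = (dot u (Jn n u))%:E)%E.
Proof.
rewrite I22_itv; congr EFin.
pose G x := dot u (Jn n (E x u)).
pose H x := (\int[rho u]_(t in `](-3), x]%classic) t ^+ n)%R.
pose F x := dot (E x u) (E x u).
have F_oc_proj a b : a <= b -> F b - F a = dot (oc_proj a b u) (oc_proj a b u).
  by move=> ab; rewrite dot_oc_proj.
have : G (-3) - H (-3) = G 3 - H 3.
  (* The factor 3 is 2 from [Jn_shift] with x = y, plus 1 from [int_shift]. *)
  apply: (@bisection_constant R (fun x => G x - H x) F (3 * Cn n) (-3) 3) => [a b _ ab _|a b a3 ab b3|].
  - by rewrite -subr_ge0 F_oc_proj.
  - have HB : H b - H a = (\int[rho u]_(t in `]a, b]%classic) t ^+ n)%R.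
      rewrite /H (@itv_bndbnd_setU _ _ _ (BRight a)) ?bnd_simp// Rintegral_setU.
      + by rewrite addrAC subrr add0r.
      + exact: measurable_itv.
      + exact: measurable_itv.
      + rewrite -itv_bndbnd_setU ?bnd_simp//; exact: pow_integrable.
      + apply/disj_setPS => t [/=]; rewrite !in_itv/= => /andP[_ ta] /andP[].
        by rewrite ltNge ta.
    have GB : G b - G a = dot (oc_proj a b u) (Jn n (oc_proj a b u)).
      rewrite -dotBr oc_proj_sym oc_proj_iter oc_projK// /oc_proj.
      have -> : forall k v w, Jn k (v - w) = Jn k v - Jn k w.
        by elim=> //= k IH v w; rewrite IH J_sub.
      by [].
    have -> : G b - H b - (G a - H a) = (G b - G a) - (H b - H a) by ring.
    rewrite GB HB F_oc_proj//.
    have h1 := @Jn_shift n a b _ _ ab _ (oc_projK u ab) (oc_projK u ab).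
    have h2 := int_shift n u a3 ab b3.
    have {}h1 := h1 (_ : `|b| <= 3).
    set p := dot (oc_proj a b u) (oc_proj a b u) in h1 h2 *.
    set q := dot (oc_proj a b u) (Jn n (oc_proj a b u)) in h1 *.
    set r := (\int[rho u]_(t in `]a, b]%classic) t ^+ n)%R in h2 *.
    have -> : q - r = (q - b ^+ n * p) - (r - b ^+ n * p) by ring.
    apply: (le_trans (ler_normB _ _)).
    have {}h1 : `|q - b ^+ n * p| <= Cn n * (b - a) * (p + p).
      by apply: h1; rewrite ler_norml; apply/andP; split; lra.
    apply: (le_trans (lerD h1 h2)).
    by rewrite le_eqVlt; apply/orP; left; apply/eqP; ring.
  - lra.
rewrite /G /H E_ltN2 ?E_gt2//; [|lra|lra].
rewrite set_itvoc0 Rintegral_set0.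
have -> : Jn n 0 = 0.
  by elim: (n) => //= m ->; have := J_sub 0 0; rewrite !subrr.
rewrite dotC dot0l; lra.
Qed.

End spectral_calculus.

(** * Square summable sequences as a type *)

Section l2_space.
Variable R : realType.

Definition l2_pred : {pred int -> R[i]} := [pred u | `[< l2 u >]].

Fact l2_pred_zmod_closed : zmod_closed l2_pred.
Proof.
split=> [|u v]; first by apply/asboolP; exact: (l20 R).
by move=> /asboolP hu /asboolP hv; apply/asboolP; exact: l2B.
Qed.

HB.instance Definition _ := GRing.isZmodClosed.Build (int -> R[i]) l2_pred
  l2_pred_zmod_closed.

(** The spectral calculus above quantifies over all vectors of a group; bundling membership in l^2
    makes its hypotheses hold without side conditions. *)
Record l2seq := L2seq { l2val :> int -> R[i]; l2valP : l2val \in l2_pred }.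

HB.instance Definition _ := [isSub for l2val].
HB.instance Definition _ := [Choice of l2seq by <:].
HB.instance Definition _ := [SubChoice_isSubZmodule of l2seq by <:].

Lemma l2seqP (u : l2seq) : l2 u.
Proof. by case: u => u hu /=; apply/asboolP. Qed.

Definition mkl2 u (hu : l2 u) : l2seq := L2seq (introT (asboolP _) hu).

End l2_space.

Section jacobi_moments.
Variables (R : realType) (J : jacobi R).

Lemma l2norm_eq0 (u : int -> R[i]) : l2 u -> l2norm u = 0%E -> u = 0.
Proof.
move=> hu /(congr1 (fun x => x ^+ 2)%E); rewrite /l2norm sqr_sqrte ?l2sq_ge0//.
rewrite expe2 mule0 => h; apply/funext => n.
exact: l2sq_eq0.
Qed.

Lemma spectral_measure0_moment (rho0 : {measure set (measurableTypeR R) -> \bar R}) n :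
  spectral_measure0 J rho0 ->
  (\int[rho0]_(t in @I22 R) (t ^+ n)%:E =
   (complex.Re (iter n (jop J) delta0 0))%:E)%E.
Proof.
move=> [E [[SF res] st0]].
have l2J (u : l2seq R) : l2 (jop J u) by apply/l2_jop/l2seqP.
have l2E t (u : l2seq R) : l2 (E t u) by apply: (sf_l2 SF); exact: l2seqP.
pose Jv (u : l2seq R) := mkl2 (l2J u).
pose Ev t (u : l2seq R) := mkl2 (l2E t u).
pose dot (u v : l2seq R) := rdot u v.
have eqv (u v : l2seq R) : (u : int -> R[i]) = v -> u = v by move=> h; exact: val_inj.
have /choice[rho hrho] : forall u : l2seq R, exists rho : {measure set (measurableTypeR R) -> \bar R},
    [/\ stieltjes_of E u rho,
        rho.-integrable setT (fun t : measurableTypeR R => (t : R)%:E) &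
        l2dot u (jop J u) = (\int[rho]_t t)%R%:C].
  by move=> u; apply: res; exact: l2seqP.
have l2d : l2 (@delta0 R).
  have := l2sq_deltaZ R 0; rewrite /l2 => h; by rewrite (_ : delta0 = deltaZ R 0) ?h ?ltry.
pose d0 := mkl2 l2d.
have rhoE u t : rho u `]-oo, t]%classic = (dot (Ev t u) (Ev t u))%:E.
  by have [-> _ _] := hrho u; rewrite -rdot_l2sq// ; exact: l2E.
have linE t (u v : l2seq R) : E t (fun n => u n + v n) = (fun n => E t u n + E t v n).
  have := @sf_linear _ _ SF t 1 u v (l2seqP u) (l2seqP v).
  have -> : (fun n => 1 * u n + v n) = (fun n => u n + v n) :> (int -> R[i]).
    by apply/funext => m; rewrite mul1r.
  by move=> ->; apply/funext => m; rewrite mul1r.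
(* [rho0] and the chosen measure of delta_0 have the same distribution function, hence the same
   integrals. *)
transitivity (\int[rho d0]_(t in @I22 R) (t ^+ n)%:E)%E.
  apply: eq_measure_integral => A mA _.
  apply: eq_measure_cdf mA => t; have [sd _ _] := hrho d0.
    by rewrite st0; exact: l2E t d0.
  by rewrite st0 sd.
rewrite (@spectral_moment R (l2seq R) dot _ _ _ _ Jv _ _ _ _ Ev _ _ _ _ _ rho _ _ _).
- congr EFin; rewrite /dot /= rdot_delta0; congr (complex.Re (_ 0)).
  by elim: n => //= n ->.
- by move=> u v; exact: rdotC.
- by move=> u u' v; apply: rdotDl; exact: l2seqP.
- by move=> u; apply: rdot_ge0; exact: l2seqP.
- by move=> u h; apply: eqv; apply: rdot_eq0 h; exact: l2seqP.
- by move=> u v; apply: eqv; exact: jopD.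
- by move=> u v; apply: rdot_jop; exact: l2seqP.
- by move=> u; apply: rdot_jop_le; exact: l2seqP.
- by move=> u; apply: rdot_jop_bound; exact: l2seqP.
- by move=> t u v; apply: eqv; exact: linE.
- move=> t u v; rewrite /dot -!Re_l2dot; congr complex.Re.
  by apply: (sf_selfadjoint SF); exact: l2seqP.
- by move=> s t u; apply: eqv; apply: (sf_mul SF); exact: l2seqP.
- move=> b u h; apply: eqv => /=.
  have l2B' : l2 (fun n => E b u n - u n).
    exact: (l2B (l2E b u) (l2seqP u)).
  suff h0 : l2norm (fun n => E b u n - u n) = 0%E.
    have := l2norm_eq0 l2B' h0 => h1; apply/funext => m.
    by apply/eqP; rewrite -subr_eq0; apply/eqP; exact: (congr1 (fun f => f m) h1).
  have c0 := @sf_pinfty _ _ SF u (l2seqP u).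
  apply: (cvg_unique _ _ c0) => //; apply: cvg_near_cst.
  exists b; split => [|s bs]; first exact: num_real.
  congr l2norm; apply/funext => m; congr (_ - _).
  by have /(congr1 (fun f : l2seq R => f m)) := h s (ltW bs).
- move=> b u h; apply: eqv => /=.
  apply: l2norm_eq0; first exact: l2E.
  have c0 := @sf_ninfty _ _ SF u (l2seqP u).
  apply: (cvg_unique _ _ c0) => //; apply: cvg_near_cst.
  exists b; split => [|s bs]; first exact: num_real.
  by have /(congr1 (fun f : l2seq R => l2norm f)) := h s (ltW bs).
- exact: rhoE.
- by move=> u; have [] := hrho u.
- by move=> u; have [_ _ h] := hrho u; rewrite /dot -Re_l2dot h.
Qed.

End jacobi_moments.

(** * Finite volume estimates *)

Section tridiagonal.
Variable K : comNzRingType.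
Variables d c : nat -> K.

Definition trid n : 'M[K]_n := \matrix_(i, j)
  (if i == j :> nat then d i else if j == i.+1 :> nat then - c i
   else if i == j.+1 :> nat then - c j else 0).

Lemma det_tridSS n : \det (trid n.+2) =
  d n.+1 * \det (trid n.+1) - c n ^+ 2 * \det (trid n).
Proof.
rewrite (expand_det_row _ ord_max) big_ord_recr /= big_ord_recr /= big1 ?add0r; last first.
  move=> i _; rewrite !mxE /=.
  have := ltn_ord i => hi.
  rewrite gtn_eqF; last by rewrite ltnS (leq_trans (ltnW hi)).
  rewrite ltn_eqF; last by rewrite !ltnS (leq_trans (ltnW hi)).
  by rewrite gtn_eqF ?mul0r// !ltnS.
rewrite addrC; congr (_ + _).
  rewrite !mxE /= eqxx; congr (_ * _).
  rewrite /cofactor -signr_odd oddD addbb expr0 mul1r; congr determinant.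
  by apply/matrixP => i j; rewrite !mxE !lift_max.
rewrite !mxE /= gtn_eqF// ltn_eqF// eqxx.
rewrite /cofactor /= addSn -signr_odd /= oddD addbb /= expr1 mulN1r mulNr mulrN opprK.
(* The last column of this minor has a single nonzero entry, - c n in the last row, so a second
   expansion produces the square of c n. *)
set B := row' _ _.
have BE (i j : 'I_n.+1) : B i j = if j == n :> nat then (if i == n :> nat then - c n else 0)
   else trid n.+1 i j.
  rewrite !mxE lift_max /= /bump.
  have := ltn_ord i; have := ltn_ord j; rewrite !ltnS => hj hi.
  have [->|jn] := eqVneq (j : nat) n.
    rewrite leqnn /= add1n.
    have -> : (i == n.+1 :> nat) = false by lia.
    have -> : (i == n.+2 :> nat) = false by lia.
    by rewrite eqSS eq_sym; case: eqP => // ->.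
  have -> : (n <= j)%N = false by lia.
  by rewrite /= add0n.
rewrite (expand_det_col _ ord_max) (bigD1 ord_max)//= big1 ?addr0; last first.
  move=> i ni; rewrite BE /= eqxx ifF ?mul0r//; apply/negbTE.
  by apply: contra ni => /eqP h; apply/eqP/val_inj.
rewrite BE /= !eqxx /cofactor -signr_odd oddD addbb expr0 mul1r.
rewrite expr2 mulrA mulrN mulNr; congr (- (_ * _ * _)).
congr determinant; apply/matrixP => i j; rewrite !mxE !lift_max.
have := ltn_ord i; have := ltn_ord j => hj hi.
have bj : bump n j = j by rewrite /bump leqNgt hj.
by rewrite /= !bj.
Qed.

Lemma det_trid0 : \det (trid 0) = 1.
Proof. exact: det_mx00. Qed.

Lemma det_trid1 : \det (trid 1) = d 0.
Proof. by rewrite det_mx11 mxE eqxx. Qed.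

End tridiagonal.

(** * Growth of the characteristic polynomials off the real axis *)

Section growth.
Variable R : realType.

Lemma Im_invN (r : R[i]) : complex.Im (- r^-1) = complex.Im r / nsq r.
Proof. by case: r => a b; rewrite /= opprK /nsq. Qed.

Lemma nsqM (z z' : R[i]) : nsq (z * z') = nsq z * nsq z'.
Proof. by rewrite /nsq !ReImE; ring. Qed.

Lemma nsq_eq0 (z : R[i]) : (nsq z == 0) = (z == 0).
Proof. by rewrite /nsq paddr_eq0 ?sqr_ge0// !sqrf_eq0 eq_complex. Qed.

Lemma nsqV (z : R[i]) : nsq z^-1 = (nsq z)^-1.
Proof.
have [->|z0] := eqVneq z 0; first by rewrite invr0 /nsq /= !expr0n/= addr0 invr0.
apply: (mulfI (_ : nsq z != 0)); first by rewrite nsq_eq0.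
by rewrite -nsqM !divff ?nsq_eq0// /nsq /=; ring.
Qed.

Lemma ln_le_subr1 (x : R) : 0 < x -> ln x <= x - 1.
Proof.
move=> x0; have := @expR_ge1Dx R (ln x); rewrite lnK ?posrE//; lra.
Qed.

Variables (z : R[i]) (a b : nat -> R).
Let y := complex.Im z.
Hypothesis y0 : 0 < y.
Hypothesis a_gt0 : forall j, 0 < a j.
Hypothesis a_le2 : forall j, a j <= 2.
Let p n := \det (trid (fun j => z - (b j)%:C) (fun j => (a j)%:C) n).
Let r j := p j.+1 / p j.
Let K := y + 4 / y.

Let im_shift j : complex.Im (z - (b j)%:C) = y.
Proof. by rewrite !ReImE /= oppr0 addr0. Qed.

(* The Riccati recursion r_(j+1) = z - b_(j+1) - a_j^2 / r_j. *)
Lemma det_trid_step j : p j != 0 -> y <= complex.Im (r j) <= K ->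
  p j.+1 != 0 /\ complex.Im (r j.+1) = y + a j ^+ 2 * complex.Im (r j) / nsq (r j).
Proof.
move=> pj /andP[ry rK].
have pj1 : p j.+1 != 0.
  apply/eqP => h; move: ry; rewrite /r h mul0r /= => h'.
  by have := lt_le_trans y0 h'; rewrite ltxx.
split => //.
have -> : r j.+1 = (z - (b j.+1)%:C) + (a j ^+ 2)%:C * - (r j)^-1.
  rewrite /r /p det_tridSS -/(p j) -/(p j.+1) mulrBl mulfK// rmorphXn /=.
  by rewrite mulrN invf_div mulrA.
by rewrite cImD im_shift cImM Im_invN /= mul0r addr0 mulrA.
Qed.

(** The map r -> - 1 / r preserves the upper half plane, so Im r_j never drops below y. Then |r_j|^2
    >= y Im r_j and a_j^2 <= 4 bound the added term by 4 / y, which is the origin of K. *)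
Lemma det_trid_im j : p j != 0 /\ y <= complex.Im (r j) <= K.
Proof.
have K_ge : y <= K by rewrite lerDl divr_ge0// ltW.
elim: j => [|j [pj rj]].
  by rewrite /r /p det_trid0 det_trid1 divr1 im_shift lexx oner_eq0.
have [pj1 rE] := det_trid_step pj rj; split => //.
have /andP[ry _] := rj; have r0 : 0 < complex.Im (r j) := lt_le_trans y0 ry.
have n0 : 0 < nsq (r j).
  by rewrite /nsq ltr_wpDl ?sqr_ge0// exprn_gt0.
rewrite rE /K lerDl lerD2l; apply/andP; split.
  by rewrite divr_ge0 ?mulr_ge0 ?sqr_ge0// ltW.
rewrite ler_pdivrMr// [leRHS]mulrAC ler_pdivlMr//.
have h1 : a j ^+ 2 <= 4.
  have := a_le2 j; have := a_gt0 j => h h'.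
  by rewrite (_ : 4 = 2 ^+ 2); [rewrite lerXn2r// nnegrE ltW|ring].
have h2 : complex.Im (r j) * y <= nsq (r j).
  apply: (@le_trans _ _ (complex.Im (r j) ^+ 2)); last by rewrite lerDr sqr_ge0.
  by rewrite expr2 ler_wpM2l// ltW.
rewrite -mulrA ler_pM ?sqr_ge0// mulr_ge0// ltW//.
Qed.

(** The recursion gives ln |r_n|^2 = 2 ln a_n + ln Im r_n - ln Im r_(n+1) - ln (1 - y / Im r_(n+1)).
    The middle terms telescope, starting from Im r_0 = y, and the last one gains at least y / K at
    each step. *)
Lemma det_trid_growth n :
  2 * (\sum_(j < n) ln (a j)) + (n%:R * (y / K) + ln y - ln K) <= ln (nsq (p n)).
Proof.
have K_ge : y <= K by rewrite lerDl divr_ge0// ltW.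
have K0 : 0 < K := lt_le_trans y0 K_ge.
suff h : 2 * (\sum_(j < n) ln (a j)) + n%:R * (y / K) + ln y - ln (complex.Im (r n))
   <= ln (nsq (p n)).
  apply: le_trans h; have [_ /andP[h1 h2]] := det_trid_im n.
  have : ln (complex.Im (r n)) <= ln K by rewrite ler_ln// posrE// (lt_le_trans y0).
  lra.
elim: n => [|n IH].
  rewrite big_ord0 /r /p det_trid0 det_trid1 divr1 im_shift.
  rewrite /nsq /= expr1n expr0n /= addr0 ln1; lra.
have [pn rn] := det_trid_im n; have [pn1 rE] := det_trid_step pn rn.
have [_ rn1] := det_trid_im n.+1.
move: rn rn1 => /andP[ry _] /andP[ry1 rK1].
have r0 := lt_le_trans y0 ry; have r10 := lt_le_trans y0 ry1.
have pE : p n.+1 = r n * p n by rewrite /r divfK.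
have n0 : 0 < nsq (r n) by rewrite /nsq ltr_wpDl ?sqr_ge0// exprn_gt0.
have np0 : 0 < nsq (p n) by rewrite lt_neqAle eq_sym nsq_eq0 pn nsq_ge0.
rewrite pE nsqM lnM ?posrE// big_ord_recr /= -natr1.
set s := complex.Im (r n) in rE r0 ry IH *; set s1 := complex.Im (r n.+1) in rE ry1 rK1 r10 *.
have d1 : s1 - y = a n ^+ 2 * s / nsq (r n) by rewrite rE addrC addKr.
have d0 : 0 < s1 - y.
  by rewrite d1 divr_gt0// mulr_gt0// exprn_gt0.
have E : ln ((s1 - y) / s1) = 2 * ln (a n) + ln s - ln (nsq (r n)) - ln s1.
  rewrite ln_div ?posrE// d1.
  by rewrite ln_div ?posrE ?mulr_gt0 ?exprn_gt0// lnM ?posrE ?exprn_gt0// lnXn// mulr_natl; ring.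
have h1 : ln ((s1 - y) / s1) <= - (y / s1).
  apply: (le_trans (ln_le_subr1 (divr_gt0 d0 r10))).
  by rewrite mulrBl divff ?gt_eqF// addrAC subrr add0r.
have h2 : y / K <= y / s1 by rewrite ler_wpM2l ?(ltW y0)// lef_pV2 ?posrE.
rewrite E in h1; lra.
Qed.

End growth.

(** * Truncations: eigenvalues and traces of powers *)

Section finite_section.
Variables (R : realType) (J : jacobi R) (N : nat).
Local Notation C := R[i].

(* The truncation of J to the sites 0, ..., N - 1. *)
Definition truncJ : 'M[R]_N := \matrix_(i, j)
  ((j == i.+1 :> nat)%:R * ja J i%:Z + (i == j.+1 :> nat)%:R * ja J j%:Z
   + (i == j)%:R * jb J i%:Z).

Lemma det_truncJ (z : C) :
  \det (z%:M - map_mx (real_complex R) truncJ) =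
  \det (trid (fun j => z - (jb J j%:Z)%:C) (fun j => (ja J j%:Z)%:C) N).
Proof.
congr determinant; apply/matrixP => i j; rewrite !mxE.
have [ij|ij] := eqVneq i j.
  rewrite ij eqxx mulr1n.
  have -> : (j == j.+1 :> nat) = false by lia.
  by rewrite !mul0r !add0r mul1r.
rewrite mulr0n sub0r.
have -> : (i == j :> nat) = false by apply/negbTE.
have [->|ij1] := eqVneq (j : nat) i.+1.
  have -> : (i == i.+2 :> nat) = false by lia.
  by rewrite !mul0r !addr0 mul1r.
have [->|ij2] := eqVneq (i : nat) j.+1; first by rewrite !mul0r addr0 add0r mul1r.
by rewrite !mul0r !addr0 rmorph0 oppr0.
Qed.

Definition extZ (T : nmodType) (x : 'I_N -> T) (n : int) : T :=
  if n is Posz m then (if insub m is Some i then x i else 0) else 0.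

Lemma extZ_ord (T : nmodType) (x : 'I_N -> T) (i : 'I_N) : extZ x i%:Z = x i.
Proof. by rewrite /extZ /= valK. Qed.

Lemma extZ_out (T : nmodType) (x : 'I_N -> T) (n : int) :
  (forall i : 'I_N, n != i%:Z) -> extZ x n = 0.
Proof.
case: n => // m h; rewrite /extZ; case: insubP => // i hi im.
by have := h i; rewrite im eqxx.
Qed.

Lemma sum_delta (T : pzRingType) (x : 'I_N -> T) (n : int) :
  \sum_(k < N) ((k%:Z == n)%:R * x k) = extZ x n.
Proof.
case: n => m; last by rewrite big1// => k _; rewrite mul0r.
rewrite /extZ; case: insubP => [i hi im|hm].
  rewrite (bigD1 i)//= big1 ?addr0 ?im ?eqxx ?mul1r// => k ki.
  have -> : (k%:Z == m) = false; last by rewrite mul0r.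
  by apply/negbTE; apply: contra ki => /eqP [h]; apply/eqP/val_inj; exact: etrans h (esym im).
rewrite big1// => k _; have -> : (k%:Z == m) = false; last by rewrite mul0r.
by apply/negbTE; apply: contra hm => /eqP [<-].
Qed.

Lemma truncJ_sym i j : truncJ i j = truncJ j i.
Proof.
rewrite !mxE; congr (_ + _); first by rewrite addrC.
by rewrite eq_sym; case: eqP => [->|_]//; rewrite !mul0r.
Qed.

(** J acts on arbitrary real sequences, with no summability; this is enough for the matrix entries
    of its powers. *)
Definition jopr (x : int -> R) : int -> R :=
  fun n => ja J n * x (n + 1) + ja J (n - 1) * x (n - 1) + jb J n * x n.

Lemma sum_truncJ (x : 'I_N -> R) (l : 'I_N) :
  \sum_k truncJ l k * x k = jopr (extZ x) l%:Z.
Proof.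
rewrite /jopr -!sum_delta !mulr_sumr -!big_split /=; apply: eq_bigr => k _.
rewrite !mxE !mulrDl; congr (_ + _ + _).
- rewrite (_ : (k == l.+1 :> nat) = (k%:Z == l%:Z + 1)); first by ring.
  by apply/eqP/eqP; lia.
- rewrite (_ : (l == k.+1 :> nat) = (k%:Z == l%:Z - 1)); last by apply/eqP/eqP; lia.
  by case: eqP => [<-|_] /=; ring.
- rewrite (_ : (l == k) = (k%:Z == l%:Z)); first by ring.
  by rewrite eq_sym.
Qed.

Lemma sumZ_finite (x : int -> R) :
  (forall n : int, (forall i : 'I_N, n != i%:Z) -> x n = 0) ->
  summableZ x /\ sumZ x = \sum_(i < N) x i%:Z.
Proof.
elim: N x => [|M IH] x xE.
  have x0 n : x n = 0 by apply: xE => -[].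
  split.
    rewrite /summableZ /esumZ esum1 ?ltry// => n _.
    by rewrite x0 normr0.
  rewrite big_ord0 -(sumZ1 0 0); congr sumZ; apply/funext => n.
  by rewrite x0 if_same.
have [|s1 e1] := IH (fun n => if n == M%:Z then 0 else x n).
  move=> n h; case: eqP => // /eqP nM; apply: xE => i.
  by have [iM|iM] := eqVneq (i : nat) M; [rewrite iM|have hi : (i < M)%N; [have := ltn_ord i; lia|exact: (h (Ordinal hi))]].
have s2 : summableZ (fun n => if n == M%:Z then x M%:Z else 0).
  rewrite /summableZ /esumZ (_ : esum _ _ = \esum_(n in [set M%:Z]) (`|x M%:Z|)%:E).
    by rewrite esum_set1 ?ltry// lee_fin.
  rewrite [RHS]esum_mkcond; apply: eq_esum => n _.
  have -> : (n \in [set M%:Z]) = (n == M%:Z) by apply/idP/eqP; rewrite inE.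
  by case: eqP => // _; rewrite normr0.
have E n : x n = (if n == M%:Z then 0 else x n) + (if n == M%:Z then x M%:Z else 0).
  by case: eqP => [->|_]; rewrite ?add0r ?addr0.
split.
  have := summableZD s1 s2; congr summableZ; apply/funext => n; exact/esym/E.
rewrite (_ : x = fun n => (if n == M%:Z then 0 else x n) + (if n == M%:Z then x M%:Z else 0)).
  rewrite sumZD// e1 sumZ1 big_ord_recr /= eqxx add0r; congr (_ + _).
  apply: eq_bigr => i _; have -> : (i%:Z == M%:Z) = false by have := ltn_ord i; lia.
  by rewrite addr0.
by apply/funext.
Qed.

(** The truncation is a compression of J: extending u by zero to Z preserves both the norm and the
    quadratic form, so the bound for J carries over. *)
Lemma quad_truncJ (u : 'I_N -> C) :
  \sum_i nsq (u i) = 1 ->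
  `|\sum_i \sum_j truncJ i j * (complex.Re (u i) * complex.Re (u j)
       + complex.Im (u i) * complex.Im (u j))| <= 2.
Proof.
move=> u1; pose v := extZ u.
have v0 (n : int) : (forall i : 'I_N, n != i%:Z) -> v n = 0 by exact: extZ_out.
have ReE n : complex.Re (v n) = extZ (fun i => complex.Re (u i)) n.
  by rewrite /v /extZ; case: n => // m; case: insub.
have ImE n : complex.Im (v n) = extZ (fun i => complex.Im (u i)) n.
  by rewrite /v /extZ; case: n => // m; case: insub.
have [|s1 e1] := @sumZ_finite (fun n => nsq (v n)).
  by move=> n /v0 ->; rewrite /nsq /= expr0n /= addr0.
have l2v : l2 v.
  move: s1; rewrite /l2 l2sqE /summableZ.
  rewrite (_ : (fun n => `|nsq (v n)|) = fun n => nsq (v n))//.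
  by apply/funext => n; rewrite ger0_norm ?nsq_ge0.
have vv : rdot v v = 1.
  rewrite /rdot (_ : (fun n => _) = fun n => nsq (v n))//.
  by rewrite e1 -u1; apply: eq_bigr => i _; rewrite /v extZ_ord.
have := rdot_jop_bound J l2v; rewrite vv mulr1; congr (`| _ | <= _).
rewrite /rdot; have [|_ ->] := @sumZ_finite (fun n => complex.Re (v n) * complex.Re (jop J v n)
   + complex.Im (v n) * complex.Im (jop J v n)).
  by move=> n /v0 ->; rewrite /= !mul0r addr0.
apply: eq_bigr => i _.
have jE : complex.Re (jop J v i%:Z) = jopr (fun n => complex.Re (v n)) i%:Z /\
          complex.Im (jop J v i%:Z) = jopr (fun n => complex.Im (v n)) i%:Z.
  by rewrite /jop /jacobi_op /jopr !ReImE /=; split; ring.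
rewrite jE.1 jE.2 (_ : (fun n => complex.Re (v n)) = extZ (fun i => complex.Re (u i))); last exact/funext.
rewrite (_ : (fun n => complex.Im (v n)) = extZ (fun i => complex.Im (u i))); last exact/funext.
rewrite -!sum_truncJ ReE ImE !extZ_ord !mulr_sumr -big_split /=.
by apply: eq_bigr => j _; ring.
Qed.

(** Unitary diagonalization of the truncation as a Hermitian matrix. The eigenvalue lam i is the
    quadratic form at row i of the unitary matrix, a unit vector, hence at most 2 in modulus by
    [quad_truncJ]. *)
Lemma truncJ_spectrum : exists lam : 'I_N -> R,
  [/\ forall i, `|lam i| <= 2,
      forall m, \tr (truncJ ^+ m) = \sum_i lam i ^+ m &
      forall z : C, \det (z%:M - map_mx (real_complex R) truncJ) = \prod_i (z - (lam i)%:C)].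
Proof.
pose TC := map_mx (real_complex R) truncJ.
have conjE (x : C) : Num.conj x = complex.conjc x by [].
have TCreal : TC \is a (mxOver Num.real).
  by apply/mxOverP => i j; rewrite mxE; apply/complex_realP; eexists.
have TCherm : TC \is hermsymmx.
  apply: realsym_hermsym => //; apply/is_hermitianmxP; rewrite expr0 scale1r.
  rewrite map_mx_id//; apply/matrixP => i j.
  by rewrite [RHS]mxE [LHS]mxE [RHS]mxE truncJ_sym.
have /orthomx_spectralP := hermitian_normalmx TCherm.
have := hermitian_spectral_diag_real TCherm.
have := spectral_unitarymx TC.
set P := spectralmx TC; set D := spectral_diag TC => PU Dreal TCE.
have PV : invmx P = map_mx Num.conj P^T by rewrite invmx_unitary.
have Pu : P \in unitmx := unitarymx_unit PU.
pose lam i := complex.Re (D 0 i).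
have lamE i : D 0 i = (lam i)%:C by rewrite /lam RRe_real//; move/mxOverP: Dreal; apply.
have PD : P *m TC *m invmx P = diag_mx D.
  by rewrite TCE !mulmxA mulmxV// mul1mx -mulmxA mulmxV// mulmx1.
have Re_sum (I : finType) (F : I -> C) : complex.Re (\sum_i F i) = \sum_i complex.Re (F i).
  by rewrite (big_morph _ (@cReD R) (erefl _)).
exists lam; split.
- move=> i.
  have u1 : \sum_k nsq (P i k) = 1.
    have := congr1 (fun M : 'M[C]_N => complex.Re (M i i)) (mulmxV Pu).
    rewrite PV /= !mxE eqxx Re_sum /= => <-; apply: eq_bigr => k _.
    by rewrite !mxE conjE /nsq !ReImE /=; case: (P i k) => c d /=; ring.
  have -> : lam i = \sum_k \sum_l truncJ k l * (complex.Re (P i k) * complex.Re (P i l)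
       + complex.Im (P i k) * complex.Im (P i l)).
    have := congr1 (fun M : 'M[C]_N => complex.Re (M i i)) PD.
    rewrite PV [in RHS]/= [in RHS]mxE eqxx mulr1n -/(lam i) => <-.
    rewrite mxE Re_sum exchange_big /=; apply: eq_bigr => l _.
    rewrite [X in X * _]mxE mulr_suml Re_sum; apply: eq_bigr => k _.
    have -> : (map_mx Num.conj P^T) l i = complex.conjc (P i l) by rewrite !mxE conjE.
    rewrite (_ : TC k l = (truncJ k l)%:C); last by rewrite mxE.
    by rewrite !ReImE /=; case: (P i k) => c d; case: (P i l) => c' d' /=; ring.
  exact: quad_truncJ u1.
- move=> m.
  have TCm : TC ^+ m = invmx P *m diag_mx (\row_i (lam i)%:C ^+ m) *m P.
    elim: m => [|m IH].
      rewrite expr0 (_ : diag_mx _ = 1%:M); last first.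
        by rewrite -diag_const_mx; congr diag_mx; apply/matrixP => i j; rewrite !mxE expr0.
      by rewrite mulmx1 mulVmx.
    rewrite exprS IH {1}TCE -mulmxE !mulmxA; congr (_ *m _).
    rewrite -[X in X *m diag_mx (\row__ _)]mulmxA mulmxV// mulmx1 -mulmxA; congr (_ *m _).
    rewrite mulmx_diag; congr diag_mx; apply/matrixP => i j.
    by rewrite !mxE lamE exprS.
  apply: (@complexI R); rewrite -trace_map_mx rmorphXn /= TCm.
  rewrite mxtrace_mulC mulmxA mulmxV// mul1mx mxtrace_diag rmorph_sum.
  by apply: eq_bigr => i _; rewrite mxE rmorphXn.
- move=> z.
  have -> : z%:M - TC = invmx P *m (z%:M - diag_mx D) *m P.
    rewrite mulmxBr mulmxBl -TCE; congr (_ - _).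
    by rewrite mul_mx_scalar -scalemxAl mulVmx// scalemx1.
  rewrite !det_mulmx mulrAC -det_mulmx mulVmx// det1 mul1r.
  have -> : z%:M - diag_mx D = diag_mx (\row_i (z - (lam i)%:C)).
    apply/matrixP => i j; rewrite !mxE; case: eqP => [->|_].
      by rewrite !mulr1n lamE.
    by rewrite !mulr0n subrr.
  by rewrite det_diag; apply: eq_bigr => i _; rewrite mxE.
Qed.

Lemma jopr_supp (m : nat) (j n : int) : (m < `|n - j|)%N ->
  iter m jopr (fun n => (n == j)%:R) n = 0.
Proof.
elim: m n => [|m IH] n h /=.
  by have -> : (n == j) = false by lia.
by rewrite /jopr !IH ?mulr0 ?addr0//; lia.
Qed.

(** J moves the support by one site at a time, so m steps starting from j do not reach outside [0,
    N) and cannot see the truncation. *)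
Lemma truncJ_exp (j : 'I_N) (m : nat) : (m <= j)%N -> (j + m < N)%N ->
  forall n, extZ (fun i => (truncJ ^+ m) i j) n = iter m jopr (fun n => (n == j%:Z)%:R) n.
Proof.
elim: m => [|m IH] mj jm n.
  have [[i ->]|h] := pselect (exists i : 'I_N, n = i%:Z).
    by rewrite extZ_ord expr0 mxE.
  rewrite extZ_out; last by move=> i; apply/eqP => e; apply: h; exists i.
  by rewrite /= (_ : (n == j%:Z) = false)//; apply/negbTE/eqP => e; apply: h; exists j.
have [[i ->]|h] := pselect (exists i : 'I_N, n = i%:Z).
  rewrite extZ_ord exprS -mulmxE mxE (sum_truncJ (fun k => (truncJ ^+ m) k j)) iterS.
  congr jopr; apply/funext => k; apply: IH; lia.
have out (i : 'I_N) : n != i%:Z by apply/eqP => e; apply: h; exists i.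
rewrite extZ_out// jopr_supp//.
case: n {h} out => n out; last by lia.
rewrite ltnNge; apply/negP => h.
have hn : (n < N)%N by lia.
by have := out (Ordinal hn); rewrite eqxx.
Qed.

(** Three terms, each with a coefficient at most 2 in modulus, give the 6. *)
Lemma jopr_bound (x : int -> R) (B : R) : (forall n, `|x n| <= B) ->
  forall n, `|jopr x n| <= 6 * B.
Proof.
move=> xB n; have B0 : 0 <= B := le_trans (normr_ge0 _) (xB 0).
have ax k l : `|ja J k * x l| <= 2 * B.
  by rewrite normrM ler_pM// ger0_norm ?ja_ge0// ja_le2.
have bx : `|jb J n * x n| <= 2 * B by rewrite normrM ler_pM// jb_le2.
apply: (le_trans (ler_normD _ _)); apply: (le_trans (lerD (ler_normD _ _) (lexx _))).
have := ax n (n + 1); have := ax (n - 1) (n - 1); lra.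
Qed.

Lemma iter_jopr_bound (j : int) m n : `|iter m jopr (fun n => (n == j)%:R) n| <= 6 ^+ m.
Proof.
elim: m n => [|m IH] n /=; last by rewrite exprS; exact: jopr_bound.
by rewrite expr0; case: eqP => _; rewrite ?normr1 ?normr0.
Qed.

Lemma extZ_bound (x : 'I_N -> R) (B : R) : 0 <= B -> (forall i, `|x i| <= B) ->
  forall n, `|extZ x n| <= B.
Proof.
move=> B0 xB [n|n]; rewrite /extZ ?normr0//.
by case: insub => [i|]; rewrite ?normr0.
Qed.

Lemma truncJ_exp_bound (j : 'I_N) m i : `|(truncJ ^+ m) i j| <= 6 ^+ m.
Proof.
elim: m i => [|m IH] i.
  by rewrite !expr0 mxE; case: eqP => _; rewrite ?normr1 ?normr0.
rewrite exprS -mulmxE mxE (sum_truncJ (fun k => (truncJ ^+ m) k j)) exprS.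
by apply: jopr_bound; apply: extZ_bound => //; exact: exprn_ge0.
Qed.

(** Only sites within m of an end, at most 2 m of them, can differ, and there each of the two terms
    is at most 6^m. The bound does not depend on N. *)
Lemma truncJ_trace m :
  `|\tr (truncJ ^+ m) - \sum_(j < N) iter m jopr (fun n => (n == j%:Z)%:R) j%:Z|
    <= (2 * m)%:R * (2 * 6 ^+ m).
Proof.
rewrite /mxtrace -sumrB.
apply: (le_trans (ler_norm_sum _ _ _)).
have bd (j : 'I_N) : `|(truncJ ^+ m) j j - iter m jopr (fun n => (n == j%:Z)%:R) j%:Z|
    <= (~~ ((m <= j)%N && (j + m < N)%N))%:R * (2 * 6 ^+ m).
  case: (boolP ((m <= j)%N && (j + m < N)%N)) => [/andP[h1 h2]|_].
    by rewrite -(truncJ_exp h1 h2) extZ_ord subrr normr0 mul0r.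
  rewrite mul1r; apply: (le_trans (ler_normB _ _)).
  have := truncJ_exp_bound j m j; have := iter_jopr_bound j m j; lra.
apply: (le_trans (ler_sum _ (fun j _ => bd j))).
rewrite -mulr_suml ler_wpM2r ?mulr_ge0 ?exprn_ge0//.
rewrite -natr_sum ler_nat.
have cnt n : (\sum_(j < n) (j < m) <= m)%N.
  suff -> : (\sum_(j < n) (j < m) = minn n m)%N by rewrite geq_minr.
  by elim: n => [|n IH]; rewrite ?big_ord0 ?min0n// big_ord_recr /= IH; lia.
apply: (@leq_trans (\sum_(j < N) ((j < m) + (N <= j + m)))%N).
  by apply: leq_sum => j _; lia.
rewrite big_split /= mul2n -addnn leq_add ?cnt//.
(* Reversing the order of the sites carries those near the right end to those near the left end,
   which [cnt] counts. *)
rewrite (reindex_inj rev_ord_inj) /=; apply: leq_trans (cnt N).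
by apply: leq_sum => j _; have := ltn_ord j; lia.
Qed.

End finite_section.

(** * The finite volume inequality for a single Jacobi matrix *)

Section ergodic_pointwise.
Variable R : realType.
Implicit Types J : jacobi R.

Definition moment J m : R := iter m (jopr J) (fun n => (n == 0)%:R) 0.

Lemma momentE J m : complex.Re (iter m (jop J) delta0 0) = moment J m.
Proof.
suff H n : complex.Re (iter m (jop J) delta0 n) = iter m (jopr J) (fun n => (n == 0)%:R) n by exact: H.
elim: m n => [|m IH] n /=; first by rewrite /delta0; case: eqP.
rewrite /jop /jacobi_op /jopr -!IH !ReImE /= -/(jop J); ring.
Qed.

Lemma iter_jshift J (j : nat) n :
  ja (iter j (@jshift R) J) n = ja J (n + j%:Z) /\ jb (iter j (@jshift R) J) n = jb J (n + j%:Z).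
Proof.
elim: j n => [|j IH] n; first by rewrite addr0.
rewrite iterS /=; have [-> ->] := IH (n + 1).
by rewrite (_ : n + 1 + j%:Z = n + j.+1%:Z)//; lia.
Qed.

Lemma moment_shift J (j : nat) m :
  iter m (jopr J) (fun n => (n == j%:Z)%:R) j%:Z = moment (iter j (@jshift R) J) m.
Proof.
suff H n : iter m (jopr J) (fun n => (n == j%:Z)%:R) (n + j%:Z) =
    iter m (jopr (iter j (@jshift R) J)) (fun n => (n == 0)%:R) n.
  by rewrite /moment -H add0r.
elim: m n => [|m IH] n /=; first by congr ((nat_of_bool _)%:R); apply/eqP/eqP; lia.
rewrite /jopr !(iter_jshift J j _).1 !(iter_jshift J j _).2 -!IH.
rewrite (_ : n + j%:Z + 1 = n + 1 + j%:Z); last by lia.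
by rewrite (_ : n + j%:Z - 1 = n - 1 + j%:Z)//; lia.
Qed.

(* Evaluation of the polynomial q on the spectral side: <delta_0, q(J) delta_0>. *)
Definition poly_moment (q : {poly R}) J : R := \sum_(m < size q) q`_m * moment J m.

Lemma ln_prod_nsq N (lam : 'I_N -> R) (z : R[i]) : 0 < complex.Im z ->
  ln (nsq (\prod_i (z - (lam i)%:C))) = \sum_i ln (nsq (z - (lam i)%:C)).
Proof.
move=> z0; elim: N lam => [|N IH] lam.
  by rewrite !big_ord0 /nsq /= expr1n expr0n /= addr0 ln1.
have p0 l : 0 < nsq (z - l%:C).
  by rewrite /nsq !ReImE /= oppr0 addr0 ltr_wpDl ?sqr_ge0// exprn_gt0.
rewrite !big_ord_recr /= nsqM lnM ?posrE//; first by rewrite IH.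
apply: (big_ind (fun x => 0 < nsq x)) => //.
- by rewrite /nsq /= expr1n expr0n /= addr0.
- by move=> x y' hx hy; rewrite nsqM mulr_gt0.
Qed.

(** Both sides estimate ln |det (z - J_N)|^2 = \sum_i ln |z - lam_i|^2: from below by the growth of
    p_N, from above by tr q(J_N), which is the sum over sites of local moments up to boundary terms.
    What matters is that B depends neither on J nor on N. *)
Lemma finite_volume_bound (z : R[i]) (q : {poly R}) :
  0 < complex.Im z ->
  (forall t : R, `|t| <= 2 -> ln (nsq (z - t%:C)) <= q.[t]) ->
  let y := complex.Im z in let K := y + 4 / y in
  exists B : R, forall J (N : nat), (forall j : nat, 0 < ja J j%:Z) ->
    2 * (\sum_(j < N) ln (ja J j%:Z)) + N%:R * (y / K) + (ln y - ln K) <=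
    \sum_(j < N) poly_moment q (iter j (@jshift R) J) + B.
Proof.
move=> z0 hq y K.
exists (\sum_(m < size q) `|q`_m| * ((2 * m)%:R * (2 * 6 ^+ m))) => J N a0.
have h1 := det_trid_growth (fun j => jb J j%:Z) z0 a0 (fun j => ja_le2 J j%:Z) N.
have [lam [lam2 lamtr lamdet]] := truncJ_spectrum J N.
have h2 : \sum_i ln (nsq (z - (lam i)%:C)) <= \sum_i q.[lam i].
  by apply: ler_sum => i _; exact: hq.
have h3 : \sum_i q.[lam i] = \sum_(m < size q) q`_m * \tr (truncJ J N ^+ m).
  under eq_bigr do rewrite horner_coef.
  by rewrite exchange_big /=; apply: eq_bigr => m _; rewrite lamtr mulr_sumr.
have h4 : \sum_(j < N) poly_moment q (iter j (@jshift R) J) =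
   \sum_(m < size q) q`_m * \sum_(j < N) iter m (jopr J) (fun n => (n == j%:Z)%:R) j%:Z.
  rewrite /poly_moment exchange_big /=; apply: eq_bigr => m _.
  by rewrite mulr_sumr; apply: eq_bigr => j _; rewrite moment_shift.
have h5 : \sum_(m < size q) q`_m * \tr (truncJ J N ^+ m) <=
   \sum_(m < size q) q`_m * \sum_(j < N) iter m (jopr J) (fun n => (n == j%:Z)%:R) j%:Z
   + \sum_(m < size q) `|q`_m| * ((2 * m)%:R * (2 * 6 ^+ m)).
  rewrite -lerBlDl -sumrB; apply: ler_sum => m _; rewrite -mulrBr.
  by apply: (le_trans (ler_norm _)); rewrite normrM ler_wpM2l// truncJ_trace.
rewrite -det_truncJ lamdet ln_prod_nsq// in h1.
rewrite h4; apply: le_trans h5; rewrite -h3; apply: le_trans h2.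
by apply: le_trans h1; rewrite -/y -/K; lra.
Qed.

End ergodic_pointwise.

(** * Averaging over the ergodic measure *)

Section log_polynomial.
Variable R : realType.

(** Partial sums of the power series of - ln (1 - v). *)
Definition log_sum (n : nat) (v : R) : R := \sum_(i < n) v ^+ i.+1 / i.+1%:R.

Lemma is_derive_log_sum n (x : R) :
  is_derive x 1 (log_sum n) (\sum_(i < n) x ^+ i).
Proof.
elim: n => [|n IH].
  rewrite (_ : log_sum 0 = cst 0); first by rewrite big_ord0; exact: is_derive_cst.
  by apply/funext => v; rewrite /log_sum big_ord0.
have h0 : is_derive x 1 (id ^+ n.+1 : R -> R) ((n.+1%:R * x ^+ n) *: 1).
  exact: (is_deriveX n.+1 (is_derive_id x 1)).
have h1 := is_deriveD IH (is_deriveZ n.+1%:R^-1 h0).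
apply: is_derive_eq.
  rewrite (_ : log_sum n.+1 = log_sum n + n.+1%:R^-1 *: (id ^+ n.+1 : R -> R)); first exact: h1.
  apply/funext => v; rewrite /log_sum big_ord_recr /= [RHS]/(_ + _); congr (_ + _).
  by rewrite mulrC; congr (_ * _); elim: n.+1 => // m IHm; rewrite !exprS IHm.
rewrite big_ord_recr /=; congr (_ + _).
by rewrite /GRing.scale /= mulr1 mulrA mulVf ?mul1r.
Qed.

(** The remainder vanishes at 0 and has derivative x^n / (1 - x), so the mean value theorem gives
    its sign and a bound uniform for v in [0, q]. *)
Lemma ln_log_sum n (v q : R) : 0 <= v -> v <= q -> q < 1 ->
  0 <= - ln (1 - v) - log_sum n v <= q ^+ n / (1 - q).
Proof.
move=> v0 vq q1.
pose f := - (@ln R \o (cst (1 : R) - id)) - log_sum n.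
have df (x : R) : x < 1 -> is_derive x 1 f (x ^+ n / (1 - x)).
  move=> x1.
  have h1 : is_derive x 1 (cst (1 : R) - id) (0 - 1) :=
    is_deriveB (is_derive_cst _ _ _) (is_derive_id _ _).
  have h2 : is_derive (1 - x) 1 (@ln R) (1 - x)^-1 by apply: is_derive1_ln; lra.
  have h3 := @is_derive1_comp R (@ln R) (cst 1 - id) x _ _ h2 h1.
  have h4 := is_deriveB (is_deriveN h3) (is_derive_log_sum n x).
  suff <- : - ((1 - x)^-1 * (0 - 1)) - \sum_(i < n) x ^+ i = x ^+ n / (1 - x) by exact: h4.
  have E : (1 - x) * \sum_(i < n) x ^+ i = 1 - x ^+ n by rewrite -opprB mulNr -subrX1 opprB.
  have x1' : 1 - x != 0 by rewrite gt_eqF// subr_gt0.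
  by apply: (mulfI x1'); rewrite mulrBr E mulrCA divff// ; field.
have cf : {within `[0, v], continuous f}.
  apply: derivable_within_continuous => x; rewrite in_itv/= => /andP[x0 xv].
  by have [] := df x (le_lt_trans xv (le_lt_trans vq q1)).
have [|c] := MVT_segment (df := fun x => x ^+ n / (1 - x)) v0 _ cf.
  by move=> x; rewrite in_itv/= => /andP[_ xv]; apply: df; exact: (lt_le_trans xv (le_trans vq (ltW q1))).
rewrite in_itv/= => /andP[c0 cv].
have -> : f v = - ln (1 - v) - log_sum n v by [].
have -> : f 0 = 0.
  rewrite /f !fctE /= subr0 ln1 oppr0 /log_sum big1 ?subrr// => i _.
  by rewrite expr0n mul0r.
rewrite !subr0 => ->.
have h1c : 0 < 1 - c by lra.
have h1q : 0 < 1 - q by lra.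
apply/andP; split; first by rewrite mulr_ge0// divr_ge0 ?exprn_ge0// ltW.
apply: (@le_trans _ _ (c ^+ n / (1 - c))).
  by rewrite ler_piMr// ?divr_ge0 ?exprn_ge0 ?(ltW h1c)//; lra.
rewrite ler_pM ?exprn_ge0 ?invr_ge0 ?(ltW h1c)//.
  by rewrite lerXn2r ?nnegrE//; lra.
by rewrite lef_pV2 ?posrE//; lra.
Qed.

(** For |t| <= 2 the value |z - t|^2 lies in [y^2, M]. With v = 1 - |z - t|^2 / M, which lies in
    [0, th] with th < 1, ln |z - t|^2 = ln M + ln (1 - v). Truncating the series of - ln (1 - v),
    whose terms are nonnegative, errs on the required side. *)
Lemma log_poly_approx (z : R[i]) (e : R) : 0 < complex.Im z -> 0 < e ->
  exists q : {poly R}, forall t : R, `|t| <= 2 ->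
    ln (nsq (z - t%:C)) <= q.[t] <= ln (nsq (z - t%:C)) + e.
Proof.
move=> y0 e0; set x := complex.Re z; set y := complex.Im z in y0 *.
have nsqE t : nsq (z - t%:C) = (x - t) ^+ 2 + y ^+ 2.
  by rewrite /nsq !ReImE /= oppr0 addr0.
pose M := (`|x| + 2) ^+ 2 + y ^+ 2.
have y2 : 0 < y ^+ 2 by rewrite exprn_gt0.
have M0 : 0 < M by rewrite ltr_wpDl// sqr_ge0.
pose th := 1 - y ^+ 2 / M.
have th1 : th < 1 by rewrite gtrBl divr_gt0.
have th0 : 0 <= th by rewrite subr_ge0 ler_pdivrMr// mul1r lerDr sqr_ge0.
have [n hn] : exists n, th ^+ n / (1 - th) <= e.
  have h : `|th| < 1 by rewrite ger0_norm.
  have e1 : 0 < e * (1 - th) by rewrite mulr_gt0// subr_gt0.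
  have /cvgrPdist_lt/(_ _ e1)[n _ /(_ n (leqnn n))] := cvg_expr h.
  rewrite /= sub0r normrN => hn; exists n.
  by rewrite ler_pdivrMr ?subr_gt0//; exact: le_trans (ler_norm _) (ltW hn).
pose v : {poly R} := 1 - M^-1 *: ((x%:P - 'X) ^+ 2 + (y ^+ 2)%:P).
exists ((ln M)%:P - \sum_(i < n) i.+1%:R^-1 *: v ^+ i.+1) => t t2.
have vE : v.[t] = 1 - nsq (z - t%:C) / M.
  by rewrite /v !hornerE nsqE mulrC.
have qE : ((ln M)%:P - \sum_(i < n) i.+1%:R^-1 *: v ^+ i.+1).[t] = ln M - log_sum n v.[t].
  rewrite hornerD hornerN hornerC horner_sum; congr (_ - _); apply: eq_bigr => i _.
  by rewrite hornerZ horner_exp mulrC.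
have sM : nsq (z - t%:C) <= M.
  rewrite nsqE lerD2r -[(x - t) ^+ 2]real_normK ?num_real// lerXn2r ?nnegrE ?addr_ge0//.
  by apply: (le_trans (ler_normB _ _)); rewrite lerD2l.
have s0 : y ^+ 2 <= nsq (z - t%:C) by rewrite nsqE lerDr sqr_ge0.
have v0 : 0 <= v.[t] by rewrite vE subr_ge0 ler_pdivrMr// mul1r.
have vth : v.[t] <= th by rewrite vE lerD2l lerN2 ler_pM2r ?invr_gt0.
have /andP[h1 h2] := ln_log_sum n v0 vth th1.
have s00 : 0 < nsq (z - t%:C) := lt_le_trans y2 s0.
have E : ln (nsq (z - t%:C)) = ln M + ln (1 - v.[t]).
  rewrite vE opprB addrCA subrr addr0 -lnM ?posrE ?divr_gt0//.
  by rewrite mulrC divfK// gt_eqF.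
by rewrite qE E; apply/andP; split; lra.
Qed.

End log_polynomial.

(** * Borel measurability of the coefficients, the shift and the moments *)

Section jacobi_measurable.
Variable R : realType.
Local Notation JB := (jacobi_borel R).

Lemma jdist_term_le (J J' : jacobi R) n : jdist_term J J' n <= jdist J J'.
Proof.
rewrite -lee_fin jdistE; apply: ereal_sup_ubound; exists [set n].
  by split.
by rewrite fsbig_set1.
Qed.

Lemma open_measurable_jacobi (U : set (jacobi R)) : open U -> measurable (U : set JB).
Proof. by move=> oU; exact: sub_sigma_algebra. Qed.

Lemma nbhs_open (T : topologicalType) (U : set T) :
  (forall x, U x -> nbhs x U) -> open U.
Proof. by move=> h; rewrite openE. Qed.

Lemma jdist_nbhs (J : jacobi R) (U : set (jacobi R)) (e : R) : 0 < e ->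
  (forall J', jdist J J' < e -> U J') -> nbhs J U.
Proof.
by move=> e0 h; apply/nbhs_ballP; exists e.
Qed.

Lemma jdist_ge0 (J J' : jacobi R) : 0 <= jdist J J'.
Proof. by apply: le_trans (jdist_term_le J J' 0); exact: jdist_term_ge0. Qed.

Lemma lipschitz_measurable (f : jacobi R -> R) (C : R) :
  (forall J J', `|f J - f J'| <= C * jdist J J') ->
  measurable_fun setT (f : JB -> R).
Proof.
move=> fL.
have C0 : 0 < `|C| + 1 by rewrite ltr_wpDl.
apply: (measurability (@RGenOpens.G R)); first exact: RGenOpens.measurableE.
move=> _ [_ [a [b ->]] <-]; rewrite setTI.
apply: open_measurable_jacobi; apply: nbhs_open => J /=.
rewrite in_itv/= => /andP[aJ Jb].
pose e := Num.min (f J - a) (b - f J).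
have e0 : 0 < e by rewrite lt_min !subr_gt0 aJ.
apply: (@jdist_nbhs _ _ (e / (`|C| + 1))); first by rewrite divr_gt0.
move=> J'; rewrite ltr_pdivlMr// => h /=; rewrite in_itv/=.
have : `|f J - f J'| < e.
  apply: le_lt_trans (fL J J') _; apply: le_lt_trans h.
  rewrite mulrC ler_wpM2l ?jdist_ge0//.
  by apply: (le_trans (ler_norm _)); rewrite lerDl.
rewrite lt_min => /andP[]; rewrite !ltr_norml => /andP[h1 h2] /andP[h3 h4].
by apply/andP; split; lra.
Qed.

Lemma measurable_ja n : measurable_fun setT (fun J : JB => ja (J : jacobi R) n).
Proof.
apply: (@lipschitz_measurable _ (2 ^+ `|n|%N)) => J J'.
have := jdist_term_le J J' n; rewrite /jdist_term mulrC ler_pdivrMr ?exprn_gt0// mulrC => h.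
by apply: le_trans h; rewrite lerDl.
Qed.

Lemma measurable_jb n : measurable_fun setT (fun J : JB => jb (J : jacobi R) n).
Proof.
apply: (@lipschitz_measurable _ (2 ^+ `|n|%N)) => J J'.
have := jdist_term_le J J' n; rewrite /jdist_term mulrC ler_pdivrMr ?exprn_gt0// mulrC => h.
by apply: le_trans h; rewrite lerDr.
Qed.

(** The weights 2^-|n| of neighbouring sites differ by at most a factor 2. *)
Lemma jdist_shift (J J' : jacobi R) : jdist (jshift J) (jshift J') <= 2 * jdist J J'.
Proof.
rewrite -lee_fin EFinM !jdistE -!/(esumZ _).
rewrite -(esumZ_shift (jdist_term J J') 1) -esumZ_scale//; last by move=> n; exact: jdist_term_ge0.
apply: le_esumZ => n; rewrite /jdist_term /= mulrA ler_wpM2r ?addr_ge0//.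
rewrite ler_pdivlMr ?exprn_gt0// mulrC ler_pdivrMr ?exprn_gt0// -exprS.
by rewrite ler_weXn2l ?ler1n//; lia.
Qed.

Lemma measurable_jshift : measurable_fun setT (@jshift R : JB -> JB).
Proof.
apply: (@measurability _ _ JB JB setT (@jshift R) (@open (jacobi R))) => //.
move=> _ [U oU <-]; rewrite setTI.
apply: open_measurable_jacobi; apply: nbhs_open => J /= UJ.
have : nbhs (jshift J) U by exact: open_nbhs_nbhs.
move=> /nbhs_ballP[e /= e0 h].
apply: (@jdist_nbhs _ _ (e / 2)); first by rewrite divr_gt0.
move=> J' h'; apply: h; rewrite ballEmdist /=.
apply: le_lt_trans (jdist_shift J J') _.
by move: h'; rewrite ltr_pdivlMr// mulrC.
Qed.

Lemma measurable_moment m : measurable_fun setT (fun J : JB => moment (J : jacobi R) m).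
Proof.
suff H n : measurable_fun setT
    (fun J : JB => iter m (jopr (J : jacobi R)) (fun n => (n == 0)%:R) n) by exact: H.
elim: m n => [|m IH] n /=; first exact: measurable_cst.
rewrite /jopr; apply: measurable_funD; first apply: measurable_funD.
- by apply: measurable_funM; [exact: measurable_ja|exact: IH].
- by apply: measurable_funM; [exact: measurable_ja|exact: IH].
- by apply: measurable_funM; [exact: measurable_jb|exact: IH].
Qed.

Lemma measurable_poly_moment q : measurable_fun setT (fun J : JB => poly_moment q (J : jacobi R)).
Proof.
apply: measurable_sum => i; apply: measurable_funM; first exact: measurable_cst.
exact: measurable_moment.
Qed.

Lemma poly_moment_bound (q : {poly R}) :
  exists C, forall J : jacobi R, `|poly_moment q J| <= C.
Proof.
exists (\sum_(m < size q) `|q`_m| * 6 ^+ m) => J.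
apply: (le_trans (ler_norm_sum _ _ _)); apply: ler_sum => m _.
by rewrite normrM ler_wpM2l// iter_jopr_bound.
Qed.

End jacobi_measurable.

(** * Integration of the finite volume inequality *)

Section ergodic.
Variables (R : realType) (mu : probability (jacobi_borel R) R).
Hypothesis hmu : M0 mu.
Local Notation JB := (jacobi_borel R).
Local Notation S := (@jshift R : JB -> JB).

Lemma Rintegral_cst_prob (x : R) : (\int[mu]_(J in [set: JB]) x)%R = x.
Proof.
rewrite Rintegral_cst//; transitivity (x * fine 1%:E); last by rewrite /= mulr1.
by congr (_ * fine _); exact: probability_setT.
Qed.

Lemma integrable_shift (f : JB -> R) : mu.-integrable setT (EFin \o f) ->
  mu.-integrable setT (EFin \o (f \o S)).
Proof.
move=> /integrableP[mf intf]; apply/integrableP; split.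
  by apply: (measurableT_comp mf); exact: measurable_jshift.
have mabs : measurable_fun setT (fun J : JB => `|(EFin \o f) J|%E) by exact: measurableT_comp.
have := ge0_integral_pushforward (@measurable_jshift R) mu (D := setT) measurableT mabs (fun _ _ => abse_ge0 _).
rewrite preimage_setT => <-; rewrite (eq_measure_integral mu)//.
  exact: measurable_jshift.
by move=> ? A mA _; have [h _] := hmu; exact: h.
Qed.

Lemma Rintegral_shift (f : JB -> R) : mu.-integrable setT (EFin \o f) ->
  (\int[mu]_J (f \o S) J)%R = (\int[mu]_J f J)%R.
Proof.
move=> intf; have /integrableP[mf _] := intf.
rewrite /Rintegral; congr fine.
have := integral_pushforward (@measurable_jshift R) (mu := mu) mf (integrable_shift intf) measurableT.
rewrite preimage_setT => <-.
have mS := @measurable_jshift R.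
rewrite [LHS](eq_measure_integral mu)//.
by move=> A mA _; have [h _] := hmu; exact: h.
Qed.

(** By invariance each of the N terms has the integral of f; integrability is carried along because
    [RintegralD] asks for it. *)
Lemma birkhoff_integral (f : JB -> R) N : mu.-integrable setT (EFin \o f) ->
  mu.-integrable setT (EFin \o (fun J => \sum_(j < N) f (iter j S J))) /\
  (\int[mu]_J (\sum_(j < N) f (iter j S J)))%R = N%:R * (\int[mu]_J f J)%R.
Proof.
move=> intf.
have I j : mu.-integrable setT (EFin \o (fun J => f (iter j S J))) /\
    (\int[mu]_J f (iter j S J))%R = (\int[mu]_J f J)%R.
  elim: j => [|j [IH1 IH2]]; first by split.
  split.
    rewrite (_ : (fun J => f (iter j.+1 S J)) = (fun J => f (iter j S J)) \o S).
      exact: integrable_shift.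
    by apply/funext => J; rewrite iterSr.
  rewrite -IH2 -(Rintegral_shift IH1).
  by apply: eq_Rintegral => J _; rewrite iterSr.
elim: N => [|N [IH1 IH2]].
  rewrite (_ : (fun J => \sum_(j < 0) _) = cst 0); last by apply/funext => J; rewrite big_ord0.
  by split; [exact: finite_measure_integrable_cst|rewrite Rintegral_cst// !mul0r].
have E : (fun J => \sum_(j < N.+1) f (iter j S J)) =
    (fun J => (\sum_(j < N) f (iter j S J)) + f (iter N S J)).
  by apply/funext => J; rewrite big_ord_recr.
have [h1 h2] := I N.
rewrite E; split.
  by have := integrableD measurableT IH1 h1; apply: eq_integrable.
by rewrite RintegralD// IH2 h2 -natr1 mulrDl mul1r.
Qed.

Lemma measurable_iter_shift j : measurable_fun setT (fun J : JB => iter j S J).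
Proof.
elim: j => [|j IH]; first exact: measurable_id.
by apply: measurableT_comp IH; exact: measurable_jshift.
Qed.

Lemma iter_shift_invariant j B : measurable B -> mu ((fun J => iter j S J) @^-1` B) = mu B.
Proof.
move=> mB; elim: j => //= j IH.
have -> : (fun J => S (iter j S J)) @^-1` B = S @^-1` ((fun J => iter j S J) @^-1` B).
  by apply/seteqP; split => J /=; rewrite -iterSr.
have [h _] := hmu; rewrite h ?IH//.
by rewrite -[X in measurable X]setTI; exact: measurable_iter_shift.
Qed.

Let lna (J : JB) : \bar R := lne (ja (J : jacobi R) 0)%:E.

Lemma lnaE J : lna J = if 0 < ja (J : jacobi R) 0 then (ln (ja (J : jacobi R) 0))%:E else -oo%E.
Proof.
by rewrite /lna; case: ltP => h; [rewrite lne_EFin|rewrite le0_lneNy// lee_fin].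
Qed.

Lemma measurable_lna : measurable_fun setT lna.
Proof.
rewrite (funext lnaE); apply: measurable_fun_ifT.
- by apply: measurable_fun_ltr; [exact: measurable_cst|exact: measurable_ja].
- apply/measurable_EFinP; apply: (measurableT_comp (@measurable_ln R)).
  exact: measurable_ja.
- exact: measurable_cst.
Qed.

Lemma lna_le J : (lna J <= (ln 2)%:E)%E.
Proof.
rewrite lnaE; case: ifP => h; rewrite ?leNye// lee_fin ler_ln ?posrE//.
exact: ja_le2.
Qed.

(** The positive part is bounded since a_0 <= 2; the negative part has finite integral because the
    integral is not -oo. *)
Lemma integrable_lna : mu.-integrable setT lna.
Proof.
have l2 : 0 <= ln (2 : R) by rewrite ln_ge0// ler1n.
have pos : (\int[mu]_J lna^\+ J < +oo)%E.
  apply: (@le_lt_trans _ _ (\int[mu]_J (cst (ln 2)%:E J))%E).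
    apply: ge0_le_integral => //.
    - by apply: measurable_funepos; exact: measurable_lna.
    - by move=> J _; rewrite funeposE ge_max lna_le lee_fin.
  by rewrite integral_cst// lte_mul_pinfty// ?lee_fin// ltey_eq fin_num_measure.
have neg : (\int[mu]_J lna^\- J < +oo)%E.
  have [_] := hmu; rewrite /int_ln_a0 integralE.
  by case: (X in (_ - X)%E) => [r _||]//; rewrite ?ltry//; case: (X in (X - _)%E).
apply/integrableP; split; first exact: measurable_lna.
under eq_integral do rewrite -/((abse \o lna) _) fune_abse.
rewrite ge0_integralD//; last 2 first.
- by apply: measurable_funepos; exact: measurable_lna.
- by apply: measurable_funeneg; exact: measurable_lna.
exact: lte_add_pinfty.
Qed.

(** Here the value at a_0 = 0 is the default 0 instead of -oo. The two agree almost everywhere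
    because [lna] is integrable. *)
Definition lna0 (J : JB) : R := ln (ja (J : jacobi R) 0).

Lemma lna0E J : lna0 J = fine (lna J).
Proof.
by rewrite /lna0 lnaE; case: ltP => h //=; exact: ln0.
Qed.

Lemma integrable_lna0 : mu.-integrable setT (EFin \o lna0).
Proof.
apply: le_integrable integrable_lna => //.
  apply/measurable_EFinP; apply: (measurableT_comp (@measurable_ln R)).
  exact: measurable_ja.
by move=> J _ /=; rewrite lna0E; case: (lna J) => [r||] //=; rewrite ?normr0 ?leey.
Qed.

Lemma ln_Amu : ln (Amu mu) = (\int[mu]_J lna0 J)%R.
Proof.
rewrite /Amu expRK /Rintegral; congr fine; rewrite /int_ln_a0.
apply: ae_eq_integral => //.
- exact: measurable_lna.
- by have /integrableP[] := integrable_lna0.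
have := integrable_ae measurableT integrable_lna.
apply: filterS => J /(_ I) h _; rewrite lna0E.
by rewrite fineK.
Qed.

(** The matrices to which the growth estimate applies. They have full measure: a_0 > 0 almost
    everywhere since ln a_0 is integrable, and invariance carries this to all sites j >= 0. *)
Definition pos_coefs : set JB := \bigcap_j [set J | 0 < ja (iter j S J) 0].

Lemma pos_coefsP J : pos_coefs J -> forall j : nat, 0 < ja (J : jacobi R) j%:Z.
Proof.
by move=> h j; have := h j Logic.I; rewrite /= (iter_jshift J j 0).1 add0r.
Qed.

Lemma pos_coefs_full : measurable pos_coefs /\ mu (~` pos_coefs) = 0%E.
Proof.
pose A : set JB := [set J | 0 < ja (J : jacobi R) 0].
have mA : measurable A.
  rewrite (_ : A = (fun J : JB => ja (J : jacobi R) 0) @^-1` `]0, +oo[%classic).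
    by rewrite -[X in measurable X]setTI; apply: measurable_ja => //; exact: measurable_itv.
  by apply/seteqP; split => J /=; rewrite in_itv/= andbT.
have A0 : mu (~` A) = 0%E.
  have [N [mN N0 sN]] := integrable_ae measurableT integrable_lna.
  apply/eqP; rewrite -measure_le0 -N0; apply: le_measure; rewrite ?inE//.
    exact: measurableC.
  move=> J /= hJ; apply: sN => /= /(_ I); rewrite lnaE.
  by move: hJ => /negP/negbTE ->.
have mAj j : measurable ((fun J : JB => iter j S J) @^-1` A).
  by rewrite -[X in measurable X]setTI; exact: measurable_iter_shift.
have mD : measurable pos_coefs by apply: bigcapT_measurable => j; exact: mAj.
split => //; rewrite setC_bigcap.
apply/negligibleP; first by apply: bigcupT_measurable => j; exact: measurableC (mAj j).
apply: negligible_bigcup => j; apply/negligibleP; first exact: measurableC (mAj j).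
by rewrite -A0 -(iter_shift_invariant j (measurableC mA)).
Qed.

Lemma integrable_poly_moment q :
  mu.-integrable setT (EFin \o (fun J : JB => poly_moment q (J : jacobi R))).
Proof.
apply: measurable_bounded_integrable => //.
- by rewrite ltey_eq fin_num_measure.
- exact: measurable_poly_moment.
- have [C hC] := poly_moment_bound q; exists C; split; first exact: num_real.
  by move=> M hM J _; apply: le_trans (hC J) (ltW hM).
Qed.

(** Integrating [finite_volume_bound] gives N c <= N (\int q - 2 ln A) + b for every N, with b
    fixed, and hence the claim as N grows. *)
Lemma thouless_lower_bound (z : R[i]) (q : {poly R}) :
  0 < complex.Im z ->
  (forall t : R, `|t| <= 2 -> ln (nsq (z - t%:C)) <= q.[t]) ->
  let y := complex.Im z in
  2 * ln (Amu mu) + y / (y + 4 / y) <=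
    (\int[mu]_(J in [set: JB]) poly_moment q (J : jacobi R))%R.
Proof.
move=> z0 hq /=; set y := complex.Im z; set c := y / (y + 4 / y).
have [B hB] := finite_volume_bound z0 hq.
rewrite -/y -/c in hB.
set iQ := Rintegral _ _ _.
pose h (J : JB) := poly_moment q (J : jacobi R) - 2 * lna0 J.
have ih : mu.-integrable setT (EFin \o h).
  have := integrableB measurableT (integrable_poly_moment q)
    (integrableZl measurableT 2 integrable_lna0).
  by apply: eq_integrable.
have Ih : (\int[mu]_J h J)%R = iQ - 2 * ln (Amu mu).
  rewrite /h RintegralB//; last first.
  - by have := integrableZl measurableT 2 integrable_lna0; apply: eq_integrable.
  - exact: integrable_poly_moment.
  by rewrite RintegralZl// ?ln_Amu//; exact: integrable_lna0.
have [mD D0] := pos_coefs_full.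
pose b := B - (ln y - ln (y + 4 / y)).
have key N : N%:R * c <= N%:R * (iQ - 2 * ln (Amu mu)) + b.
  have [i1 i2] := birkhoff_integral N ih.
  rewrite -Ih -i2.
  have ic (x : R) : mu.-integrable setT (EFin \o cst x) by exact: finite_measure_integrable_cst.
  have -> : b = (\int[mu]_(J in [set: JB]) b)%R.
    by rewrite Rintegral_cst_prob.
  have -> : N%:R * c = (\int[mu]_(J in [set: JB]) (N%:R * c))%R.
    by rewrite Rintegral_cst_prob.
  rewrite -RintegralD//; last exact: ic.
  have iD : mu.-integrable setT (EFin \o (fun J => \sum_(j < N) h (iter j S J) + b)).
    by have := integrableD measurableT i1 (ic b); apply: eq_integrable.
  rewrite /Rintegral.
  rewrite (negligible_integral (measurableC mD) measurableT iD D0).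
  rewrite [in leLHS](negligible_integral (measurableC mD) measurableT (ic (N%:R * c)) D0).
  rewrite setTD setCK.
  apply: (@le_Rintegral _ _ _ mu pos_coefs (cst (N%:R * c))) => //.
  - exact: integrableS (ic _).
  - exact: integrableS iD.
  move=> J /pos_coefsP hJ; have := hB J N hJ.
  rewrite /h sumrB -mulr_sumr /b.
  have -> : \sum_(j < N) lna0 (iter j S J) = \sum_(j < N) ln (ja (J : jacobi R) j%:Z).
    by apply: eq_bigr => j _; rewrite /lna0 (iter_jshift J j 0).1 add0r.
  by rewrite /cst; lra.
rewrite -subr_ge0 leNgt; apply/negP => neg.
pose d := 2 * ln (Amu mu) + c - iQ.
have d0 : 0 < d by rewrite /d; lra.
(* An N with N d > |b|, which [key] excludes. *)
have := key (Num.truncn (`|b| / d)).+1.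
have := truncnS_gt (`|b| / d); rewrite ltr_pdivrMr// => h1 h2.
have := ler_norm b; rewrite /d in h1.
set n := _.+1%:R in h1 h2; nra.
Qed.

End ergodic.

Section I22_integral.
Variables (R : realType) (k : probability (measurableTypeR R) R).
Hypothesis k1 : k (@I22 R) = 1%E.

Lemma measurable_I22 : measurable (@I22 R : set (measurableTypeR R)).
Proof. exact: measurable_itv. Qed.

Lemma I22_norm (t : R) : I22 t -> `|t| <= 2.
Proof. by rewrite /I22 /= in_itv/= ler_norml. Qed.

Lemma Rintegral_k_cst (c : R) : (\int[k]_(t in @I22 R) c)%R = c.
Proof.
rewrite Rintegral_cst//; last exact: measurable_I22.
transitivity (c * fine 1%:E); last by rewrite /= mulr1.
by congr (_ * fine _); exact: k1.
Qed.

Lemma integrable_k (f : R -> R) (B : R) :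
  measurable_fun (@I22 R : set (measurableTypeR R)) (f : measurableTypeR R -> R) ->
  (forall t, `|t| <= 2 -> `|f t| <= B) ->
  k.-integrable (@I22 R) (EFin \o f).
Proof.
move=> mf fB; apply: measurable_bounded_integrable => //.
- exact: measurable_I22.
- by rewrite ltey_eq fin_num_measure//; exact: measurable_I22.
- by exists B; split=> [|M BM t /I22_norm /fB h]; [exact: num_real|exact: le_trans h (ltW BM)].
Qed.

End I22_integral.

(** * Strict positivity of the Lyapunov exponent *)

Section lyapunov.
Variables (R : realType) (mu : probability (jacobi_borel R) R)
  (k : probability (measurableTypeR R) R).
Hypotheses (hmu : M0 mu) (hk : density_of_states mu k).

Lemma measurable_horner (q : {poly R}) (D : set R) :
  measurable_fun (D : set (measurableTypeR R)) ((fun t => q.[t]) : measurableTypeR R -> R).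
Proof.
apply: (@measurable_funTS _ _ (measurableTypeR R) R).
rewrite (_ : (fun t => q.[t]) = (fun t => \sum_(i < size q) q`_i * t ^+ i)).
  apply: measurable_sum => i; apply: measurable_funM; first exact: measurable_cst.
  exact: exprn_measurable.
by apply/funext => t; rewrite horner_coef.
Qed.

Lemma horner_bound (q : {poly R}) (t : R) : `|t| <= 2 ->
  `|q.[t]| <= \sum_(i < size q) `|q`_i| * 2 ^+ i.
Proof.
move=> t2; rewrite horner_coef; apply: (le_trans (ler_norm_sum _ _ _)).
by apply: ler_sum => i _; rewrite normrM normrX ler_wpM2l// lerXn2r ?nnegrE.
Qed.

(** Tested on a polynomial, the definition of k involves the spectral measures only through their
    moments, which are explicit functions of the coefficients for any choice of [rho]. *)
Lemma integral_k_poly (q : {poly R}) :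
  (\int[k]_(t in @I22 R) q.[t])%R =
  (\int[mu]_(J in [set: jacobi_borel R]) poly_moment q (J : jacobi R))%R.
Proof.
have [k1 [rho [hrho hf]]] := hk; rewrite /Rintegral; congr fine.
rewrite hf; last first.
  apply: continuous_subspaceT => t.
  exact: continuous_horner.
apply: eq_integral => J _.
have mom n := spectral_measure0_moment n (hrho J).
(* The moment of order 0 is finite, so bounded functions are integrable on [-2, 2]. *)
have r1 : (rho J (@I22 R) < +oo)%E.
  have := mom 0%N; rewrite (eq_integral (cst 1%E)); last by move=> t _; rewrite expr0.
  by rewrite integral_cst ?mul1e; [move=> ->; exact: ltry|exact: measurable_I22].
have ip n : (rho J).-integrable (@I22 R) (fun t => (q`_n * t ^+ n)%:E).
  apply: (@measurable_bounded_integrable _ _ _ _ (fun t : measurableTypeR R => q`_n * t ^+ n)) => //.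
  - exact: measurable_I22.
  - by apply: measurable_funM; [exact: measurable_cst|exact: exprn_measurable].
  - exists (`|q`_n| * 2 ^+ n); split; first exact: num_real.
    move=> M hM t /I22_norm t2 /=; apply: le_trans (ltW hM).
    by rewrite normrM normrX ler_wpM2l// lerXn2r ?nnegrE.
rewrite (eq_integral (fun t : measurableTypeR R => (\sum_(n < size q) (q`_n * (t : R) ^+ n)%:E)%E)); last first.
  by move=> t _; rewrite horner_coef sumEFin.
rewrite integral_sum//; last exact: measurable_I22.
rewrite /poly_moment -sumEFin; apply: eq_bigr => n _.
under eq_integral do rewrite EFinM.
rewrite integralZl ?mom ?momentE//; first exact: measurable_I22.
apply: (@measurable_bounded_integrable _ _ _ _ (fun t : measurableTypeR R => t ^+ n)) => //.
- exact: measurable_I22.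
- exists (2 ^+ n); split; first exact: num_real.
  move=> M hM t /I22_norm t2 /=; apply: le_trans (ltW hM).
  by rewrite normrX lerXn2r ?nnegrE.
Qed.

Lemma measurable_ln_nsq (z : R[i]) (D : set R) :
  measurable_fun (D : set (measurableTypeR R))
    ((fun t => ln (nsq (z - t%:C))) : measurableTypeR R -> R).
Proof.
apply: (@measurable_funTS _ _ (measurableTypeR R) R).
apply: (measurableT_comp (@measurable_ln R)).
rewrite (_ : (fun t => _) = (fun t => (complex.Re z - t) ^+ 2 + complex.Im z ^+ 2)); last first.
  by apply/funext => t; rewrite /nsq !ReImE /= oppr0 addr0.
apply: measurable_funD; last exact: measurable_cst.
by apply: measurable_funX; apply: measurable_funB; [exact: measurable_cst|exact: measurable_id].
Qed.

(** The error e is half the gain c = y / (y + 4 / y): from 2 ln A + 2 e <= \int q <= \int ln |z -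
    t|^2 + e one still has e > 0 to spare. *)
Lemma lyapunov_gt0 (z : R[i]) : 0 < complex.Im z ->
  2 * ln (Amu mu) < (\int[k]_(t in @I22 R) ln (nsq (z - t%:C)))%R.
Proof.
move=> z0; pose y := complex.Im z.
have e0 : 0 < y / (y + 4 / y) / 2.
  by rewrite divr_gt0// divr_gt0// addr_gt0// divr_gt0.
have [q hq] := log_poly_approx z0 e0.
have h1 := thouless_lower_bound hmu z0 (fun t h => proj1 (andP (hq t h))).
rewrite -integral_k_poly /= -/y in h1.
set e := y / (y + 4 / y) / 2 in e0 hq.
have iq : k.-integrable (@I22 R) (EFin \o (fun t => q.[t])).
  by apply: (integrable_k k _ (horner_bound q)); exact: measurable_horner.
have il : k.-integrable (@I22 R) (EFin \o (fun t => ln (nsq (z - t%:C)))).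
  apply: (integrable_k k (B := \sum_(i < size q) `|q`_i| * 2 ^+ i + e)); first exact: measurable_ln_nsq.
  move=> t t2; have /andP[h2 h3] := hq t t2; have := horner_bound q t2.
  by rewrite !ler_norml => /andP[h4 h5]; apply/andP; split; lra.
have ic : k.-integrable (@I22 R) (EFin \o (fun=> e)).
  apply: (integrable_k k (B := `|e|)) => //; exact: measurable_cst.
have h2 : (\int[k]_(t in @I22 R) q.[t])%R <= (\int[k]_(t in @I22 R) (ln (nsq (z - t%:C)) + e))%R.
  apply: le_Rintegral => //.
  - exact: measurable_I22.
  - by have := integrableD (@measurable_I22 R) il ic; apply: eq_integrable => //; exact: measurable_I22.
  - by move=> t /I22_norm /hq /andP[].
rewrite RintegralD// ?(Rintegral_k_cst (proj1 hk)) in h2; last exact: measurable_I22.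
have E : y / (y + 4 / y) = 2 * e by rewrite /e [RHS]mulrC divfK.
rewrite E in h1; lra.
Qed.

End lyapunov.

(** * Complex exponential and logarithm *)

Section complex_exp_log.
Variable R : realType.
Local Notation C := R[i].
Implicit Types (z c : C) (x : R).

Local Notation nrm := (@Normc.normc R).

Lemma nrmE z : nrm z = Num.sqrt (nsq z).
Proof. by case: z. Qed.

Lemma nrm_ge0 z : 0 <= nrm z.
Proof. by rewrite nrmE sqrtr_ge0. Qed.

Lemma nrm_sqr z : nrm z ^+ 2 = nsq z.
Proof. exact: normc_sqr. Qed.

Lemma nrm_gt0 z : (0 < nrm z) = (z != 0).
Proof. by rewrite nrmE sqrtr_gt0 lt_neqAle eq_sym nsq_eq0 nsq_ge0 andbT. Qed.

Lemma nrmM z z' : nrm (z * z') = nrm z * nrm z'.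
Proof. exact: Normc.normcM. Qed.

Lemma nrmD z z' : nrm (z + z') <= nrm z + nrm z'.
Proof. exact: le_normcD. Qed.

Lemma nrmN z : nrm (- z) = nrm z.
Proof. exact: normcN. Qed.

Lemma nrmB z z' : nrm (z - z') <= nrm z + nrm z'.
Proof. by rewrite -(nrmN z') nrmD. Qed.

Lemma nrmV z : nrm z^-1 = (nrm z)^-1.
Proof. exact: Normc.normcV. Qed.

Lemma nrm_real x : nrm x%:C = `|x|.
Proof. by rewrite nrmE /nsq /= expr0n /= addr0 sqrtr_sqr. Qed.

Lemma nrm1 : nrm 1 = 1.
Proof. exact: Normc.normc1. Qed.

Lemma nrm0 : nrm 0 = 0.
Proof. exact: Normc.normc0. Qed.

Lemma Re_le_nrm z : `|complex.Re z| <= nrm z.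
Proof. by rewrite nrmE -sqrtr_sqr ler_wsqrtr// lerDl sqr_ge0. Qed.

Lemma Im_le_nrm z : `|complex.Im z| <= nrm z.
Proof. by rewrite nrmE -sqrtr_sqr ler_wsqrtr// lerDr sqr_ge0. Qed.

Lemma nrm_le z : nrm z <= `|complex.Re z| + `|complex.Im z|.
Proof.
rewrite -(ler_pXn2r (n := 2)) ?nnegrE ?nrm_ge0 ?addr_ge0//.
rewrite nrm_sqr /nsq sqrrD !real_normK ?num_real//.
by rewrite -addrA lerD2l lerDr mulrn_wge0 ?mulr_ge0.
Qed.

Lemma complexP (z z' : C) : complex.Re z = complex.Re z' ->
  complex.Im z = complex.Im z' -> z = z'.
Proof. by case: z; case: z' => ? ? ? ? /= -> ->. Qed.

Lemma cexpD z z' : cexp (z + z') = cexp z * cexp z'.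
Proof.
apply: complexP; rewrite /cexp !ReImE /= expRD ?cosD ?sinD; ring.
Qed.

Lemma cexp0 : cexp 0 = 1 :> C.
Proof. by apply: complexP; rewrite /cexp /= ?expR0 ?cos0 ?sin0 ?mulr1 ?mulr0. Qed.

Lemma cexpNK z : cexp z * cexp (- z) = 1.
Proof. by rewrite -cexpD subrr cexp0. Qed.

Lemma cexp_neq0 z : cexp z != 0.
Proof.
apply/eqP => h; have := cexpNK z; rewrite h mul0r => /eqP.
by rewrite eq_sym oner_eq0.
Qed.

Lemma cexpN z : cexp (- z) = (cexp z)^-1.
Proof. by apply: (mulfI (cexp_neq0 z)); rewrite cexpNK divff// cexp_neq0. Qed.

Lemma nsq_cexp z : nsq (cexp z) = expR (complex.Re z) ^+ 2.
Proof.
rewrite /nsq /cexp /= !exprMn -mulrDr cos2Dsin2; ring.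
Qed.

Lemma nrm_cexp z : nrm (cexp z) = expR (complex.Re z).
Proof. by rewrite nrmE nsq_cexp sqrtr_sqr ger0_norm// expR_ge0. Qed.

Lemma cexp_conj z : cexp (z^*)%C = ((cexp z)^*)%C.
Proof. by case: z => a b; rewrite /cexp /= cosN sinN mulrN. Qed.

(** At the half angle e = d / 2 the hypothesis becomes sin e = 0 with |e| < pi. *)
Lemma cos_eq1_small (d : R) : `|d| < pi *+ 2 -> cos d = 1 -> d = 0.
Proof.
move=> dpi cd; pose e := d / 2.
have de : d = e + e by rewrite /e; lra.
have se : sin e = 0.
  move: cd; rewrite de cosD -!expr2 => h; have := cos2Dsin2 e => h'.
  by apply/eqP; rewrite -sqrf_eq0; apply/eqP; lra.
have epi : `|e| < pi.
  by rewrite /e normrM [`|2^-1|]ger0_norm// ltr_pdivrMr// mulr_natr.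
have [e0|e0|e0] := ltgtP e 0; last by rewrite de e0 addr0.
  have : 0 < sin (- e) by apply: sin_gt0_pi; rewrite oppr_gt0 e0 -ltr0_norm.
  by rewrite sinN se oppr0 ltxx.
have : 0 < sin e by apply: sin_gt0_pi; rewrite e0 -(gtr0_norm e0).
by rewrite se ltxx.
Qed.

Lemma cexp_inj_strip z z' : `|complex.Im z - complex.Im z'| < pi *+ 2 ->
  cexp z = cexp z' -> z = z'.
Proof.
move=> h E.
have hR : complex.Re z = complex.Re z'.
  apply: expR_inj; have := congr1 (@nsq R) E; rewrite !nsq_cexp => /eqP.
  by rewrite eqrXn2 ?expR_ge0// => /eqP.
apply: complexP => //; apply/eqP; rewrite -subr_eq0; apply/eqP.
apply: cos_eq1_small => //.
have e0 : expR (complex.Re z') != 0 by rewrite gt_eqF// expR_gt0.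
have [] := (congr1 (@complex.Re R) E, congr1 (@complex.Im R) E).
rewrite /cexp /= hR => /(mulfI e0) hc /(mulfI e0) hs.
by rewrite cosB hc hs -!expr2 cos2Dsin2.
Qed.

(** The principal logarithm on the right half plane, where the argument is the arc tangent of the
    slope. *)
Definition clog c : C := (ln (nsq c) / 2) +i* atan (complex.Im c / complex.Re c).

Lemma clog_conj c : clog (c^*)%C = ((clog c)^*)%C.
Proof. by case: c => a b; rewrite /clog /nsq /= sqrrN mulNr atanN. Qed.

Lemma sin_atan x : sin (atan x) = x * cos (atan x).
Proof.
have : cos (atan x) != 0.
  by rewrite cos_atan invr_eq0 sqrtr_eq0 -ltNge ltr_wpDr ?sqr_ge0.
by move=> h; rewrite -{2}(atanK x) /tan divfK.
Qed.

Lemma nsq_gt0 c : c != 0 -> 0 < nsq c.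
Proof. by move=> h; rewrite lt_neqAle eq_sym nsq_eq0 h nsq_ge0. Qed.

Lemma Re_gt0_neq0 c : 0 < complex.Re c -> c != 0.
Proof. by apply: contraTneq => ->; rewrite ltxx. Qed.

Lemma clogK c : 0 < complex.Re c -> cexp (clog c) = c.
Proof.
move=> c0; have n0 := nsq_gt0 (Re_gt0_neq0 c0).
have e1 : expR (ln (nsq c) / 2) = Num.sqrt (nsq c).
  apply/eqP; rewrite -(eqrXn2 (n := 2)) ?expR_ge0 ?sqrtr_ge0// sqr_sqrtr ?ltW//.
  by rewrite expr2 -expRD -splitr lnK.
have e2 : cos (atan (complex.Im c / complex.Re c)) = complex.Re c / Num.sqrt (nsq c).
  rewrite cos_atan; have -> : 1 + (complex.Im c / complex.Re c) ^+ 2 = nsq c / complex.Re c ^+ 2.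
    by rewrite /nsq expr_div_n; field; rewrite gt_eqF.
  rewrite sqrtrM ?ltW// sqrtrV ?sqr_ge0// sqrtr_sqr gtr0_norm//.
  by rewrite invfM invrK mulrC.
have s0 : Num.sqrt (nsq c) != 0 by rewrite sqrtr_eq0 -ltNge.
apply: complexP; rewrite /cexp /clog /= ?sin_atan e1 e2; field; rewrite ?s0 ?gt_eqF//.
Qed.

Lemma Im_clog c : `|complex.Im (clog c)| < pi / 2.
Proof. by rewrite ltr_norml /= atan_gtNpi2 atan_ltpi2. Qed.

(** Multiplication by i turns the lower half plane into the right half plane, at the cost of adding
    pi / 2 to the argument. *)
Lemma lower_log_clog c : complex.Im c < 0 ->
  lower_log c = clog ('i%C * c) - 0 +i* (pi / 2).
Proof.
move=> c0; have [h1 h2 h3] := lower_logP c0.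
have r0 : 0 < complex.Re ('i%C * c) by rewrite cReM /= mul0r sub0r mul1r oppr_gt0.
apply: cexp_inj_strip.
  have := Im_clog ('i%C * c); have := pi_gt0 R.
  rewrite cImD cImN (_ : complex.Im (0 +i* (pi / 2)) = pi / 2)// -mulr_natl !ltr_norml => hp /andP[h4 h5].
  by apply/andP; split; lra.
rewrite h1 cexpD clogK// cexpN.
have -> : cexp (0 +i* (pi / 2)) = 'i%C :> C.
  by apply: complexP; rewrite /cexp /= expR0 ?cos_pihalf ?sin_pihalf ?mulr0 ?mulr1.
by rewrite mulrAC divff ?mul1r// -nsq_eq0 /nsq /= expr0n expr1n add0r oner_eq0.
Qed.

(** Three arguments below pi / 2 in modulus cannot add up to 2 pi, so the exponentials decide. *)
Lemma clogM c e : 0 < complex.Re c -> 0 < complex.Re e -> 0 < complex.Re (c * e) ->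
  clog (c * e) = clog c + clog e.
Proof.
move=> c0 e0 ce0; apply: cexp_inj_strip; last by rewrite cexpD !clogK.
have := Im_clog c; have := Im_clog e; have := Im_clog (c * e); have := pi_gt0 R.
rewrite cImD -mulr_natl !ltr_norml => hp /andP[h1 h2] /andP[h3 h4] /andP[h5 h6].
by apply/andP; split; lra.
Qed.

Lemma atan_sub_le x : `|atan x - x| <= x ^+ 2.
Proof.
wlog x0 : x / 0 <= x => [H|].
  have [|/ltW h] := leP 0 x; first exact: H.
  have := H (- x); rewrite oppr_ge0 => /(_ h).
  by rewrite atanN -opprD normrN sqrrN.
have cf : {within `[0, x], continuous atan}.
  by apply: continuous_subspaceT => y; exact: continuous_atan.
have [c] := MVT_segment (df := fun y => (1 + y ^+ 2)^-1) x0 _ cf.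
rewrite in_itv/= atan0 !subr0 => /andP[c0 cx] ->.
have h : 0 < 1 + c ^+ 2 by rewrite ltr_pwDl// sqr_ge0.
have -> : (1 + c ^+ 2)^-1 * x - x = - (c ^+ 2 * x / (1 + c ^+ 2)).
  by field; rewrite gt_eqF.
rewrite normrN ger0_norm ?divr_ge0 ?mulr_ge0 ?sqr_ge0 ?(ltW h)//.
rewrite ler_pdivrMr//.
have h1 : c ^+ 2 * x <= x ^+ 2 * c.
  by have := mulr_ge0 (mulr_ge0 c0 x0) (_ : 0 <= x - c); rewrite subr_ge0 => /(_ cx); lra.
apply: (le_trans h1); rewrite ler_wpM2l ?sqr_ge0//.
by have := sqr_ge0 (c - 1); have := sqr_ge0 c; lra.
Qed.

(** Apply ln y <= y - 1 at 1 + x and at its inverse. The range is the one needed for 1 + x = |1 +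
    e|^2 with |e| <= 1/2, which is at least 1/4. *)
Lemma ln1D_sub_le x : - (3 / 4) <= x -> `|ln (1 + x) - x| <= 4 * x ^+ 2.
Proof.
move=> x0; have p : 0 < 1 + x by lra.
have h1 := ln_le_subr1 p.
have h2 := @ln_le_subr1 R (1 + x)^-1.
rewrite invr_gt0 in h2; move: (h2 p); rewrite lnV ?posrE// => h3.
have E : x - (1 - (1 + x)^-1) = x ^+ 2 / (1 + x) by field; rewrite gt_eqF.
have h4 : x ^+ 2 / (1 + x) <= 4 * x ^+ 2.
  by rewrite ler_pdivrMr//; have := sqr_ge0 x; nra.
have := sqr_ge0 x => h5.
by rewrite ler_norml; apply/andP; split; lra.
Qed.

(** The constant is 14 for the real part plus 6 for the imaginary part. *)
Lemma clog1_est e : nrm e <= 2^-1 -> nrm (clog (1 + e) - e) <= 20 * nsq e.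
Proof.
move=> e2; set a := complex.Re e; set b := complex.Im e.
have n4 : nsq e <= 4^-1.
  rewrite -nrm_sqr (_ : 4^-1 = 2^-1 ^+ 2 :> R); last by field.
  by rewrite lerXn2r ?nnegrE ?nrm_ge0.
have nE : nsq e = a ^+ 2 + b ^+ 2 by [].
have a2 : `|a| <= 2^-1 := le_trans (Re_le_nrm e) e2.
have b2 : `|b| <= 2^-1 := le_trans (Im_le_nrm e) e2.
have a2' := sqr_ge0 a; have b2' := sqr_ge0 b.
move: (a2); rewrite ler_norml => /andP[a3 a4].
apply: (le_trans (nrm_le _)); rewrite !cReD !cImD !cReN !cImN -/a -/b /=.
have s1 : nsq (1 + e) = 1 + (2 * a + nsq e).
  by rewrite /nsq !ReImE /= -/a -/b; ring.
have hRe : `|ln (nsq (1 + e)) / 2 - a| <= 14 * nsq e.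
  rewrite s1; set s := 2 * a + nsq e.
  have hs : `|ln (1 + s) - s| <= 4 * s ^+ 2.
    by apply: ln1D_sub_le; rewrite /s nE; have := sqr_ge0 (a + 2^-1); nra.
  have hs2 : s ^+ 2 <= 13 / 2 * nsq e.
    rewrite /s -/a; have h : a ^+ 2 <= nsq e by rewrite nE lerDl.
    have h' : nsq e ^+ 2 <= 4^-1 * nsq e by rewrite expr2 ler_wpM2r// nsq_ge0.
    have h2 : a * nsq e <= 2^-1 * nsq e by rewrite ler_wpM2r// nsq_ge0.
    have -> : (2 * a + nsq e) ^+ 2 = 4 * a ^+ 2 + 4 * (a * nsq e) + nsq e ^+ 2 by ring.
    have := nsq_ge0 e; lra.
  move: hs; rewrite !ler_norml => /andP[h1 h2]; have h3 := nsq_ge0 e.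
  have sE : s = 2 * a + nsq e by [].
  by apply/andP; split; lra.
have hIm : `|atan ((0 + b) / (1 + a)) - b| <= 6 * nsq e.
  rewrite add0r; have p : 0 < 1 + a by lra.
  have h1 := atan_sub_le (b / (1 + a)).
  have p2 : (1 + a)^-1 <= 2 by rewrite invf_ple ?posrE//; lra.
  have h2 : (b / (1 + a)) ^+ 2 <= 4 * b ^+ 2.
    rewrite expr_div_n mulrC ler_wpM2r// -exprVn (_ : 4 = 2 ^+ 2); last by ring.
    by rewrite lerXn2r ?nnegrE ?invr_ge0// ltW.
  have h3 : `|b / (1 + a) - b| <= 2 * nsq e.
    have -> : b / (1 + a) - b = - (a * b) * (1 + a)^-1 by field; rewrite gt_eqF.
    rewrite normrM normrN [X in _ * X]gtr0_norm ?invr_gt0// mulrC.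
    rewrite ler_pM ?invr_ge0 ?(ltW p)// nE ler_norml.
    have := sqr_ge0 (a + b); have := sqr_ge0 (a - b).
    by move=> h4 h5; apply/andP; split; nra.
  have -> : atan (b / (1 + a)) - b = (atan (b / (1 + a)) - b / (1 + a)) + (b / (1 + a) - b) by ring.
  apply: (le_trans (ler_normD _ _)); rewrite nE in h3 *; lra.
rewrite [complex.Im (1 + e)]cImD [complex.Re (1 + e)]cReD -/a -/b /=.
have := lerD hRe hIm; lra.
Qed.

(** Reduction to c = 1 through c + d = c (1 + d / c): the bound on d gives |d / c| <= 1/2 and keeps
    c + d in the right half plane. *)
Lemma clog_est c d r : 0 < r -> r <= complex.Re c -> nrm d <= r / 2 ->
  nrm (clog (c + d) - clog c - d / c) <= 20 / r ^+ 2 * nsq d.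
Proof.
move=> r0 rc dr; have c0 : 0 < complex.Re c := lt_le_trans r0 rc.
have cn := Re_gt0_neq0 c0.
have rn : r <= nrm c by apply: le_trans (Re_le_nrm c); apply: le_trans (ler_norm _).
have n0 : 0 < nrm c := lt_le_trans r0 rn.
have e2 : nrm (d / c) <= 2^-1.
  rewrite nrmM nrmV ler_pdivrMr//; apply: (le_trans dr); lra.
have E : c + d = c * (1 + d / c) by rewrite mulrDr mulr1 mulrC divfK.
have p1 : 0 < complex.Re (1 + d / c).
  have := le_trans (Re_le_nrm _) e2; rewrite cReD /= ler_norml => /andP[h1 h2]; lra.
have p2 : 0 < complex.Re (c * (1 + d / c)).
  have := le_trans (Re_le_nrm _) dr; rewrite -E cReD ler_norml => /andP[h1 h2]; lra.
rewrite E clogM// [clog c + _]addrC addrK.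
apply: (le_trans (clog1_est e2)).
rewrite nsqM nsqV -mulrA ler_wpM2l// mulrC ler_wpM2r ?nsq_ge0//.
by rewrite lef_pV2 ?posrE ?exprn_gt0 ?nsq_gt0// -nrm_sqr lerXn2r ?nnegrE ?nrm_ge0// ltW.
Qed.

Lemma sin_le_abs x : `|sin x| <= `|x|.
Proof.
wlog x0 : x / 0 <= x => [H|].
  have [|/ltW h] := leP 0 x; first exact: H.
  by have := H (- x); rewrite oppr_ge0 sinN !normrN => /(_ h).
have cf : {within `[0, x], continuous sin}.
  by apply: continuous_subspaceT => y; exact: continuous_sin.
have [c] := MVT_segment (df := cos) x0 _ cf.
move=> _; rewrite sin0 !subr0 => ->; rewrite normrM ler_piMl//.
exact: cos_max.
Qed.

Lemma cos_sub1_le x : `|cos x - 1| <= x ^+ 2.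
Proof.
have -> : cos x - 1 = - (2 * sin (x / 2) ^+ 2).
  rewrite {1}(splitr x) cosD -!expr2; have := cos2Dsin2 (x / 2); lra.
rewrite normrN ger0_norm; last by rewrite mulr_ge0// sqr_ge0.
have h := sin_le_abs (x / 2).
have : sin (x / 2) ^+ 2 <= (x / 2) ^+ 2.
  have : `|sin (x / 2)| ^+ 2 <= `|x / 2| ^+ 2 by rewrite lerXn2r ?nnegrE.
  by rewrite !real_normK ?num_real.
rewrite expr_div_n; have := sqr_ge0 x; lra.
Qed.

Lemma sin_sub_le x : `|x| <= 1 -> `|sin x - x| <= x ^+ 2.
Proof.
wlog x0 : x / 0 <= x => [H x1|].
  have [h|/ltW h] := leP 0 x; first exact: H.
  have := H (- x); rewrite oppr_ge0 normrN => /(_ h x1).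
  by rewrite sinN -opprD normrN sqrrN.
rewrite ger0_norm// => x1.
have cf : {within `[0, x], continuous sin}.
  by apply: continuous_subspaceT => y; exact: continuous_sin.
have [c] := MVT_segment (df := cos) x0 _ cf.
rewrite in_itv/= sin0 !subr0 => /andP[c0 cx] ->.
rewrite -{2}[x]mul1r -mulrBl normrM (ger0_norm x0).
have h := cos_sub1_le c.
have h2 : c ^+ 2 <= x.
  by apply: (le_trans _ cx); rewrite expr2 ler_piMr// (le_trans cx).
by rewrite expr2 ler_wpM2r// (le_trans h).
Qed.

Lemma expR_sub_le x : `|x| <= 2^-1 -> `|expR x - 1 - x| <= 2 * x ^+ 2.
Proof.
rewrite ler_norml => /andP[x1 x2].
have h1 := expR_ge1Dx x; have h2 := expR_ge1Dx (- x); rewrite expRN in h2.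
have p : 0 < 1 - x by lra.
have e0 := expR_gt0 x.
have h3 : expR x <= (1 - x)^-1.
  by rewrite -[expR x]invrK lef_pV2 ?posrE ?invr_gt0//.
have E : (1 - x)^-1 - 1 - x = x ^+ 2 / (1 - x) by field; rewrite gt_eqF.
have h4 : x ^+ 2 / (1 - x) <= 2 * x ^+ 2.
  by rewrite ler_pdivrMr//; have := sqr_ge0 x; nra.
have := sqr_ge0 x => h5; rewrite ler_norml; apply/andP; split; lra.
Qed.

Lemma cexp_est e : nrm e <= 2^-1 -> nrm (cexp e - 1 - e) <= 10 * nsq e.
Proof.
move=> e2; set a := complex.Re e; set b := complex.Im e.
have nE : nsq e = a ^+ 2 + b ^+ 2 by [].
have a2 : `|a| <= 2^-1 := le_trans (Re_le_nrm e) e2.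
have b2 : `|b| <= 2^-1 := le_trans (Im_le_nrm e) e2.
have a2' := sqr_ge0 a; have b2' := sqr_ge0 b.
have b1 : `|b| <= 1 by lra.
have h1 := expR_sub_le a2; have h2 := cos_sub1_le b; have h3 := sin_sub_le b1.
have e3 : expR a <= 2.
  move: h1 a2; rewrite !ler_norml => /andP[_ h] /andP[h' h''].
  have : a ^+ 2 <= 4^-1 by rewrite (_ : 4^-1 = 2^-1 * 2^-1); [nra|field].
  lra.
have e0 := expR_gt0 a.
apply: (le_trans (nrm_le _)); rewrite /cexp !cReD !cImD !cReN !cImN -/a -/b /= oppr0 addr0 -/a -/b.
have hRe : `|expR a * cos b - 1 - a| <= 2 * a ^+ 2 + 2 * b ^+ 2.
  have -> : expR a * cos b - 1 - a = (expR a - 1 - a) + expR a * (cos b - 1) by ring.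
  apply: (le_trans (ler_normD _ _)); rewrite lerD// normrM ger0_norm ?(ltW e0)//.
  by rewrite ler_pM// ltW.
have hIm : `|expR a * sin b - b| <= 2 * b ^+ 2 + 2 * (a ^+ 2 + b ^+ 2).
  have -> : expR a * sin b - b = expR a * (sin b - b) + (expR a - 1) * b by ring.
  apply: (le_trans (ler_normD _ _)); rewrite lerD//.
    by rewrite normrM ger0_norm ?(ltW e0)// ler_pM// ltW.
  have h4 : `|expR a - 1| <= 2 * `|a|.
    have -> : expR a - 1 = (expR a - 1 - a) + a by ring.
    apply: (le_trans (ler_normD _ _)).
    have : 2 * a ^+ 2 <= `|a|.
      by rewrite -(real_normK (num_real a)) expr2; have := normr_ge0 a; nra.
    lra.
  rewrite normrM; apply: (@le_trans _ _ (2 * `|a| * `|b|)); first by rewrite ler_wpM2r.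
  rewrite -(real_normK (num_real a)) -(real_normK (num_real b)).
  by have := sqr_ge0 (`|a| - `|b|); have := sqr_ge0 `|a|; have := sqr_ge0 `|b|; nra.
rewrite nE; have := lerD hRe hIm; lra.
Qed.

End complex_exp_log.

(** * Complex integrals and the extension of F *)

Section complex_integral.
Variables (R : realType) (k : probability (measurableTypeR R) R).
Hypothesis k1 : k (@I22 R) = 1%E.
Local Notation C := R[i].
Local Notation nrm := (@Normc.normc R).
Local Notation mR := (measurableTypeR R).
Implicit Types f g : R -> C.

Definition cmeasurable f : Prop :=
  measurable_fun setT ((fun t => complex.Re (f t)) : mR -> R) /\
  measurable_fun setT ((fun t => complex.Im (f t)) : mR -> R).

Definition cbounded f : Prop :=
  exists B : R, forall t, `|t| <= 2 -> nrm (f t) <= B.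

(** A class closed under the operations below and integrable for k on [-2, 2]; the bound is asked
    only there. *)
Definition cgood f : Prop := cmeasurable f /\ cbounded f.

Lemma measurable_inv : measurable_fun setT (@GRing.inv R).
Proof.
(* Squaring makes the base of the power nonnegative; at x = 0 both sides are 0. *)
rewrite (_ : GRing.inv = (fun x : R => x * (x ^+ 2) `^ (- 1))).
  apply: measurable_funM; first exact: measurable_id.
  apply: (measurableT_comp (@measurable_powR R (- 1))).
  exact: exprn_measurable.
apply/funext => x; rewrite powR_inv1 ?sqr_ge0//.
have [->|x0] := eqVneq x 0; first by rewrite invr0 mul0r.
by field.
Qed.

Lemma cmeasurable_cst c : cmeasurable (fun=> c).
Proof. by split; exact: measurable_cst. Qed.

Lemma cmeasurableD f g : cmeasurable f -> cmeasurable g ->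
  cmeasurable (fun t => f t + g t).
Proof.
move=> [f1 f2] [g1 g2]; split.
  by under eq_fun do rewrite cReD; exact: measurable_funD.
by under eq_fun do rewrite cImD; exact: measurable_funD.
Qed.

Lemma cmeasurableM f g : cmeasurable f -> cmeasurable g ->
  cmeasurable (fun t => f t * g t).
Proof.
move=> [f1 f2] [g1 g2]; split.
  by under eq_fun do rewrite cReM; apply: measurable_funB; exact: measurable_funM.
by under eq_fun do rewrite cImM; apply: measurable_funD; exact: measurable_funM.
Qed.

Lemma cmeasurableN f : cmeasurable f -> cmeasurable (fun t => - f t).
Proof.
move=> hf; rewrite (_ : (fun t => - f t) = (fun t => (- 1) * f t)).
  by apply: cmeasurableM => //; exact: cmeasurable_cst.
by apply/funext => t; rewrite mulN1r.
Qed.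

Lemma cmeasurable_conj f : cmeasurable f -> cmeasurable (fun t => (f t)^*%C).
Proof.
move=> [f1 f2]; split.
  by rewrite (_ : (fun t => _) = (fun t => complex.Re (f t))) //; apply/funext => t; case: (f t).
rewrite (_ : (fun t => _) = (fun t => - complex.Im (f t))).
  by apply: measurableT_comp => //; exact: measurable_oppr.
by apply/funext => t; case: (f t).
Qed.

Lemma measurable_nsq f : cmeasurable f ->
  measurable_fun setT ((fun t => nsq (f t)) : mR -> R).
Proof.
by move=> [f1 f2]; apply: measurable_funD; apply: measurable_funX.
Qed.

Lemma cmeasurable_real (u : R -> R) : measurable_fun setT (u : mR -> R) ->
  cmeasurable (fun t => (u t)%:C).
Proof. by move=> hu; split => //; exact: measurable_cst. Qed.

Lemma cinvE (z : C) : z^-1 = (nsq z)^-1%:C * z^*%C.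
Proof.
have [->|z0] := eqVneq z 0; first by rewrite invr0 rmorph0 mulr0.
apply: (mulfI z0); rewrite divff// mulrCA.
have -> : z * z^*%C = (nsq z)%:C by apply: complexP; rewrite !ReImE /nsq /=; case: {z0}z => a b /=; ring.
by rewrite -rmorphM /= mulVf// ?nsq_eq0.
Qed.

Lemma cmeasurableV f : cmeasurable f -> cmeasurable (fun t => (f t)^-1).
Proof.
move=> hf; under eq_fun do rewrite cinvE.
apply: cmeasurableM; last exact: cmeasurable_conj.
apply: cmeasurable_real; apply: (measurableT_comp measurable_inv).
exact: measurable_nsq.
Qed.

Lemma cmeasurable_clog f : cmeasurable f -> cmeasurable (fun t => clog (f t)).
Proof.
move=> hf; split.
  apply: measurable_funM; last exact: measurable_cst.
  by apply: (measurableT_comp (@measurable_ln R)); exact: measurable_nsq.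
apply: measurableT_comp.
  by apply: continuous_measurable_fun; exact: continuous_atan.
case: hf => h1 h2; apply: measurable_funM => //.
exact: (measurableT_comp measurable_inv).
Qed.

Lemma cbounded_cst c : cbounded (fun=> c).
Proof. by exists (nrm c). Qed.

Lemma cboundedD f g : cbounded f -> cbounded g -> cbounded (fun t => f t + g t).
Proof.
move=> [B hB] [B' hB']; exists (B + B') => t ht.
by apply: (le_trans (nrmD _ _)); rewrite lerD ?hB ?hB'.
Qed.

Lemma cboundedM f g : cbounded f -> cbounded g -> cbounded (fun t => f t * g t).
Proof.
move=> [B hB] [B' hB']; exists (B * B') => t ht.
by rewrite nrmM ler_pM ?nrm_ge0 ?hB ?hB'.
Qed.

Lemma cboundedN f : cbounded f -> cbounded (fun t => - f t).
Proof. by move=> [B hB]; exists B => t ht; rewrite nrmN hB. Qed.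

Lemma cboundedV f r : 0 < r -> (forall t, `|t| <= 2 -> r <= nrm (f t)) ->
  cbounded (fun t => (f t)^-1).
Proof.
move=> r0 h; exists r^-1 => t ht; rewrite nrmV lef_pV2 ?posrE ?h//.
exact: lt_le_trans r0 (h t ht).
Qed.

Lemma cbounded_clog f r : 0 < r -> (forall t, `|t| <= 2 -> r <= complex.Re (f t)) ->
  cbounded f -> cbounded (fun t => clog (f t)).
Proof.
move=> r0 h [B hB]; exists (B ^+ 2 + (r ^+ 2)^-1 + pi) => t ht.
have h1 := h t ht; have h2 := hB t ht.
have rn : r <= nrm (f t).
  by apply: (le_trans h1); apply: le_trans (Re_le_nrm _); exact: ler_norm.
have n1 : r ^+ 2 <= nsq (f t) by rewrite -nrm_sqr lerXn2r ?nnegrE ?nrm_ge0// ltW.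
have n2 : nsq (f t) <= B ^+ 2.
  by rewrite -nrm_sqr lerXn2r ?nnegrE ?nrm_ge0// (le_trans (nrm_ge0 (f t))).
have r2 : 0 < r ^+ 2 by rewrite exprn_gt0.
have n0 : 0 < nsq (f t) := lt_le_trans r2 n1.
apply: (le_trans (nrm_le _)); apply: lerD; last first.
  by have := Im_clog (f t); have := pi_gt0 R; lra.
have l1 := ln_le_subr1 n0; have l2 := @ln_le_subr1 R (nsq (f t))^-1.
rewrite invr_gt0 lnV ?posrE// in l2; have {}l2 := l2 n0.
have l3 : (nsq (f t))^-1 <= (r ^+ 2)^-1 by rewrite lef_pV2 ?posrE.
have l4 : 0 < (nsq (f t))^-1 by rewrite invr_gt0.
by rewrite /clog /= ler_norml; apply/andP; split; lra.
Qed.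

Lemma cgood_cst c : cgood (fun=> c).
Proof. by split; [exact: cmeasurable_cst|exact: cbounded_cst]. Qed.

Lemma cgoodD f g : cgood f -> cgood g -> cgood (fun t => f t + g t).
Proof. by move=> [? ?] [? ?]; split; [exact: cmeasurableD|exact: cboundedD]. Qed.

Lemma cgoodM f g : cgood f -> cgood g -> cgood (fun t => f t * g t).
Proof. by move=> [? ?] [? ?]; split; [exact: cmeasurableM|exact: cboundedM]. Qed.

Lemma cgoodN f : cgood f -> cgood (fun t => - f t).
Proof. by move=> [? ?]; split; [exact: cmeasurableN|exact: cboundedN]. Qed.

Lemma cgoodV f r : 0 < r -> (forall t, `|t| <= 2 -> r <= nrm (f t)) ->
  cgood f -> cgood (fun t => (f t)^-1).
Proof.
by move=> r0 h [? ?]; split; [exact: cmeasurableV|exact: cboundedV r0 h].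
Qed.

Lemma cgood_clog f r : 0 < r -> (forall t, `|t| <= 2 -> r <= complex.Re (f t)) ->
  cgood f -> cgood (fun t => clog (f t)).
Proof.
by move=> r0 h [? ?]; split; [exact: cmeasurable_clog|exact: cbounded_clog r0 h _].
Qed.

Lemma cgood_id : cgood (fun t => t%:C).
Proof.
split; first by apply: cmeasurable_real; exact: measurable_id.
by exists 2 => t; rewrite nrm_real.
Qed.

Lemma cgood_Re f : cgood f -> k.-integrable (@I22 R) (EFin \o (fun t => complex.Re (f t))).
Proof.
move=> [[h _] [B hB]]; apply: (integrable_k k (B := B)).
  exact: (@measurable_funTS _ _ mR R).
by move=> t ht; apply: le_trans (hB t ht); exact: Re_le_nrm.
Qed.

Lemma cgood_Im f : cgood f -> k.-integrable (@I22 R) (EFin \o (fun t => complex.Im (f t))).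
Proof.
move=> [[_ h] [B hB]]; apply: (integrable_k k (B := B)).
  exact: (@measurable_funTS _ _ mR R).
by move=> t ht; apply: le_trans (hB t ht); exact: Im_le_nrm.
Qed.

Definition cint f : C :=
  (\int[k]_(t in @I22 R) complex.Re (f t))%R
    +i* (\int[k]_(t in @I22 R) complex.Im (f t))%R.

Lemma eq_cint f g : (forall t, `|t| <= 2 -> f t = g t) -> cint f = cint g.
Proof.
move=> h; congr (_ +i* _); apply: eq_Rintegral => t; rewrite inE => /I22_norm ht;
  by rewrite h.
Qed.

Lemma cint_cst c : cint (fun=> c) = c.
Proof.
apply: complexP; exact: Rintegral_k_cst.
Qed.

Lemma cintD f g : cgood f -> cgood g ->
  cint (fun t => f t + g t) = cint f + cint g.
Proof.
move=> hf hg; apply: complexP; rewrite ?cReD ?cImD /=.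
  under eq_Rintegral do rewrite cReD.
  by rewrite RintegralD ?cgood_Re//; exact: measurable_I22.
under eq_Rintegral do rewrite cImD.
by rewrite RintegralD ?cgood_Im//; exact: measurable_I22.
Qed.

Lemma cintZ c f : cgood f -> cint (fun t => c * f t) = c * cint f.
Proof.
move=> hf; have mI := @measurable_I22 R.
have hr x : k.-integrable (@I22 R) (EFin \o (fun t => x * complex.Re (f t))).
  have := cgood_Re (cgoodM (cgood_cst x%:C) hf).
  by congr (_.-integrable _ _); apply/funext => t /=; rewrite cReM /= mul0r subr0.
have hi x : k.-integrable (@I22 R) (EFin \o (fun t => x * complex.Im (f t))).
  have := cgood_Im (cgoodM (cgood_cst x%:C) hf).
  by congr (_.-integrable _ _); apply/funext => t /=; rewrite cImM /= mul0r addr0.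
apply: complexP; rewrite ?cReM ?cImM /=.
  under eq_Rintegral do rewrite cReM.
  by rewrite RintegralB// !RintegralZl// ?cgood_Re ?cgood_Im.
under eq_Rintegral do rewrite cImM.
by rewrite RintegralD// !RintegralZl// ?cgood_Re ?cgood_Im.
Qed.

Lemma cintN f : cgood f -> cint (fun t => - f t) = - cint f.
Proof.
move=> hf; rewrite -mulN1r -cintZ//; apply: eq_cint => t _; by rewrite mulN1r.
Qed.

Lemma cintB f g : cgood f -> cgood g ->
  cint (fun t => f t - g t) = cint f - cint g.
Proof. by move=> hf hg; rewrite cintD ?cintN//; exact: cgoodN. Qed.

Lemma cint_conj f : cgood f -> cint (fun t => (f t)^*%C) = (cint f)^*%C.
Proof.
move=> hf; have mI := @measurable_I22 R.
apply: complexP => /=; first by apply: eq_Rintegral => t _; case: (f t).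
rewrite -mulN1r -RintegralZl ?cgood_Im//; apply: eq_Rintegral => t _.
by case: (f t) => x y /=; rewrite mulN1r.
Qed.

Lemma Re_cint_ge f x : cgood f -> (forall t, `|t| <= 2 -> x <= complex.Re (f t)) ->
  x <= complex.Re (cint f).
Proof.
move=> hf h; rewrite -[X in X <= _](Rintegral_k_cst k1 x); apply: le_Rintegral.
- exact: measurable_I22.
- exact: (cgood_Re (cgood_cst x%:C)).
- exact: cgood_Re.
- by move=> t /I22_norm; exact: h.
Qed.

Lemma Im_cint_ge f x : cgood f -> (forall t, `|t| <= 2 -> x <= complex.Im (f t)) ->
  x <= complex.Im (cint f).
Proof.
move=> hf h; have := Re_cint_ge (x := x) (cgoodM (cgood_cst (- 'i%C)) hf).
rewrite cintZ// cReM /= oppr0 mul0r sub0r mulN1r opprK; apply => t ht.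
by rewrite cReM /= oppr0 mul0r sub0r mulN1r opprK h.
Qed.

(** With v the integral and v' its conjugate, Re (- v' f) >= - |v| B pointwise; integrating gives
    |v|^2 <= |v| B. *)
Lemma nrm_cint f B : cgood f -> (forall t, `|t| <= 2 -> nrm (f t) <= B) ->
  nrm (cint f) <= B.
Proof.
move=> hf h; set v := cint f.
have [v0|v0] := eqVneq v 0.
  by rewrite v0 nrm0; apply: le_trans (h 0 _); rewrite ?nrm_ge0// normr0.
have n0 : 0 < nrm v by rewrite nrm_gt0.
have := Re_cint_ge (x := - (nrm v * B)) (cgoodM (cgood_cst (- v^*%C)) hf).
rewrite cintZ// -/v.
have -> : complex.Re (- v^*%C * v) = - nrm v ^+ 2.
  by rewrite nrm_sqr /nsq mulNr cReN cReM; case: (v) => a b /=; ring.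
have vE : nrm (- v^*%C) = nrm v by rewrite nrmN !nrmE /nsq; case: (v) => a b /=; rewrite sqrrN.
rewrite lerN2 expr2 ler_pM2l//; apply => t ht.
have := Re_le_nrm (- v^*%C * f t); rewrite nrmM vE ler_norml => /andP[+ _].
apply: le_trans; rewrite lerN2 ler_wpM2l ?nrm_ge0//; exact: h.
Qed.

End complex_integral.

(** Used with K = R[i] for complex derivatives and with K = R along real lines. *)
Lemma quadratic_is_derive (K : numFieldType) (f : K^o -> K^o) (z l : K^o) (B r : K) :
  0 < r -> 0 <= B ->
  (forall d : K, `|d| <= r -> `|f (z + d) - f z - d * l| <= B * `|d| ^+ 2) ->
  is_derive z (1 : K^o) f l.
Proof.
move=> r0 B0 h.
have lim : (fun d => d^-1 *: ((f \o shift z) (d *: (1 : K^o)) - f z)) @ (0 : K)^' --> l.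
  apply/cvgrPdist_le => e e0.
  have B1 : 0 < B + 1 by rewrite ltr_wpDl.
  near=> d.
  have d0 : d != 0 by near: d; exact: nbhs_dnbhs_neq.
  have dr : `|d| <= r by near: d; exact: dnbhs0_le.
  have de : `|d| <= e / (B + 1) by near: d; apply: dnbhs0_le; rewrite divr_gt0.
  have := h d dr; rewrite /= /GRing.scale /= mulr1 [d + z]addrC => hd.
  have E (x m : K) : m - d^-1 * x = - (d^-1 * (x - d * m)) by field.
  rewrite [X in `|X| <= _](E _ l) normrN normrM normfV ler_pdivrMl ?normr_gt0//.
  apply: (le_trans hd); rewrite expr2 mulrCA ler_wpM2l//.
  move: de; rewrite ler_pdivlMr// => de; apply: le_trans de.
  by rewrite mulrC ler_wpM2l// lerDl.
have dv : 'D_1 f z = l by exact: cvg_lim.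
by split => //; apply/cvg_ex; exists l.
Unshelve. all: by end_near.
Qed.

(** * Complex derivatives with quadratic remainder *)

Section quadratic_derivative.
Variable R : realType.
Local Notation C := R[i].
Local Notation nrm := (@Normc.normc R).
Implicit Types (f g h : C -> C) (z l : C).

(* A derivative with a quadratic remainder, a condition that passes under the
   integral sign. *)
Definition qderiv f z l : Prop := exists K r : R, [/\ 0 < r, 0 <= K &
  forall d, nrm d <= r -> nrm (f (z + d) - f z - d * l) <= K * nsq d].

Lemma nsqE_nrm z : nsq z = nrm z * nrm z.
Proof. by rewrite -expr2 nrm_sqr. Qed.

Lemma qderiv_lip f z l : qderiv f z l -> exists K r : R, [/\ 0 < r, 0 <= K &
  forall d, nrm d <= r -> nrm (f (z + d) - f z) <= K * nrm d].
Proof.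
move=> [K [r [r0 K0 h]]]; exists (K * r + nrm l), r; split=> // [|d dr].
  by rewrite addr_ge0 ?nrm_ge0// mulr_ge0// ltW.
have -> : f (z + d) - f z = (f (z + d) - f z - d * l) + d * l by rewrite subrK.
apply: (le_trans (nrmD _ _)); rewrite mulrDl lerD//; last by rewrite nrmM mulrC.
apply: (le_trans (h d dr)); rewrite nsqE_nrm -!mulrA !ler_wpM2l//.
by rewrite ler_wpM2r// nrm_ge0.
Qed.

Lemma qderiv_cst c z : qderiv (fun=> c) z 0.
Proof.
exists 0, 1; split => // d _.
by rewrite subrr mulr0 subr0 nrm0 mul0r.
Qed.

Lemma qderiv_id z : qderiv id z 1.
Proof.
exists 0, 1; split => // d _.
have -> : id (z + d) - id z - d * 1 = 0 by rewrite /=; ring.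
by rewrite nrm0 mul0r.
Qed.

Lemma qderivM f g z l m : qderiv f z l -> qderiv g z m ->
  qderiv (fun x => f x * g x) z (l * g z + f z * m).
Proof.
move=> hf hg; have [K [r [r0 K0 h]]] := hf; have [K' [r' [r'0 K'0 h']]] := hg.
have [L [s [s0 L0 hl]]] := qderiv_lip hf; have [L' [s' [s'0 L'0 hl']]] := qderiv_lip hg.
exists (K * nrm (g z) + nrm (f z) * K' + L * L').
exists (Num.min (Num.min r r') (Num.min s s')); split.
- by rewrite !lt_min r0 r'0 s0 s'0.
- by rewrite !addr_ge0// mulr_ge0// nrm_ge0.
move=> d; rewrite !le_min => /andP[/andP[d1 d2] /andP[d3 d4]].
have -> : f (z + d) * g (z + d) - f z * g z - d * (l * g z + f z * m) =
   (f (z + d) - f z - d * l) * g z + f z * (g (z + d) - g z - d * m)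
    + (f (z + d) - f z) * (g (z + d) - g z) by ring.
apply: (le_trans (nrmD _ _)); rewrite [leRHS]mulrDl lerD//.
  apply: (le_trans (nrmD _ _)); rewrite [leRHS]mulrDl lerD// nrmM.
    by rewrite mulrAC ler_wpM2r ?nrm_ge0// h.
  by rewrite -mulrA ler_wpM2l ?nrm_ge0// h'.
by rewrite nrmM nsqE_nrm mulrACA ler_pM ?nrm_ge0// ?hl ?hl'.
Qed.

Lemma qderivN f z l : qderiv f z l -> qderiv (fun x => - f x) z (- l).
Proof.
move=> [K [r [r0 K0 h]]]; exists K, r; split => // d dr.
by rewrite mulrN -!opprD nrmN -/(_ - _) h.
Qed.

Lemma qderiv_cexp h z l : qderiv h z l -> qderiv (fun x => cexp (h x)) z (cexp (h z) * l).
Proof.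
move=> hh; have [K [r [r0 K0 hq]]] := hh.
have [L [s [s0 L0 hl]]] := qderiv_lip hh.
have n0 := nrm_ge0 (cexp (h z)).
have L1 : 0 < L + 1 by rewrite ltr_wpDl.
exists (nrm (cexp (h z)) * (10 * L ^+ 2 + K)), (Num.min (Num.min r s) (2^-1 / (L + 1))); split.
- by rewrite !lt_min r0 s0 divr_gt0.
- by rewrite mulr_ge0// addr_ge0// mulr_ge0// sqr_ge0.
move=> d; rewrite !le_min => /andP[/andP[d1 d2] d3].
set e := h (z + d) - h z.
have he : nrm e <= L * nrm d by exact: hl.
have e2 : nrm e <= 2^-1.
  move: d3; rewrite ler_pdivlMr// => d3.
  by apply: (le_trans he); have := nrm_ge0 d; lra.
have -> : cexp (h (z + d)) - cexp (h z) - d * (cexp (h z) * l) =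
    cexp (h z) * ((cexp e - 1 - e) + (e - d * l)).
  have -> : h (z + d) = h z + e by rewrite /e; ring.
  rewrite cexpD; ring.
rewrite nrmM -mulrA ler_wpM2l//; apply: (le_trans (nrmD _ _)).
rewrite [leRHS]mulrDl lerD// ?hq//; apply: (le_trans (cexp_est e2)).
rewrite -mulrA ler_wpM2l// !nsqE_nrm expr2 mulrACA.
by rewrite ler_pM ?nrm_ge0.
Qed.

Lemma normc_complexE (z : C) : `|z| = (nrm z)%:C.
Proof. by case: z. Qed.

Lemma qderiv_is_derive f z l : qderiv f z l ->
  is_derive (z : C^o) (1 : C^o) (f : C^o -> C^o) (l : C^o).
Proof.
move=> [K [r [r0 K0 h]]].
apply: (@quadratic_is_derive _ _ _ _ K%:C r%:C); rewrite ?ltcR ?lecR//.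
move=> d; rewrite !normc_complexE lecR => /h.
by rewrite -rmorphXn -rmorphM lecR nrm_sqr.
Qed.

(** This brings in the mean value theorem of real analysis, for the monotonicity of F on ]-1, 1[ and
    for the lower bound on the increments of [clog]. *)
Lemma qderiv_line f z u l (x : R) : qderiv f (z + x%:C * u) l ->
  is_derive x 1 (fun s : R => complex.Re (f (z + s%:C * u))) (complex.Re (u * l)).
Proof.
move=> [K [r [r0 K0 h]]]; have u1 : 0 < nrm u + 1 by rewrite ltr_wpDl ?nrm_ge0.
apply: (@quadratic_is_derive _ _ _ _ (K * nsq u) (r / (nrm u + 1))).
- by rewrite divr_gt0.
- by rewrite mulr_ge0 ?nsq_ge0.
move=> d; rewrite ler_pdivlMr// => dr.
have dr' : nrm (d%:C * u) <= r.
  by rewrite nrmM nrm_real; apply: le_trans dr; rewrite ler_wpM2l// lerDl.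
have := le_trans (Re_le_nrm _) (h _ dr').
have -> : z + x%:C * u + d%:C * u = z + (x + d)%:C * u by rewrite rmorphD /=; ring.
rewrite !cReD !cReN -mulrA [complex.Re (d%:C * _)]cReM /= mul0r subr0.
rewrite nsqM -[nsq d%:C]nrm_sqr nrm_real.
by have -> : K * nsq u * `|d| ^+ 2 = K * (`|d| ^+ 2 * nsq u) by ring.
Qed.

Lemma qderiv_continuous f z l : qderiv f z l ->
  {for (z : C^o), continuous (f : C^o -> C^o)}.
Proof.
move=> /qderiv_is_derive h.
by apply: differentiable_continuous; apply/derivable1_diffP; apply: ex_derive.
Qed.

End quadratic_derivative.

(** * The logarithm of the quadratic 1 + t z + z^2 *)

Section inverse_joukowski.
Variable R : realType.
Local Notation C := R[i].
Local Notation nrm := (@Normc.normc R).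
Implicit Types (z d : C) (t : R).

(* The roots of 1 + t z + z^2 are the inverses of [joukowski t] and of its
   conjugate. *)
Definition joukowski t : C := (- t / 2) +i* Num.sqrt (1 - t ^+ 2 / 4).

Lemma nrm_conj z : nrm z^*%C = nrm z.
Proof. by rewrite !nrmE /nsq; case: z => a b /=; rewrite sqrrN. Qed.

Lemma nsq_joukowski t : `|t| <= 2 -> nsq (joukowski t) = 1.
Proof.
move=> t2; rewrite /nsq /= sqr_sqrtr; first by field.
rewrite subr_ge0 ler_pdivrMr// mul1r -(real_normK (num_real t)).
by rewrite (_ : 4 = 2 ^+ 2); [rewrite lerXn2r ?nnegrE|ring].
Qed.

Lemma nrm_joukowski t : `|t| <= 2 -> nrm (joukowski t) = 1.
Proof. by move=> t2; rewrite nrmE nsq_joukowski// sqrtr1. Qed.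

Lemma quadratic_joukowski t z : `|t| <= 2 ->
  (1 - z * joukowski t) * (1 - z * (joukowski t)^*%C) = 1 + t%:C * z + z ^+ 2.
Proof.
move=> /nsq_joukowski t2.
have h1 : joukowski t + (joukowski t)^*%C = - t%:C.
  by apply: complexP; rewrite !ReImE /= ?subrr ?oppr0//; field.
have h2 : joukowski t * (joukowski t)^*%C = 1.
  by apply: complexP; rewrite !ReImE /=; [rewrite -[RHS]t2 /nsq /=; ring|ring].
have -> : (1 - z * joukowski t) * (1 - z * (joukowski t)^*%C) =
  1 - (joukowski t + (joukowski t)^*%C) * z + (joukowski t * (joukowski t)^*%C) * z ^+ 2 by ring.
by rewrite h1 h2 mulNr opprK mul1r.
Qed.

Lemma Re_1sub_ge z e : nrm e = 1 -> 1 - nrm z <= complex.Re (1 - z * e).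
Proof.
move=> e1; have := Re_le_nrm (z * e); rewrite nrmM e1 mulr1 cReD cReN /= ler_norml.
by move=> /andP[_ h]; lra.
Qed.

(** A sum over the two factors instead of [clog] of the product: each factor has real part at least
    1 - |z|, while the product may leave the right half plane. *)
Definition log_quadratic z t : C :=
  clog (1 - z * joukowski t) + clog (1 - z * (joukowski t)^*%C).

Definition dlog_quadratic z t : C :=
  - joukowski t / (1 - z * joukowski t)
  + - (joukowski t)^*%C / (1 - z * (joukowski t)^*%C).

Lemma clog_1sub_est z d e : nrm z < 1 -> nrm e = 1 -> nrm d <= (1 - nrm z) / 2 ->
  nrm (clog (1 - (z + d) * e) - clog (1 - z * e) - d * (- e / (1 - z * e)))
    <= 20 / (1 - nrm z) ^+ 2 * nsq d.
Proof.
move=> z1 e1 dr; have r0 : 0 < 1 - nrm z by rewrite subr_gt0.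
have := clog_est (d := - (d * e)) r0 (Re_1sub_ge z e1).
rewrite nrmN nrmM e1 mulr1 => /(_ dr).
rewrite -[nsq (- _)]nrm_sqr nrmN nrmM e1 mulr1 nrm_sqr.
by congr (nrm _ <= _); rewrite mulrDl opprD addrA mulrA mulrN.
Qed.

Lemma log_quadratic_est z d t : nrm z < 1 -> `|t| <= 2 -> nrm d <= (1 - nrm z) / 2 ->
  nrm (log_quadratic (z + d) t - log_quadratic z t - d * dlog_quadratic z t)
    <= 40 / (1 - nrm z) ^+ 2 * nsq d.
Proof.
move=> z1 /nrm_joukowski t2 dr.
have h1 := clog_1sub_est z1 t2 dr.
have h2 := clog_1sub_est z1 (etrans (nrm_conj _) t2) dr.
have E (x y x' y' u v w : C) : x + y - (x' + y') - w * (u + v) = (x - x' - w * u) + (y - y' - w * v) by ring.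
rewrite /log_quadratic /dlog_quadratic E; apply: (le_trans (nrmD _ _)).
by have := lerD h1 h2; rewrite -mulrDl -mulrDl -natrD.
Qed.

Lemma quadratic_neq0 z t : nrm z < 1 -> `|t| <= 2 -> 1 + t%:C * z + z ^+ 2 != 0.
Proof.
move=> z1 t2; rewrite -(quadratic_joukowski z t2).
have n1 := nrm_joukowski t2; have n2 := etrans (nrm_conj _) n1.
rewrite mulf_neq0// Re_gt0_neq0//.
  by apply: lt_le_trans (Re_1sub_ge z n1); rewrite subr_gt0.
by apply: lt_le_trans (Re_1sub_ge z n2); rewrite subr_gt0.
Qed.

(** This combination is z times the logarithmic derivative of z / (1 + t z + z^2), hence the shape
    of F'. *)
Lemma dlog_quadraticE z t : nrm z < 1 -> `|t| <= 2 ->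
  1 - z * dlog_quadratic z t = (1 - z ^+ 2) / (1 + t%:C * z + z ^+ 2).
Proof.
move=> z1 t2; have := quadratic_neq0 z1 t2; rewrite -(quadratic_joukowski z t2).
rewrite mulf_eq0 negb_or => /andP[h1 h2].
have h3 : joukowski t * (joukowski t)^*%C = 1.
  have /nsq_joukowski := t2.
  by move=> t3; apply: complexP; rewrite !ReImE /=; [rewrite -[RHS]t3 /nsq /=; ring|ring].
rewrite /dlog_quadratic; move: h1 h2 h3; set e := joukowski t; set e' := (_^*)%C.
move=> h1 h2 h3; have -> : 1 - z ^+ 2 = 1 - (e * e') * z ^+ 2 by rewrite h3 mul1r.
by field; rewrite h1 h2.
Qed.

Lemma nrm_quadratic_le z t : nrm z < 1 -> `|t| <= 2 -> nrm (1 + t%:C * z + z ^+ 2) <= 4.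
Proof.
move=> z1 t2; apply: (le_trans (nrmD _ _)); rewrite expr2 nrmM.
have h1 := nrmD 1 (t%:C * z); rewrite nrmM nrm_real nrm1 in h1.
have n0 := nrm_ge0 z.
have h2 : `|t| * nrm z <= 2 * 1 by rewrite ler_pM// ltW.
have h3 : nrm z * nrm z <= 1 * 1 by rewrite ler_pM// ltW.
lra.
Qed.

Lemma nrm_quadratic_ge z t : nrm z < 1 -> `|t| <= 2 ->
  (1 - nrm z) ^+ 2 <= nrm (1 + t%:C * z + z ^+ 2).
Proof.
move=> z1 t2; rewrite -quadratic_joukowski// nrmM expr2.
have n1 := nrm_joukowski t2; have n2 := etrans (nrm_conj _) n1.
have h e : nrm e = 1 -> 1 - nrm z <= nrm (1 - z * e).
  move=> he; apply: (le_trans (Re_1sub_ge z he)).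
  by apply: le_trans (Re_le_nrm _); exact: ler_norm.
by rewrite ler_pM ?subr_ge0 ?h// ltW.
Qed.

End inverse_joukowski.

(** * The extended function, its derivative and its symmetry *)

Section disk_function.
Variables (R : realType) (k : probability (measurableTypeR R) R).
Hypothesis k1 : k (@I22 R) = 1%E.
Local Notation C := R[i].
Local Notation nrm := (@Normc.normc R).
Local Notation mR := (measurableTypeR R).
Implicit Types (z d : C) (t : R).

Lemma conjcD z z' : (z + z')^*%C = z^*%C + z'^*%C.
Proof. by case: z; case: z' => a b c d; apply: complexP; rewrite /= ?opprD. Qed.

Lemma conjcM z z' : (z * z')^*%C = z^*%C * z'^*%C.
Proof. by apply: complexP; rewrite !ReImE; case: z; case: z' => a b c d /=; ring. Qed.

Lemma conjcN z : (- z)^*%C = - z^*%C.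
Proof. by case: z. Qed.

Lemma conjc_real x : (x%:C : C)^*%C = x%:C.
Proof. by apply: complexP; rewrite /= ?oppr0. Qed.

Lemma cgood_joukowski : cgood (@joukowski R).
Proof.
split; last by exists 1 => t /nrm_joukowski ->.
have hm : measurable_fun setT ((fun t => - t / 2) : mR -> R).
  by apply: measurable_funM => //; apply: measurableT_comp => //; exact: measurable_oppr.
split => //; apply: measurableT_comp.
  by apply: continuous_measurable_fun; exact: sqrt_continuous.
by apply: measurable_funB => //; exact: measurable_funM.
Qed.

Lemma cgood_conj (f : R -> C) : cgood f -> cgood (fun t => (f t)^*%C).
Proof.
move=> [h [B hB]]; split; first exact: cmeasurable_conj.
by exists B => t /hB; rewrite nrm_conj.
Qed.

Lemma cgood_1sub z (e : R -> C) : cgood e -> cgood (fun t => 1 - z * e t).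
Proof.
move=> he; apply: cgoodD; first exact: cgood_cst.
by apply: cgoodN; apply: cgoodM => //; exact: cgood_cst.
Qed.

Lemma cgood_clog_1sub z (e : R -> C) : nrm z < 1 -> cgood e ->
  (forall t, `|t| <= 2 -> nrm (e t) = 1) -> cgood (fun t => clog (1 - z * e t)).
Proof.
move=> z1 he e1; have r0 : 0 < 1 - nrm z by rewrite subr_gt0.
apply: (cgood_clog r0); last exact: cgood_1sub.
by move=> t /e1; exact: Re_1sub_ge.
Qed.

Lemma cgood_div_1sub z (e : R -> C) : nrm z < 1 -> cgood e ->
  (forall t, `|t| <= 2 -> nrm (e t) = 1) -> cgood (fun t => - e t / (1 - z * e t)).
Proof.
move=> z1 he e1; have r0 : 0 < 1 - nrm z by rewrite subr_gt0.
apply: cgoodM; first exact: cgoodN.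
apply: (cgoodV r0); last exact: cgood_1sub.
move=> t /e1 /(Re_1sub_ge z) h; apply: (le_trans h).
by apply: le_trans (Re_le_nrm _); exact: ler_norm.
Qed.

Lemma cgood_log_quadratic z : nrm z < 1 -> cgood (log_quadratic z).
Proof.
move=> z1; apply: cgoodD; apply: cgood_clog_1sub => //.
- exact: cgood_joukowski.
- by move=> t /nrm_joukowski.
- exact: cgood_conj cgood_joukowski.
- by move=> t /nrm_joukowski; rewrite nrm_conj.
Qed.

Lemma cgood_dlog_quadratic z : nrm z < 1 -> cgood (dlog_quadratic z).
Proof.
move=> z1; apply: cgoodD; apply: cgood_div_1sub => //.
- exact: cgood_joukowski.
- by move=> t /nrm_joukowski.
- exact: cgood_conj cgood_joukowski.
- by move=> t /nrm_joukowski; rewrite nrm_conj.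
Qed.

Lemma cgood_quadratic z : cgood (fun t => 1 + t%:C * z + z ^+ 2).
Proof.
apply: cgoodD; last exact: cgood_cst.
apply: cgoodD; first exact: cgood_cst.
by apply: cgoodM; [exact: cgood_id|exact: cgood_cst].
Qed.

Lemma cgood_quadraticV z : nrm z < 1 -> cgood (fun t => (1 + t%:C * z + z ^+ 2)^-1).
Proof.
move=> z1; have r0 : 0 < (1 - nrm z) ^+ 2 by rewrite exprn_gt0// subr_gt0.
by apply: (cgoodV r0) (cgood_quadratic z) => t; exact: nrm_quadratic_ge.
Qed.

Definition logint z : C := cint k (log_quadratic z).

(** The remainder in [log_quadratic_est] is uniform in t, so it survives integration. *)
Lemma qderiv_logint z : nrm z < 1 -> qderiv logint z (cint k (dlog_quadratic z)).
Proof.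
move=> z1; have r0 : 0 < 1 - nrm z by rewrite subr_gt0.
exists (40 / (1 - nrm z) ^+ 2), ((1 - nrm z) / 2); split.
- by rewrite divr_gt0.
- by rewrite divr_ge0 ?exprn_ge0// ltW.
move=> d dr.
have zd : nrm (z + d) < 1 by apply: (le_lt_trans (nrmD _ _)); lra.
rewrite /logint -cintZ; last exact: cgood_dlog_quadratic.
have gd := cgoodM (cgood_cst d) (cgood_dlog_quadratic z1).
rewrite -!cintB; try exact: cgood_log_quadratic; last first.
- exact: gd.
- by apply: cgoodD; [exact: cgood_log_quadratic|apply: cgoodN; exact: cgood_log_quadratic].
apply: nrm_cint => //.
- apply: cgoodD; last exact: cgoodN.
  by apply: cgoodD; [exact: cgood_log_quadratic|apply: cgoodN; exact: cgood_log_quadratic].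
- by move=> t t2; exact: log_quadratic_est.
Qed.

Lemma logint0 : logint 0 = 0.
Proof.
rewrite /logint (_ : log_quadratic 0 = fun=> 0) ?cint_cst//.
apply/funext => t; rewrite /log_quadratic !mul0r subr0.
have -> : clog 1 = 0 :> C.
  by apply: complexP; rewrite /clog /nsq /= ?mul0r ?atan0// expr1n expr0n addr0 ln1 mul0r.
by rewrite addr0.
Qed.

Lemma logint_conj z : nrm z < 1 -> logint z^*%C = (logint z)^*%C.
Proof.
move=> z1; rewrite /logint -cint_conj; last exact: cgood_log_quadratic.
apply: eq_cint => t _; rewrite /log_quadratic conjcD -!clog_conj !(conjcD, conjcN, conjcM) !(conjc_real 1).
by rewrite conjcK addrC.
Qed.

Definition quadratic_mean z : C := cint k (fun t => (1 + t%:C * z + z ^+ 2)^-1).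

Lemma logint_derivE z : nrm z < 1 ->
  1 - z * cint k (dlog_quadratic z) = (1 - z ^+ 2) * quadratic_mean z.
Proof.
move=> z1; rewrite /quadratic_mean -[in RHS]cintZ; last exact: cgood_quadraticV.
rewrite -[X in X - _](cint_cst k1 1) -cintZ; last exact: cgood_dlog_quadratic.
rewrite -cintB; [|exact: cgood_cst|].
  by apply: eq_cint => t t2; rewrite dlog_quadraticE.
by apply: cgoodM; [exact: cgood_cst|exact: cgood_dlog_quadratic].
Qed.

Lemma quadratic_mean0 : quadratic_mean 0 = 1.
Proof.
rewrite /quadratic_mean (_ : (fun t => _) = fun=> 1) ?cint_cst//.
by apply/funext => t; rewrite mulr0 expr0n addr0 addr0 invr1.
Qed.

Lemma nrm_lt1_nsq z : (nrm z < 1) = (nsq z < 1).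
Proof. by rewrite -nrm_sqr expr_lt1// nrm_ge0. Qed.

(** Multiplying z by the conjugate of 1 + t z + z^2 gives z + t |z|^2 + |z|^2 times the conjugate of
    z, and the real parameter t drops out of the imaginary part. *)
Lemma Im_quadraticV z t : nsq z < 1 -> `|t| <= 2 ->
  complex.Im (z / (1 + t%:C * z + z ^+ 2)) =
  complex.Im z * (1 - nsq z) / nsq (1 + t%:C * z + z ^+ 2).
Proof.
move=> z1 t2; rewrite cinvE mulrCA cImM /= mul0r addr0 mulrC; congr (_ / _).
rewrite rmorphD rmorphD rmorph1 rmorphM rmorphXn /= /nsq; case: (z) => a b.
by rewrite expr2 !ReImE /=; ring.
Qed.

Lemma nsq_quadratic_bounds z t : nrm z < 1 -> `|t| <= 2 ->
  0 < nsq (1 + t%:C * z + z ^+ 2) <= 16.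
Proof.
move=> z1 t2; rewrite nsq_gt0 ?quadratic_neq0//= nsqE_nrm.
have h := nrm_quadratic_le z1 t2; have h0 := nrm_ge0 (1 + t%:C * z + z ^+ 2).
by apply: le_trans (ler_pM h0 h0 h h) _; rewrite -natrM.
Qed.

(** The factor Im z treats both half disks at once; 16 bounds |1 + t z + z^2|^2 and makes the lower
    bound uniform in t. *)
Lemma Im_quadratic_mean z : nrm z < 1 -> complex.Im z != 0 ->
  0 < complex.Im z * complex.Im (z * quadratic_mean z).
Proof.
move=> z1 z0; set y := complex.Im z.
have p : 0 < 1 - nsq z by rewrite subr_gt0 -nrm_lt1_nsq.
have y2 : 0 < y ^+ 2 by rewrite exprn_even_gt0.
have g : cgood (fun t => z * (1 + t%:C * z + z ^+ 2)^-1).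
  by apply: cgoodM; [exact: cgood_cst|exact: cgood_quadraticV].
have e0 : 0 < y ^+ 2 * (1 - nsq z) / 16 by rewrite divr_gt0// mulr_gt0.
apply: (lt_le_trans e0).
have := Im_cint_ge k1 (x := y ^+ 2 * (1 - nsq z) / 16) (cgoodM (cgood_cst y%:C) g).
rewrite !cintZ//; last exact: cgood_quadraticV.
rewrite -/(quadratic_mean z) [complex.Im (y%:C * _)]cImM /= mul0r addr0; apply => t t2.
rewrite [leRHS]cImM /= mul0r addr0 Im_quadraticV// -?nrm_lt1_nsq// -/y !mulrA -expr2.
have /andP[q0 q1] := nsq_quadratic_bounds z1 t2.
by apply: ler_wpM2l; [rewrite mulr_ge0 ?(ltW p) ?(ltW y2)|rewrite lef_pV2 ?posrE].
Qed.

(** For real z = x the quadratic is (x + t / 2)^2 + 1 - t^2 / 4, nonnegative, nonzero and at most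
    4. *)
Lemma Re_quadratic_mean z : nrm z < 1 -> complex.Im z = 0 -> 0 < complex.Re (quadratic_mean z).
Proof.
move=> z1 y0; apply: (@lt_le_trans _ _ 4^-1); first by rewrite invr_gt0.
apply: (Re_cint_ge k1) (cgood_quadraticV z1) _ => t t2.
have := nrm_quadratic_le z1 t2; have := quadratic_neq0 z1 t2.
have -> : 1 + t%:C * z + z ^+ 2 = (1 + t * complex.Re z + complex.Re z ^+ 2)%:C.
  by apply: complexP; rewrite !(expr2, ReImE) /= y0; ring.
set q := 1 + _ + _; have q0 : 0 <= q.
  have h : t ^+ 2 <= 4.
    by rewrite -(real_normK (num_real t)) (_ : 4 = 2 ^+ 2); [rewrite lerXn2r ?nnegrE|ring].
  by rewrite /q; have := sqr_ge0 (complex.Re z + t / 2); nra.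
rewrite nrm_real ger0_norm// => qn q4.
have q1 : 0 < q by rewrite lt_neqAle q0 andbT eq_sym; apply: contra qn => /eqP ->.
have -> : (q%:C)^-1 = (q^-1)%:C by rewrite fmorphV.
by rewrite /= lef_pV2 ?posrE.
Qed.

Lemma quadratic_mean_neq0 z : nrm z < 1 -> quadratic_mean z != 0.
Proof.
move=> z1; have [y0|y0] := eqVneq (complex.Im z) 0.
  by rewrite Re_gt0_neq0// Re_quadratic_mean.
apply: contraTneq (Im_quadratic_mean z1 y0) => ->.
by rewrite mulr0 /= mulr0 ltxx.
Qed.

Variable A : R.
Hypothesis A0 : 0 < A.

Definition Fext z : C := A%:C * z * cexp (- logint z).

Definition dFext z : C := A%:C * cexp (- logint z) * (1 - z ^+ 2) * quadratic_mean z.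

Lemma qderiv_Fext z : nrm z < 1 -> qderiv Fext z (dFext z).
Proof.
move=> z1.
have h1 := qderivM (qderiv_cst A%:C z) (qderiv_id z).
have h2 := qderivM h1 (qderiv_cexp (qderivN (qderiv_logint z1))).
rewrite -[dFext z]/(_ * _ * _ * _) -mulrA -logint_derivE//.
by congr (qderiv _ _ _) : h2; rewrite /id; ring.
Qed.

Lemma dFext_neq0 z : nrm z < 1 -> dFext z != 0.
Proof.
move=> z1; rewrite /dFext !mulf_neq0// ?quadratic_mean_neq0 ?cexp_neq0//.
  by rewrite -nrm_gt0 nrm_real normr_gt0 gt_eqF.
rewrite subr_eq0 eq_sym; apply/eqP => h.
have := congr1 nrm h; rewrite expr2 nrmM nrm1 => /eqP.
by rewrite lt_eqF// -expr2 expr_lt1// nrm_ge0.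
Qed.

Lemma Fext0 : Fext 0 = 0.
Proof. by rewrite /Fext mulr0 mul0r. Qed.

Lemma dFext0 : dFext 0 = A%:C.
Proof.
by rewrite /dFext logint0 oppr0 cexp0 quadratic_mean0 expr0n subr0 !mulr1.
Qed.

Lemma Fext_conj z : nrm z < 1 -> Fext z^*%C = (Fext z)^*%C.
Proof.
by move=> z1; rewrite /Fext logint_conj// !conjcM -cexp_conj conjcN conjc_real.
Qed.

End disk_function.

(** * Injectivity *)

Section half_disk_map.
Variables (R : realType) (mu : probability (jacobi_borel R) R)
  (k : probability (measurableTypeR R) R).
Hypotheses (hmu : M0 mu) (hk : density_of_states mu k).
Local Notation C := R[i].
Local Notation nrm := (@Normc.normc R).
Implicit Types (z c : C) (t : R).

Let k1 : k (@I22 R) = 1%E := proj1 hk.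

Definition ipi2 : C := 0 +i* (pi / 2).

Lemma cexp_ipi2 : cexp ipi2 = 'i%C.
Proof.
by apply: complexP; rewrite /cexp /= expR0 ?cos_pihalf ?sin_pihalf ?mulr0 ?mulr1.
Qed.

Lemma lower_logE z t : 0 < complex.Im z ->
  lower_log (t%:C - z) = clog ('i%C * (t%:C - z)) - ipi2.
Proof. by move=> z0; rewrite lower_log_clog// cImD cImN /= add0r oppr_lt0. Qed.

Lemma Re_i_sub z t : complex.Re ('i%C * (t%:C - z)) = complex.Im z.
Proof. by rewrite !ReImE /=; ring. Qed.

Lemma cgood_i_sub z : cgood (fun t => 'i%C * (t%:C - z)).
Proof.
apply: cgoodM; first exact: cgood_cst.
by apply: cgoodD; [exact: cgood_id|exact: cgood_cst].
Qed.

Lemma cgood_clog_i_sub z : 0 < complex.Im z -> cgood (fun t => clog ('i%C * (t%:C - z))).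
Proof.
move=> z0; apply: (cgood_clog z0) (cgood_i_sub z) => t _.
by rewrite Re_i_sub.
Qed.

Lemma cgood_lower_log z : 0 < complex.Im z -> cgood (fun t => lower_log (t%:C - z)).
Proof.
move=> z0; under eq_fun do rewrite lower_logE//.
by apply: cgoodD; [exact: cgood_clog_i_sub|exact: cgood_cst].
Qed.

Lemma wE z : w mu k z = (ln (Amu mu))%:C - cint k (fun t => lower_log (t%:C - z)).
Proof. by []. Qed.

Lemma Re_w_lt0 z : 0 < complex.Im z -> complex.Re (w mu k z) < 0.
Proof.
move=> z0; have := lyapunov_gt0 hmu hk z0.
have g := cgood_lower_log z0.
have -> : complex.Re (w mu k z) = ln (Amu mu) - complex.Re (cint k (fun t => lower_log (t%:C - z))).
  by rewrite wE cReD cReN.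
suff -> : (\int[k]_(t in @I22 R) ln (nsq (z - t%:C)))%R =
    2 * complex.Re (cint k (fun t => lower_log (t%:C - z))) by lra.
rewrite /= -RintegralZl; [|exact: measurable_I22|exact: cgood_Re g].
apply: eq_Rintegral => t _; rewrite /lower_log /=.
have n0 : 0 < nrm (t%:C - z).
  rewrite nrm_gt0; apply/eqP => h; have := congr1 (@complex.Im R) h.
  by rewrite cImD cImN /= add0r => /eqP; rewrite oppr_eq0 gt_eqF.
have -> : nsq (z - t%:C) = nrm (t%:C - z) ^+ 2.
  by rewrite nrm_sqr /nsq !ReImE; ring.
by rewrite lnXn// mulr_natl.
Qed.

(** The argument of t - z increases with t, so its values at t = -2 and t = 2 bound it strictly
    inside ]-pi, 0[ uniformly; strictness then survives integration. *)
Lemma Im_w_bounds z : 0 < complex.Im z -> 0 < complex.Im (w mu k z) < pi.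
Proof.
move=> z0; set I := complex.Im (cint k (fun t => lower_log (t%:C - z))).
have -> : complex.Im (w mu k z) = - I by rewrite wE cImD cImN /= add0r.
have Im_log t : complex.Im (lower_log (t%:C - z)) = atan ((t - complex.Re z) / complex.Im z) - pi / 2.
  rewrite lower_logE// cImD cImN /=; congr (atan (_ / _) - _); by rewrite !ReImE /=; ring.
have g := cgood_lower_log z0.
have mono (a b : R) : a <= b -> atan ((a - complex.Re z) / complex.Im z) <= atan ((b - complex.Re z) / complex.Im z).
  by move=> ab; apply: le_atan; rewrite ler_wpM2r ?invr_ge0 ?(ltW z0)// lerB.
have h1 := Im_cint_ge k1 (x := atan ((- 2 - complex.Re z) / complex.Im z) - pi / 2) g.
have h2 := Im_cint_ge k1 (x := pi / 2 - atan ((2 - complex.Re z) / complex.Im z)) (cgoodN g).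
rewrite cintN// cImN -/I in h2.
have {}h1 : atan ((- 2 - complex.Re z) / complex.Im z) - pi / 2 <=
    I.
  apply: h1 => t; rewrite ler_norml => /andP[t1 t2].
  by rewrite Im_log; have := mono _ _ t1; lra.
have {}h2 : pi / 2 - atan ((2 - complex.Re z) / complex.Im z) <=
    - I.
  apply: h2 => t; rewrite ler_norml => /andP[t1 t2].
  by rewrite cImN Im_log; have := mono _ _ t2; lra.
have := atan_ltpi2 ((2 - complex.Re z) / complex.Im z).
have := atan_gtNpi2 ((- 2 - complex.Re z) / complex.Im z).
by move=> h3 h4; apply/andP; split; lra.
Qed.

Lemma Im_zmap z : complex.Im (zmap z) = complex.Im z * ((nsq z)^-1 - 1).
Proof.
rewrite /zmap cImD !cImN cinvE cImM; case: z => a b /=; ring.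
Qed.

Lemma Im_zmap_gt0 z : nrm z < 1 -> 0 < complex.Im z -> 0 < complex.Im (zmap z).
Proof.
move=> z1 z0; rewrite Im_zmap mulr_gt0// subr_gt0 invf_gt1 -?nrm_lt1_nsq//.
by apply: nsq_gt0; apply: contraTneq z0 => ->; rewrite ltxx.
Qed.

(** The logarithm of t - z(zeta) = (1 + t zeta + zeta^2) / zeta, where - i zeta is in the right half
    plane. The arguments of the two sides differ by less than 2 pi, so comparing exponentials
    suffices. *)
Lemma lower_log_zmap z t : nrm z < 1 -> 0 < complex.Im z -> `|t| <= 2 ->
  lower_log (t%:C - zmap z) = log_quadratic z t - (clog (- 'i%C * z) + ipi2).
Proof.
move=> z1 z0 t2; have z00 : z != 0 by apply: contraTneq z0 => ->; rewrite ltxx.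
have n1 := nrm_joukowski t2; have n2 := etrans (nrm_conj _) n1.
have r0 : 0 < 1 - nrm z by rewrite subr_gt0.
have p1 := lt_le_trans r0 (Re_1sub_ge z n1); have p2 := lt_le_trans r0 (Re_1sub_ge z n2).
have p3 : 0 < complex.Re (- 'i%C * z) by rewrite !ReImE /= oppr0 mul0r sub0r mulN1r opprK.
have Im_neg : complex.Im (t%:C - zmap z) < 0.
  by rewrite cImD cImN /= add0r oppr_lt0 Im_zmap_gt0.
have [e1 e2 e3] := lower_logP Im_neg.
apply: cexp_inj_strip.
  have := Im_clog (1 - z * joukowski t); have := Im_clog (1 - z * (joukowski t)^*%C).
  have := Im_clog (- 'i%C * z); have := pi_gt0 R.
  rewrite !cImD !cImN cImD -mulr_natl !ltr_norml [complex.Im ipi2]/= => h0 /andP[h1 h2] /andP[h3 h4] /andP[h5 h6].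
  by apply/andP; split; lra.
rewrite e1 cexpD cexpN !cexpD !clogK// cexp_ipi2 quadratic_joukowski// /zmap.
have -> : (- 'i%C * z) * 'i%C = z by rewrite mulrAC mulNr -expr2 sqr_i opprK mul1r.
by field.
Qed.

Lemma Fmap_Fext z : half_disk z -> Fmap mu k z = Fext k (Amu mu) z.
Proof.
rewrite /half_disk /disk /= normc_complexE ltcR => -[z1 z0].
have p3 : 0 < complex.Re (- 'i%C * z) by rewrite !ReImE /= oppr0 mul0r sub0r mulN1r opprK.
rewrite /Fmap wE (@eq_cint _ k _ (fun t => log_quadratic z t - (clog (- 'i%C * z) + ipi2))); last first.
  by move=> t; exact: lower_log_zmap.
rewrite cintB; [|exact: cgood_log_quadratic|exact: cgood_cst].
rewrite cint_cst// opprB addrCA !cexpD clogK// cexp_ipi2 /Fext -/(logint k z).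
have -> : cexp (ln (Amu mu))%:C = (Amu mu)%:C.
  by apply: complexP; rewrite /cexp /= ?cos0 ?sin0 ?mulr0 ?mulr1 // lnK// posrE expR_gt0.
have -> : (- 'i%C * z) * 'i%C = z by rewrite mulrAC mulNr -expr2 sqr_i opprK mul1r.
ring.
Qed.

Lemma half_disk_Fmap z : half_disk z -> half_disk (Fmap mu k z).
Proof.
rewrite /half_disk /disk /= !normc_complexE !ltcR => -[z1 z0].
have z0' := Im_zmap_gt0 z1 z0.
split; first by rewrite /Fmap nrm_cexp expR_lt1 Re_w_lt0.
by rewrite /Fmap /cexp /= mulr_gt0 ?expR_gt0// sin_gt0_pi// Im_w_bounds.
Qed.

End half_disk_map.

(** * Bounds and injectivity on the whole disk *)

Section extension.
Variables (R : realType) (mu : probability (jacobi_borel R) R)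
  (k : probability (measurableTypeR R) R).
Hypotheses (hmu : M0 mu) (hk : density_of_states mu k).
Local Notation C := R[i].
Local Notation nrm := (@Normc.normc R).
Implicit Types (z c : C) (t : R).

Let k1 : k (@I22 R) = 1%E := proj1 hk.
Let A0 : 0 < Amu mu := expR_gt0 _.
Local Notation F := (Fext k (Amu mu)).

Lemma half_diskE z : half_disk z <-> nrm z < 1 /\ 0 < complex.Im z.
Proof. by rewrite /half_disk /disk /= normc_complexE ltcR. Qed.

Lemma half_disk_Fext z : nrm z < 1 -> 0 < complex.Im z ->
  nrm (F z) < 1 /\ 0 < complex.Im (F z).
Proof.
move=> z1 z0; have h : half_disk z by apply/half_diskE.
by apply/half_diskE; rewrite -(Fmap_Fext hk h); exact: half_disk_Fmap.
Qed.

Lemma conj_half_disk_Fext z : nrm z < 1 -> complex.Im z < 0 ->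
  nrm (F z) < 1 /\ complex.Im (F z) < 0.
Proof.
move=> z1 z0; have z1' : nrm z^*%C < 1 by rewrite nrm_conj.
have z0' : 0 < complex.Im z^*%C by case: z z0 {z1 z1'} => a b; rewrite oppr_gt0.
have [] := half_disk_Fext z1' z0'; rewrite Fext_conj// nrm_conj => h1 h2; split => //.
by move: h2; case: (F z) => a b; rewrite oppr_gt0.
Qed.

Lemma real_conj z : complex.Im z = 0 <-> z^*%C = z.
Proof.
case: z => a b /=; split => [->|[h]]; first by rewrite oppr0.
by apply/eqP; rewrite -(eqNr b) h.
Qed.

Lemma Im_Fext_real z : nrm z < 1 -> complex.Im z = 0 -> complex.Im (F z) = 0.
Proof. by move=> z1 /real_conj h; apply/real_conj; rewrite -Fext_conj// h. Qed.

Lemma complex_real z : complex.Im z = 0 -> z = (complex.Re z)%:C.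
Proof. by case: z => a b /= ->. Qed.

Lemma Re_dFext_real z : nrm z < 1 -> complex.Im z = 0 ->
  0 < complex.Re (dFext k (Amu mu) z).
Proof.
move=> z1 z0; have h0 : complex.Im (logint k z) = 0.
  by apply/real_conj; rewrite -logint_conj// (proj1 (real_conj z) z0).
have E : (Amu mu)%:C * cexp (- logint k z) * (1 - z ^+ 2) =
    (Amu mu * expR (- complex.Re (logint k z)) * (1 - complex.Re z ^+ 2))%:C.
  have -> : cexp (- logint k z) = (expR (- complex.Re (logint k z)))%:C.
    move: (logint k z) h0 => [a b] /= ->.
    by apply: complexP; rewrite /cexp /= oppr0 ?cos0 ?sin0 ?mulr1 ?mulr0.
  have -> : z ^+ 2 = (complex.Re z ^+ 2)%:C by case: (z) z0 => a b /= ->; rewrite rmorphXn.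
  by move: (expR _) (complex.Re z) (Amu mu) => x y a; apply: complexP; rewrite !(expr2, ReImE) /=; ring.
rewrite /dFext E cReM /= mul0r subr0 mulr_gt0//; last exact: Re_quadratic_mean.
rewrite !mulr_gt0 ?expR_gt0// subr_gt0.
by move: z1; rewrite nrm_lt1_nsq /nsq z0 expr0n addr0.
Qed.

Lemma Fext_real_increasing (x y : R) : -1 < x -> x < y -> y < 1 ->
  complex.Re (F x%:C) < complex.Re (F y%:C).
Proof.
move=> x1 xy y1; pose g (s : R) := complex.Re (F (0 + s%:C * 1)).
have dg (s : R) : x <= s <= y -> is_derive s 1 g (complex.Re (dFext k (Amu mu) s%:C)).
  move=> /andP[h1 h2]; have s1 : nrm s%:C < 1.
    by rewrite nrm_real ltr_norml; apply/andP; split; lra.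
  have := @qderiv_line R F 0 1 (dFext k (Amu mu) s%:C) s.
  by rewrite add0r mulr1 mul1r; apply; exact: qderiv_Fext.
have cg : {within `[x, y], continuous g}.
  apply: derivable_within_continuous => s; rewrite in_itv/= => h.
  exact: (ex_derive (is_derive := dg s h)).
have [s|s sI] := MVT_segment (df := fun s => complex.Re (dFext k (Amu mu) s%:C)) (ltW xy) _ cg.
  by rewrite in_itv/= => /andP[h1 h2]; apply: dg; rewrite !ltW.
rewrite /g !add0r !mulr1 => E; move: sI; rewrite in_itv => /andP[/= h1 h2].
rewrite -subr_gt0 {}E; apply: mulr_gt0; last by rewrite subr_gt0.
by apply: Re_dFext_real => //; rewrite nrm_real ltr_norml; apply/andP; split; lra.
Qed.

(** A limit from the upper half disk, where |F| < 1 is known. *)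
Lemma nrm_Fext_real_le1 (x : R) : -1 < x -> x < 1 -> nrm (F x%:C) <= 1.
Proof.
move=> x1 x2; have nx : nrm x%:C < 1 by rewrite nrm_real ltr_norml x1.
have [K [r [r0 K0 h]]] := qderiv_lip (qderiv_Fext k1 (Amu mu) nx).
apply/ler_addgt0Pr => e e0.
(* In order: the Lipschitz bound applies, x + i d stays in the disk, and the error is at most e. *)
pose d := Num.min (Num.min r ((1 - nrm x%:C) / 2)) (e / (K + 1)).
have K1 : 0 < K + 1 by rewrite ltr_wpDl.
have d0 : 0 < d by rewrite !lt_min r0 !divr_gt0// subr_gt0.
have : d <= d by []; rewrite {2}/d !le_min => /andP[/andP[d1 d2] d3].
have nd : nrm (0 +i* d) = d by rewrite nrmE /nsq /= expr0n add0r sqrtr_sqr ger0_norm// ltW.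
have hd := h (0 +i* d); rewrite nd in hd; have {}hd := hd d1.
have [h1 _] : nrm (F (x%:C + 0 +i* d)) < 1 /\ 0 < complex.Im (F (x%:C + 0 +i* d)).
  apply: half_disk_Fext; last by rewrite cImD /= add0r.
  by apply: le_lt_trans (nrmD _ _) _; rewrite nd; lra.
have -> : F x%:C = F (x%:C + 0 +i* d) - (F (x%:C + 0 +i* d) - F x%:C) by ring.
apply: (le_trans (nrmB _ _)); apply: lerD; first exact: ltW.
apply: (le_trans hd); move: d3; rewrite ler_pdivlMr// => d3.
by apply: le_trans d3; rewrite mulrC ler_wpM2l ?(ltW d0)// lerDl.
Qed.

(** F is strictly increasing on ]-1, 1[, so x lies between two points where |F| <= 1 and F(x) can be
    neither 1 nor -1. *)
Lemma nrm_Fext_real_lt1 (x : R) : -1 < x -> x < 1 -> nrm (F x%:C) < 1.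
Proof.
move=> x1 x2; have le1 (y : R) : -1 < y -> y < 1 -> `|complex.Re (F y%:C)| <= 1.
  by move=> y1 y2; apply: le_trans (Re_le_nrm _) _; exact: nrm_Fext_real_le1.
have nx : nrm x%:C < 1 by rewrite nrm_real ltr_norml x1.
have -> : F x%:C = (complex.Re (F x%:C))%:C by apply: complexP => //; exact: Im_Fext_real.
have b1 : -1 < (x - 1) / 2 by lra.
have b2 : (x - 1) / 2 < x by lra.
have b3 : x < (x + 1) / 2 by lra.
have b4 : (x + 1) / 2 < 1 by lra.
have := le1 _ b1 (lt_trans b2 x2); have := le1 _ (lt_trans x1 b3) b4.
rewrite !ler_norml => /andP[_ h1] /andP[h2 _]; rewrite nrm_real ltr_norml; apply/andP; split.
  by apply: (le_lt_trans h2); exact: Fext_real_increasing.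
by apply: lt_le_trans h1; exact: Fext_real_increasing.
Qed.

Lemma real_lt1 z : complex.Im z = 0 -> nrm z < 1 -> -1 < complex.Re z < 1.
Proof. by move=> /complex_real ->; rewrite nrm_real ltr_norml. Qed.

Lemma nrm_Fext_lt1 z : nrm z < 1 -> nrm (F z) < 1.
Proof.
move=> z1; have [z0|z0|z0] := ltgtP (complex.Im z) 0.
- by have [] := conj_half_disk_Fext z1 z0.
- by have [] := half_disk_Fext z1 z0.
- have /andP[h1 h2] := real_lt1 z0 z1.
  by rewrite (complex_real z0) nrm_Fext_real_lt1.
Qed.

Lemma qderiv_clog c : 0 < complex.Re c -> qderiv (@clog R) c c^-1.
Proof.
move=> c0; exists (20 / complex.Re c ^+ 2), (complex.Re c / 2); split.
- by rewrite divr_gt0.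
- by rewrite divr_ge0// sqr_ge0.
- by move=> d; exact: clog_est.
Qed.

(* The argument of Noshiro and Warschawski: the derivative of clog has positive
   real part. *)
Lemma clog_segment_ge c d (m M : R) : 0 < m -> m <= complex.Re c ->
  m <= complex.Re (c + d) -> nrm c + nrm d <= M ->
  nsq d * m / M ^+ 2 <= complex.Re (d^*%C * (clog (c + d) - clog c)).
Proof.
move=> m0 mc mcd hM.
have Re_seg (s : R) : 0 <= s <= 1 -> m <= complex.Re (c + s%:C * d).
  move=> /andP[s0 s1]; move: mc mcd; rewrite !cReD cReM /= mul0r subr0 => h1 h2.
  by nra.
pose f c := d^*%C * clog c.
have df (s : R) : 0 <= s <= 1 ->
    is_derive s 1 (fun s : R => complex.Re (f (c + s%:C * d))) (complex.Re (d * (d^*%C / (c + s%:C * d)))).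
  move=> s01; apply: qderiv_line.
  have := qderivM (qderiv_cst d^*%C (c + s%:C * d)) (qderiv_clog (lt_le_trans m0 (Re_seg s s01))).
  by rewrite mul0r add0r.
have cf : {within `[0 : R, 1], continuous (fun s : R => complex.Re (f (c + s%:C * d)))}.
  apply: derivable_within_continuous => s; rewrite in_itv/= => h.
  exact: (ex_derive (is_derive := df s h)).
have [s|s] := MVT_segment (df := fun s => complex.Re (d * (d^*%C / (c + s%:C * d)))) ler01 _ cf.
  by rewrite in_itv/= => /andP[h1 h2]; apply: df; rewrite !ltW.
rewrite in_itv/= => s01.
rewrite /f mul0r addr0 mul1r subr0 mulr1 -cReN -cReD -mulrBr => ->.
have mp := Re_seg s s01; have p := lt_le_trans m0 mp.
set cs := c + s%:C * d in mp p *.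
have nM : nsq cs <= M ^+ 2.
  rewrite -nrm_sqr lerXn2r ?nnegrE ?nrm_ge0//.
    by apply: le_trans hM; rewrite addr_ge0 ?nrm_ge0.
  apply: le_trans hM; apply: (le_trans (nrmD _ _)); rewrite lerD2l nrmM nrm_real.
  by case/andP: s01 => s0 s1; rewrite ger0_norm// ler_piMl ?nrm_ge0.
have n0 := nsq_gt0 (Re_gt0_neq0 p).
have -> : d * (d^*%C / cs) = (nsq d / nsq cs)%:C * cs^*%C.
  rewrite cinvE rmorphM /= mulrA mulrA; congr (_ * _ * _).
  by apply: complexP; rewrite !ReImE /nsq; case: (d) => a b /=; ring.
rewrite cReM /= mul0r subr0 (_ : complex.Re cs^*%C = complex.Re cs); last by case: (cs).
rewrite mulrAC ler_pM ?mulr_ge0 ?invr_ge0 ?sqr_ge0 ?nsq_ge0 ?(ltW m0)//.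
by rewrite ler_wpM2l ?nsq_ge0// lef_pV2 ?posrE// (lt_le_trans n0).
Qed.

(** If the values agree, the integral of clog (i (t - z')) - clog (i (t - z)) is 0. With c = i (z -
    z'), the conjugate of c times this integrand has real part at least |c|^2 m / M^2 > 0 for all
    |t| <= 2, a contradiction. *)
Lemma w_inj z z' : 0 < complex.Im z -> 0 < complex.Im z' ->
  w mu k z = w mu k z' -> z = z'.
Proof.
move=> z0 z'0; rewrite !wE => /addrI/oppr_inj E; apply/eqP; apply: contraT => zz.
pose c := 'i%C * (z - z'); pose M := 2 + nrm z + nrm c.
have cE t : 'i%C * (t%:C - z') = 'i%C * (t%:C - z) + c by rewrite /c; ring.
have g := cgood_clog_i_sub z0; have g' := cgood_clog_i_sub z'0.
have c0 : 0 < nsq c.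
  rewrite nsq_gt0// mulf_neq0 ?subr_eq0//.
  by rewrite -nsq_eq0 /nsq /= expr0n expr1n add0r oner_eq0.
have M0 : 0 < M by rewrite /M -addrA ltr_wpDr// addr_ge0 ?nrm_ge0.
pose m := Num.min (complex.Im z) (complex.Im z').
have m0 : 0 < m by rewrite lt_min z0.
have e0 : 0 < nsq c * m / M ^+ 2 by rewrite divr_gt0 ?exprn_gt0// mulr_gt0.
have gd : cgood (fun t => clog ('i%C * (t%:C - z')) - clog ('i%C * (t%:C - z))).
  by apply: cgoodD => //; exact: cgoodN.
have := Re_cint_ge k1 (x := nsq c * m / M ^+ 2) (cgoodM (cgood_cst c^*%C) gd).
rewrite cintZ// cintB//.
have -> : cint k (fun t => clog ('i%C * (t%:C - z'))) = cint k (fun t => clog ('i%C * (t%:C - z))).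
  apply: (addIr (- ipi2 R)); rewrite -(cint_cst k1 (ipi2 R)) -!cintB//; try exact: cgood_cst.
  by rewrite (eq_cint k (fun t _ => esym (lower_logE t z'0))) (eq_cint k (fun t _ => esym (lower_logE t z0))).
rewrite subrr mulr0 => H; suff : nsq c * m / M ^+ 2 <= 0 by rewrite leNgt e0.
apply: H => t t2.
rewrite cE clog_segment_ge//.
- by rewrite Re_i_sub ge_min lexx.
- by rewrite -cE Re_i_sub ge_min lexx orbT.
- rewrite /M lerD2r nrmM (_ : nrm 'i%C = 1) ?mul1r; last by rewrite nrmE /nsq /= expr0n expr1n add0r sqrtr1.
  by apply: (le_trans (nrmB _ _)); rewrite nrm_real lerD2r.
Qed.

Lemma zmap_inj z z' : nrm z < 1 -> nrm z' < 1 -> z != 0 -> z' != 0 ->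
  zmap z = zmap z' -> z = z'.
Proof.
move=> z1 z'1 z0 z'0 E.
have : (z - z') * (1 - z * z') = 0.
  have -> : (z - z') * (1 - z * z') = z * z' * (zmap z - zmap z').
    by rewrite /zmap; field; rewrite z0 z'0.
  by rewrite E subrr mulr0.
move=> /eqP; rewrite mulf_eq0 => /orP[|]; first by rewrite subr_eq0 => /eqP.
rewrite subr_eq0 => /eqP/(congr1 nrm); rewrite nrm1 nrmM => h.
suff : nrm z * nrm z' < 1 by rewrite -h ltxx.
by have := nrm_ge0 z; have := nrm_ge0 z'; nra.
Qed.

(** A composition of three injective maps: [zmap], w, and [cexp] on the strip 0 < Im < pi that
    contains the values of w. *)
Lemma Fext_inj_half z z' : nrm z < 1 -> nrm z' < 1 -> 0 < complex.Im z ->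
  0 < complex.Im z' -> F z = F z' -> z = z'.
Proof.
move=> z1 z'1 z0 z'0.
have h : half_disk z by apply/half_diskE.
have h' : half_disk z' by apply/half_diskE.
have i0 := Im_zmap_gt0 z1 z0; have i'0 := Im_zmap_gt0 z'1 z'0.
rewrite -(Fmap_Fext hk h) -(Fmap_Fext hk h') => /cexp_inj_strip E.
have nz c : 0 < complex.Im c -> c != 0 by apply: contraTneq => ->; rewrite ltxx.
apply: zmap_inj; rewrite ?nz//; apply: w_inj => //; apply: E.
have /andP[h1 h2] := Im_w_bounds hk i0; have /andP[h3 h4] := Im_w_bounds hk i'0.
by rewrite -mulr_natl ltr_norml; apply/andP; split; lra.
Qed.

Lemma Fext_inj z z' : nrm z < 1 -> nrm z' < 1 -> F z = F z' -> z = z'.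
Proof.
move=> z1 z'1 E; have EI := congr1 (@complex.Im R) E.
have [z0|z0|z0] := ltgtP (complex.Im z) 0; have [z'0|z'0|z'0] := ltgtP (complex.Im z') 0.
- apply: (can_inj (@conjcK R)); apply: Fext_inj_half; rewrite ?nrm_conj//.
  + by case: (z) z0 => a b; rewrite oppr_gt0.
  + by case: (z') z'0 => a b; rewrite oppr_gt0.
  + by rewrite !Fext_conj// E.
- have [_ h1] := conj_half_disk_Fext z1 z0; have [_ h2] := half_disk_Fext z'1 z'0.
  by move: (lt_trans h1 h2); rewrite EI ltxx.
- by have [_] := conj_half_disk_Fext z1 z0; rewrite EI Im_Fext_real// ltxx.
- have [_ h1] := half_disk_Fext z1 z0; have [_ h2] := conj_half_disk_Fext z'1 z'0.
  by move: (lt_trans h2 h1); rewrite EI ltxx.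
- exact: Fext_inj_half.
- by have [_] := half_disk_Fext z1 z0; rewrite EI Im_Fext_real// ltxx.
- by have [_] := conj_half_disk_Fext z'1 z'0; rewrite -EI Im_Fext_real// ltxx.
- by have [_] := half_disk_Fext z'1 z'0; rewrite -EI Im_Fext_real// ltxx.
- have /andP[h1 h2] := real_lt1 z0 z1; have /andP[h3 h4] := real_lt1 z'0 z'1.
  move: E; rewrite (complex_real z0) (complex_real z'0) => /(congr1 (@complex.Re R)) E.
  have [h|h|->//] := ltgtP (complex.Re z) (complex.Re z').
    by have := Fext_real_increasing h1 h h4; rewrite E ltxx.
  by have := Fext_real_increasing h3 h h2; rewrite E ltxx.
Qed.

End extension.

(** * Open image and conclusion *)

Section open_image.
Variable R : realType.
Local Notation C := R[i].
Local Notation nrm := (@Normc.normc R).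
Implicit Types (z w d : C) (f : C -> C).

(** A damped Newton step: moving z by s (w - f z) / l shrinks the distance to w by the factor 1 - s,
    up to an error quadratic in s. *)
Lemma qderiv_descent f z l w : qderiv f z l -> l != 0 -> f z != w ->
  forall e : R, 0 < e -> exists2 d, nrm d <= e & nrm (f (z + d) - w) < nrm (f z - w).
Proof.
move=> [K [r [r0 K0 h]]] l0 fw e e0; set a := w - f z.
have n0 : 0 < nrm a by rewrite nrm_gt0 subr_eq0 eq_sym.
have nE : nrm (f z - w) = nrm a by rewrite -opprB nrmN.
have b0 : 0 < nrm (a / l) by rewrite nrm_gt0 mulf_neq0 ?invr_eq0// -nrm_gt0.
set b := nrm (a / l) in b0.
(* With step length s b, the middle bounds keep it below r and e; the last one keeps the quadratic
   error K s^2 b^2 below s |a| / 2. *)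
pose s := Num.min (Num.min 1 (Num.min (r / b) (e / b))) (nrm a / (2 * (K + 1) * b ^+ 2)).
have q0 : 0 < 2 * (K + 1) * b ^+ 2 by rewrite !mulr_gt0 ?exprn_gt0// ltr_wpDl.
have s0 : 0 < s by rewrite !lt_min ltr01 !divr_gt0.
have : s <= s by []; rewrite {2}/s !le_min => /andP[/andP[s1 /andP[s2 s3]] s4].
exists (s%:C * (a / l)); first by rewrite nrmM nrm_real gtr0_norm// -ler_pdivlMr.
have dr : nrm (s%:C * (a / l)) <= r by rewrite nrmM nrm_real gtr0_norm// -ler_pdivlMr.
have hd := h _ dr; rewrite nE.
have -> : f (z + s%:C * (a / l)) - w = (f (z + s%:C * (a / l)) - f z - s%:C * (a / l) * l) - (1 - s)%:C * a.
  by rewrite mulrA divfK// rmorphB rmorph1 /a; ring.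
apply: (le_lt_trans (nrmB _ _)).
rewrite [nrm (_%:C * a)]nrmM nrm_real ger0_norm ?subr_ge0//.
have hs : nsq (s%:C * (a / l)) = s * (s * b ^+ 2).
  by rewrite nsqE_nrm nrmM nrm_real gtr0_norm// -/b; ring.
rewrite hs in hd; move: s4; rewrite ler_pdivlMr// => s4.
have h5 : 2 * (K * (s * (s * b ^+ 2))) < s * nrm a.
  have : s * (s * (2 * (K + 1) * b ^+ 2)) <= s * nrm a by rewrite ler_wpM2l// ltW.
  have : 0 < s * (s * b ^+ 2) by rewrite !mulr_gt0// exprn_gt0.
  lra.
have : 0 < s * nrm a by rewrite mulr_gt0.
lra.
Qed.

(** The minimum is sought over R * R, where squares and their boundaries are compact as products of
    segments. *)
Definition square_point (p : R * R) : C := p.1 +i* p.2.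

Lemma qderiv_dist_continuous f z w l (p : R * R) :
  qderiv f (z + square_point p) l ->
  {for p, continuous (fun p => nrm (f (z + square_point p) - w))}.
Proof.
move=> /qderiv_lip[K [r [r0 K0 h]]].
apply/cvgrPdist_le => /= e e0.
have K1 : 0 < 2 * (K + 1) by rewrite mulr_gt0// ltr_wpDl.
have e1 : 0 < Num.min (r / 2) (e / (2 * (K + 1))) by rewrite lt_min !divr_gt0.
have hb : nbhs p (ball p (Num.min (r / 2) (e / (2 * (K + 1))))) by exact: nbhsx_ballx.
apply: filterS hb => q [/= q1 q2].
move: q1 q2; rewrite -!ball_normE /= !lt_min => /andP[q1 q2] /andP[q3 q4].
pose d := square_point q - square_point p.
have dE : nrm d <= `|p.1 - q.1| + `|p.2 - q.2|.
  by apply: (le_trans (nrm_le d)); rewrite /d !ReImE /= distrC lerD2l distrC.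
have -> : z + square_point q = z + square_point p + d by rewrite /d; ring.
have dr : nrm d <= r by apply: (le_trans dE); lra.
have hd := h d dr.
set u := f (z + square_point p + d) in hd *; set v := f _ in hd *.
have h1 : nrm (u - w) <= nrm (v - w) + nrm (u - v).
  by rewrite (_ : u - w = (v - w) + (u - v)); [exact: nrmD|ring].
have h2 : nrm (v - w) <= nrm (u - w) + nrm (u - v).
  by rewrite (_ : v - w = (u - w) - (u - v)); [exact: nrmB|ring].
have h3 : nrm (u - v) <= e.
  apply: (le_trans hd); move: q2 q4; rewrite !ltr_pdivlMr// => q2 q4.
  have : nrm d * (K + 1) <= (`|p.1 - q.1| + `|p.2 - q.2|) * (K + 1) by rewrite ler_wpM2r// addr_ge0.
  by have := nrm_ge0 d; lra.
by rewrite ler_norml; apply/andP; split; lra.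
Qed.

Definition square (r : R) : set (R * R) := `[- r, r]%classic `*` `[- r, r]%classic.

Definition square_boundary (r : R) : set (R * R) :=
  ([set - r] `|` [set r]) `*` `[- r, r]%classic `|` `[- r, r]%classic `*` ([set - r] `|` [set r]).

Lemma compact_square r : compact (square r).
Proof. by apply: compact_setX; exact: segment_compact. Qed.

Lemma compact_square_boundary r : compact (square_boundary r).
Proof.
have c2 : compact ([set - r] `|` [set r]) by apply: compactU; exact: compact_set1.
by apply: compactU; apply: compact_setX => //; exact: segment_compact.
Qed.

Lemma square_boundary_sub r p : 0 <= r -> square_boundary r p -> square r p.
Proof.
move=> r0; have h1 : `[- r, r]%classic r by rewrite /= in_itv/= lexx andbT ge0_cp.
have h2 : `[- r, r]%classic (- r) by rewrite /= in_itv/= lexx ge0_cp.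
by case: p => x y; rewrite /square_boundary /square /= => -[[[->|->] hy]|[hx [->|->]]].
Qed.

Lemma square_nrm r p : square r p -> nrm (square_point p) <= 2 * r.
Proof.
case: p => x y [hx hy]; apply: (le_trans (nrm_le _)) => /=.
by move: hx hy; rewrite /= !in_itv /= -!ler_norml; lra.
Qed.

(* At an interior minimum over a small square of |f - w| the derivative
   vanishes unless f takes the value w. *)
Lemma open_image f (l : C -> C) (U : set C) z0 (e : R) :
  0 < e -> (forall d, nrm d <= e -> U (z0 + d)) ->
  (forall z, U z -> qderiv f z (l z)) -> (forall z, U z -> l z != 0) ->
  (forall z z', U z -> U z' -> f z = f z' -> z = z') ->
  exists2 m : R, 0 < m & forall w, nrm (w - f z0) < m -> exists2 z, U z & f z = w.
Proof.
(* Points of the square satisfy |x + i y| <= |x| + |y| <= 2 r = e. *)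
move=> e0 hU df l0 finj; pose r := e / 2.
have r0 : 0 < r by rewrite divr_gt0.
have sqU p : square r p -> U (z0 + square_point p).
  by move=> /square_nrm h; apply: hU; apply: (le_trans h); rewrite /r; lra.
have cont w p : square r p -> {for p, continuous (fun p => nrm (f (z0 + square_point p) - w))}.
  by move=> /sqU h; apply: qderiv_dist_continuous; exact: df.
have bn0 : square_boundary r !=set0.
  by exists (r, r); left; split => /=; [right|rewrite in_itv/= lexx andbT ge0_cp// ltW].
have cb w : {within square_boundary r, continuous (fun p => nrm (f (z0 + square_point p) - w))}.
  by apply: continuous_in_subspaceT => p; rewrite inE => /(square_boundary_sub (ltW r0)); exact: cont.
have cs w : {within square r, continuous (fun p => nrm (f (z0 + square_point p) - w))}.
  by apply: continuous_in_subspaceT => p; rewrite inE; exact: cont.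
have [b bb hb] := compact_EVT_min bn0 (@compact_square_boundary r) (cb (f z0)).
rewrite inE in bb.
have Uz0 : U z0 by have := hU 0; rewrite addr0 nrm0; apply; exact: ltW.
have m0 : 0 < nrm (f (z0 + square_point b) - f z0).
  rewrite nrm_gt0 subr_eq0; apply/eqP => /finj h.
  have /h : U (z0 + square_point b) by apply: sqU; exact: square_boundary_sub (ltW r0) bb.
  move=> /(_ Uz0)/eqP; rewrite -subr_eq0 addrAC subrr add0r => /eqP.
  have bb' : (b.1 = - r :> R \/ b.1 = r :> R) \/ (b.2 = - r :> R \/ b.2 = r :> R).
    by case: bb => -[? ?]; [left|right].
  move=> E; have [hx hy] : (b.1 = 0 :> R) /\ (b.2 = 0 :> R).
    by split; [have := congr1 (@complex.Re R) E|have := congr1 (@complex.Im R) E].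
  by move: bb'; rewrite hx hy => -[[|]|[|]]; lra.
set m := nrm _ in m0.
(* Here m > 0 is the minimum of |f - f z0| on the boundary. If |w - f z0| < m / 2, then |f - w|
   exceeds m / 2 on the boundary and is below it at the centre, so the minimum is interior. *)
exists (m / 2); first by rewrite divr_gt0.
move=> w hw; have sn0 : square r !=set0 by exists (0, 0); split; rewrite /= in_itv/=; apply/andP; split; lra.
have [p ps hp] := compact_EVT_min sn0 (@compact_square r) (cs w).
rewrite inE in ps.
have p0 : nrm (f (z0 + square_point p) - w) < m / 2.
  apply: le_lt_trans (_ : nrm (f z0 - w) < m / 2); last by rewrite -opprB nrmN.
  have := hp (0, 0); rewrite (_ : square_point (0, 0) = 0)// addr0; apply.
  by rewrite inE; split; rewrite /= in_itv/=; apply/andP; split; lra.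
have pnb : ~ square_boundary r p.
  move=> pb; have : m <= nrm (f (z0 + square_point p) - f z0) by apply: hb; rewrite inE.
  have -> : f (z0 + square_point p) - f z0 = (f (z0 + square_point p) - w) + (w - f z0) by ring.
  by have := nrmD (f (z0 + square_point p) - w) (w - f z0); lra.
exists (z0 + square_point p); first exact: sqU.
apply/eqP; apply: contraT => fw.
case: p ps hp p0 pnb fw => x y [/=]; rewrite !in_itv /= => /andP[x1 x2] /andP[y1 y2] hp p0 pnb fw.
have {}x1 : - r < x.
  rewrite lt_neqAle x1 andbT; apply/eqP => E; apply: pnb; left; split => /=; first by left.
  by rewrite in_itv/= y1.
have {}x2 : x < r.
  rewrite lt_neqAle x2 andbT; apply/eqP => E; apply: pnb; left; split => /=; first by right.
  by rewrite in_itv/= y1.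
have {}y1 : - r < y.
  rewrite lt_neqAle y1 andbT; apply/eqP => E; apply: pnb; right; split => /=; last by left.
  by rewrite in_itv/= !ltW.
have {}y2 : y < r.
  rewrite lt_neqAle y2 andbT; apply/eqP => E; apply: pnb; right; split => /=; last by right.
  by rewrite in_itv/= !ltW.
(* The distance to the boundary: a descent step of this length stays in the square and contradicts
   minimality. *)
pose s := Num.min (Num.min (x + r) (r - x)) (Num.min (y + r) (r - y)).
have s0 : 0 < s by rewrite !lt_min; apply/andP; split; apply/andP; split; lra.
have Uz : U (z0 + square_point (x, y)).
  by apply: sqU; split; rewrite /= in_itv/= !ltW.
have [[u v] du] := qderiv_descent (df _ Uz) (l0 _ Uz) fw s0.
have := hp (x + u, y + v); rewrite (_ : square_point (x + u, y + v) = square_point (x, y) + (u +i* v))//.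
rewrite addrA ltNge => ->//; rewrite inE.
have := le_trans (Re_le_nrm _) du; have := le_trans (Im_le_nrm _) du.
rewrite /= !ler_norml => /andP[v1 v2] /andP[u1 u2].
have : s <= s by []; rewrite {2}/s !le_min => /andP[/andP[s1 s2] /andP[s3 s4]].
by split; rewrite /= in_itv/=; apply/andP; split; lra.
Qed.

End open_image.

(** * The disk is open and connected *)

Section disk_topology.
Variable R : realType.
Local Notation C := R[i].
Local Notation nrm := (@Normc.normc R).

Lemma diskE (z : C) : disk z <-> nrm z < 1.
Proof. by rewrite /disk /= normc_complexE ltcR. Qed.

Lemma complex_gt0 (e : C) : 0 < e -> e = (complex.Re e)%:C /\ 0 < complex.Re e.
Proof. by case: e => a b; rewrite ltcE /= => /andP[/eqP-> a0]. Qed.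

Lemma open_nrm (U : set C^o) : (forall z, U z -> exists2 e : R, 0 < e &
  forall z', nrm (z' - z) < e -> U z') -> open U.
Proof.
move=> h; rewrite openE => z /h[e e0 he]; apply/nbhs_ballP.
exists e%:C; first by rewrite /= ltcR.
move=> z'; rewrite -ball_normE /= distrC normc_complexE ltcR; exact: he.
Qed.

Lemma disk_open : open (@disk R).
Proof.
apply: open_nrm => z /diskE z1; exists (1 - nrm z); first by rewrite subr_gt0.
move=> z' h; apply/diskE; rewrite -(subrK z z').
by apply: (le_lt_trans (nrmD _ _)); rewrite -ltrBrDr.
Qed.

Lemma continuous_ray (z : C) : continuous ((fun s : R => s%:C * z) : R -> C^o).
Proof.
move=> s; apply/cvgrPdist_lt => _/posnumP[e].
have [-> r0] := complex_gt0 (gt0 e); set r := complex.Re _ in r0 *.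
have n1 : 0 < nrm z + 1 by rewrite ltr_wpDl ?nrm_ge0.
have /nbhs_ballP h : exists2 d : R, 0 < d & ball s d `<=` [set s' | `|s%:C * z - s'%:C * z : C^o| < r%:C].
  exists (r / (nrm z + 1)); first by rewrite divr_gt0.
  move=> s'; rewrite -ball_normE /= ltr_pdivlMr// => h.
  rewrite -mulrBl -rmorphB /= normc_complexE ltcR nrmM nrm_real.
  by apply: le_lt_trans h; rewrite ler_wpM2l// lerDl.
exact: h.
Qed.

Lemma disk_connected : connected (@disk R).
Proof.
have -> : @disk R = \bigcup_(z in disk) ((fun s : R => s%:C * z) @` `[0, 1]%classic).
  apply/seteqP; split => [z hz|z [z' /diskE hz' [s hs <-]]].
    by exists z => //; exists 1; rewrite ?mul1r//= in_itv/= ler01 lexx.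
  apply/diskE; rewrite nrmM nrm_real; apply: le_lt_trans hz'.
  by move: hs; rewrite /= in_itv/= => /andP[s0 s1]; rewrite ger0_norm// ler_piMl ?nrm_ge0.
apply: bigcup_connected.
  exists 0 => z _; exists 0; rewrite ?mul0r//= in_itv/= ler01 lexx//.
move=> z _; apply: connected_continuous_connected; first exact: segment_connected.
by apply: continuous_subspaceT; exact: continuous_ray.
Qed.

End disk_topology.

Theorem proposition2p4 (R : realType)
    (mu : probability (jacobi_borel R) R)
    (k : probability (measurableTypeR R) R)
    (hmu : M0 mu) (hk : density_of_states mu k) :
  (forall zeta : R[i]^o, half_disk zeta -> half_disk (Fmap mu k zeta)) /\
  exists F : R[i]^o -> R[i]^o,
    (forall zeta, half_disk zeta -> F zeta = Fmap mu k zeta) /\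
    holomorphic_on disk F /\
    (forall zeta : R[i], disk zeta -> F zeta^* = (F zeta)^*) /\
    conformal_map disk (F @` disk) F /\
    F @` disk `<=` disk /\
    F 0 = 0 /\
    'D_1 F 0 = (Amu mu)%:C.
Proof.
have k1 := proj1 hk; have A0 : 0 < Amu mu := expR_gt0 _.
pose F : R[i]^o -> R[i]^o := Fext k (Amu mu).
have dF z : disk z -> qderiv F z (dFext k (Amu mu) z).
  by move=> /diskE; exact: qderiv_Fext.
have hF : holomorphic_on disk F.
  by move=> z /dF/qderiv_is_derive h; exact: ex_derive.
have inj z z' : disk z -> disk z' -> F z = F z' -> z = z'.
  by move=> /diskE h /diskE h'; exact: Fext_inj.
split; first exact: half_disk_Fmap.
exists F; split; first by move=> z /(Fmap_Fext hk) ->.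
split => //; split; first by move=> z /diskE; exact: Fext_conj.
split; last split; last split.
- split => //.
  + by split; [exact: disk_open|exact: disk_connected].
  + split.
      apply: open_nrm => _ [z /[dup] hz /diskE z1 <-].
      have e0 : 0 < (1 - Normc.normc z) / 2 by rewrite divr_gt0// subr_gt0.
      have [|||m m0 hm] := @open_image _ F (dFext k (Amu mu)) disk z _ e0 _ dF.
      * move=> d hd; apply/diskE; apply: (le_lt_trans (nrmD _ _)); lra.
      * by move=> z' /diskE; exact: dFext_neq0.
      * exact: inj.
      by exists m => // w /hm[z' hz' <-]; exists z'.
    apply: connected_continuous_connected; first exact: disk_connected.
    apply: continuous_in_subspaceT => z; rewrite inE => /dF; exact: qderiv_continuous.
  + split => [z hz|z z'|_ [z hz <-]]; [by exists z|by rewrite !inE; exact: inj|by exists z].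
- by move=> _ [z /diskE z1 <-]; apply/diskE; exact: nrm_Fext_lt1.
- exact: Fext0.
- have h0 : disk (0 : R[i]) by apply/diskE; rewrite nrm0 ltr01.
  by have := derive_val (is_derive := qderiv_is_derive (dF 0 h0)); rewrite dFext0.
Qed.
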